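(* Define the weight-$5$ eta quotients on the upper half-plane $$h(\tau)=\frac{\eta(8\tau)^{38}}{\eta(4\tau)^{14}\eta(16\tau)^{14}},\quad u(\tau)=\frac{\eta(4\tau)^{14}}{\eta(8\tau)^4},\quad v(\tau)=\frac{\eta(2\tau)^{14}}{\eta(\tau)^4},\quad g(\tau)=\eta(\tau)^4\eta(2\tau)^2\eta(4\tau)^4 .$$ Their critical $L$-values satisfy $$L(h,4)=\frac{\pi}{4}L(h,3)=\frac{\pi^2}{32}L(h,2)=\frac{\pi^3}{384}L(h,1),$$ $$L(u,4)=\frac{\pi}{3}L(u,3)=\frac{\pi^2}{8}L(u,2)=\frac{5\pi^3}{72}L(u,1),$$ and $$L(v,4)=\frac{3\pi}{10}L(v,3)=\frac{\pi^2}{10}L(v,2)=\frac{\pi^3}{20}L(v,1).$$ Moreover, $$L(u,4)=\frac{2\sqrt{2}}{3}L(h,4),\qquad L(v,4)=\frac{6}{5}L(u,4).$$ The critical values of $g$ satisfy $$L(g,4)=\frac{2\pi}{5}L(g,3)=\frac{\pi^2}{5}L(g,2)=\frac{\pi^3}{6}L(g,1).$$ In particular, $$L(h,4)=\frac{15}{8\sqrt{2}}L(g,4).$$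
   Context: With $q=e^{2\pi i\tau}$, $\eta(\tau)=q^{1/24}\prod_{n\ge1}(1-q^n)$ is the Dedekind eta function (with $q^{1/24}=e^{2\pi i\tau/24}$). For a cusp form $f(\tau)=\sum_{n\ge1}a_nq^n$, its $L$-function is $L(f,s)=\sum_{n\ge1}a_nn^{-s}$, understood by analytic continuation where the series does not converge absolutely; equivalently, for each positive integer $s$, $$L(f,s)=\frac{(2\pi)^s}{\Gamma(s)}\int_0^\infty f(it)\,t^{s-1}\,dt .$$ *)

(* Defs.v *)
From mathcomp Require Import all_boot all_order all_algebra.
From mathcomp Require Import complex.
From mathcomp Require Import all_classical all_reals all_analysis.
Import Order.TTheory GRing.Theory Num.Theory numFieldNormedType.Exports.

Set Implicit Arguments.
Unset Strict Implicit.
Unset Printing Implicit Defensive.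

Local Open Scope classical_set_scope.
Local Open Scope ring_scope.
Local Open Scope complex_scope.

Definition expC {R : realType} (z : R[i]) : R[i] :=
  (expR (complex.Re z) * cos (complex.Im z))
    +i* (expR (complex.Re z) * sin (complex.Im z)).

(* exp (2 pi i tau); a fractional power q^r is always qexp (r * tau), so that
   no choice of branch is involved. *)
Definition qexp {R : realType} (tau : R[i]) : R[i] :=
  expC ((2 * pi)%:C * 'i * tau).

(* The functions of tau below are total on R[i], but meaningful only on the
   upper half-plane 0 < Im tau, where the infinite product converges to a
   nonzero limit. *)
Definition eta {R : realType} (tau : R[i]) : R[i] :=
  qexp (tau / 24) *
  lim ((fun N : nat => \prod_(1 <= n < N.+1) (1 - qexp tau ^+ n) : R[i]^o)
         @ \oo).

Definition h {R : realType} (tau : R[i]) : R[i] :=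
  eta (8 * tau) ^+ 38 / (eta (4 * tau) ^+ 14 * eta (16 * tau) ^+ 14).

Definition u {R : realType} (tau : R[i]) : R[i] :=
  eta (4 * tau) ^+ 14 / eta (8 * tau) ^+ 4.

Definition v {R : realType} (tau : R[i]) : R[i] :=
  eta (2 * tau) ^+ 14 / eta tau ^+ 4.

Definition g {R : realType} (tau : R[i]) : R[i] :=
  eta tau ^+ 4 * eta (2 * tau) ^+ 2 * eta (4 * tau) ^+ 4.

Definition Cintegral {R : realType} (D : set R) (F : R -> R[i]) : R[i] :=
  (\int[lebesgue_measure]_(t in D) complex.Re (F t))
    +i* (\int[lebesgue_measure]_(t in D) complex.Im (F t)).

(* The value at a positive integer s of the (analytically continued) L-function
   of a cusp form f, as (2 pi)^s / Gamma(s) times the Mellin transform of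
   t |-> f (i t); here Gamma(s) = (s - 1)!. Only meant for 0 < s. *)
Definition L {R : realType} (f : R[i] -> R[i]) (s : nat) : R[i] :=
  ((2 * pi) ^+ s / (s.-1)`!%:R)%:C *
  Cintegral `]0, +oo[ (fun t : R => f (t *i) * (t ^+ s.-1)%:C).

(* Main.v *)
Require Import Defs.
From mathcomp Require Import all_boot all_order all_algebra.
From mathcomp Require Import complex.
From mathcomp Require Import all_classical all_reals all_analysis.
From mathcomp Require Import measurable_realfun ring lra zify.
Import Order.TTheory GRing.Theory Num.Theory numFieldNormedType.Exports.
Import Normc.

(** Put [w = - i tau]. The four eta quotients are monomials of weight 5 in
the theta constants [th3 w = theta w], [th2 w = theta (w / 4) - theta w] and
[th4 w = 2 theta (4 w) - theta w], with [theta w] the sum of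
[exp (- pi n^2 w)] over all integers [n]. With

  ghat = th2^4 th3^2 th4^4,   hhat = th2 th3^8 th4,
  uhat = th2 th3 th4^8,       vhat = th2^8 th3 th4,

the product formulas of the theta constants give
[g (i t) = ghat (2 t) / 16], [h (i t) = hhat (8 t) / 2],
[u (i t) = uhat (8 t) / 2] and [v (i t) = vhat t / 256]. Each critical value
is therefore an elementary multiple of a moment, the integral over [y > 0]
of [y^k] times one of the four monomials with [0 <= k <= 3], and it is enough
to know the sixteen moments up to one common factor ([moment_values]). Three
facts determine them.

- Inversion [w -> 1 / w] fixes [th3] and exchanges [th2] and [th4], up to a
  square root of [w]. So [k]-th and [(3 - k)]-th moments agree for [ghat] and
  for [hhat], and the [k]-th moment of [vhat] is the [(3 - k)]-th moment of
  [uhat] ([moment_exists]).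

- The duplication formulas of the theta constants combine into
  [vhat y = 16 (ghat (2 y) + 8 ghat (4 y))] ([vr_gr]), which makes every moment
  of [vhat] a rational multiple of the same moment of [ghat].

- Translation [w -> w - i] exchanges [th3] and [th4] and multiplies [th2] by
  [zeta = exp (i pi / 4)]; it fixes [vhat] and sends [uhat] to [zeta hhat]. If
  [F] is a primitive of one of the forms and [b] is [i] or [- i], then
  [F (1 / (w + b))] is, by inversion, a primitive of [- (w + b)^3] times the
  translate of the dual form, and its limits at both ends of the axis are
  limits of primitives at cusps, hence zeroth moments ([contour]). For [vhat]
  and [b = - i] this says that [(y - i)^3 hhat y] has integral 0, so the zeroth
  moment of [hhat] is three times the first. For [uhat] and [b = i] it
  evaluates the integral of [(y + i)^3 vhat y]; the real and imaginary parts
  express the moments of [hhat] through those of [vhat] and fix the ratio of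
  the moments of [ghat].

Two analytic foundations are built first. The inversion formula of [theta] at
complex arguments ([theta_inversion]) is needed because the contours leave
the imaginary axis of [tau]. On the positive axis it is the limit of a finite
identity of Polya between power sums of cosines and sums of binomial
coefficients; it spreads to the half plane because both sides are power
series in a local parameter. The product formulas come from the Jacobi triple
product, itself the limit of the finite Cauchy binomial theorem.

Integrals over the positive axis are computed from holomorphic primitives
with limits at both ends ([hasint]). Cuspidal q-series have explicit
primitives, which decay exponentially in [Re w]. The fundamental theorem of
calculus identifies these integrals with Lebesgue integrals
([Rintegral_hasint]). *)

Set Implicit Arguments.
Unset Strict Implicit.
Unset Printing Implicit Defensive.

Local Open Scope classical_set_scope.
Local Open Scope ring_scope.
Local Open Scope complex_scope.

(** * Norms and limits of complex numbers *)

Section ComplexBasics.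
Context {R : realType}.
Local Notation C := R[i].
Implicit Types (z w : C) (x y : R).

Lemma normc_ge0 z : 0 <= normc z.
Proof. by case: z => a b /=; rewrite sqrtr_ge0. Qed.

Lemma ler_normcD z w : normc (z + w) <= normc z + normc w.
Proof. exact: le_normcD. Qed.

Lemma normcNE z : normc (- z) = normc z.
Proof. exact: normcN. Qed.

Lemma ler_normcB z w : normc (z - w) <= normc z + normc w.
Proof. by rewrite -(normcNE w); exact: ler_normcD. Qed.

Lemma normc_distC z w : normc (z - w) = normc (w - z).
Proof. by rewrite -normcNE opprB. Qed.

Lemma normc_real x : normc x%:C = `|x|.
Proof. by rewrite /= expr0n /= addr0 sqrtr_sqr. Qed.

Lemma normcX z n : normc (z ^+ n) = normc z ^+ n.
Proof. by elim: n => [|n IH]; rewrite ?expr0 ?normc1 // !exprS normcM IH. Qed.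

Lemma normc_sum (I : Type) (r : seq I) (P : pred I) (F : I -> C) :
  normc (\sum_(i <- r | P i) F i) <= \sum_(i <- r | P i) normc (F i).
Proof.
elim/big_rec2: _ => [|i y1 y2 _ IH]; first by rewrite normc0.
by rewrite (le_trans (ler_normcD _ _))// lerD2l.
Qed.

Lemma normc_eq0 z : (normc z == 0) = (z == 0).
Proof.
by apply/eqP/eqP => [/eq0_normc//|->]; rewrite normc0.
Qed.

Lemma normc_gt0 z : (0 < normc z) = (z != 0).
Proof. by rewrite lt_neqAle normc_ge0 andbT eq_sym normc_eq0. Qed.

Lemma Re_add z w : complex.Re (z + w) = complex.Re z + complex.Re w.
Proof. by case: z; case: w. Qed.

Lemma Im_add z w : complex.Im (z + w) = complex.Im z + complex.Im w.
Proof. by case: z; case: w. Qed.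

Lemma Re_sub z w : complex.Re (z - w) = complex.Re z - complex.Re w.
Proof. by case: z; case: w. Qed.

Lemma Im_sub z w : complex.Im (z - w) = complex.Im z - complex.Im w.
Proof. by case: z; case: w. Qed.

Lemma Re_mul z w : complex.Re (z * w) =
  complex.Re z * complex.Re w - complex.Im z * complex.Im w.
Proof. by case: z => ??; case: w. Qed.

Lemma Im_mul z w : complex.Im (z * w) =
  complex.Re z * complex.Im w + complex.Im z * complex.Re w.
Proof. by case: z => ??; case: w. Qed.

Lemma Re_scale x z : complex.Re (x%:C * z) = x * complex.Re z.
Proof. by rewrite Re_mul /= mul0r subr0. Qed.

Lemma Im_scale x z : complex.Im (x%:C * z) = x * complex.Im z.
Proof. by rewrite Im_mul /= mul0r addr0. Qed.

Lemma Re_sum (I : Type) (r : seq I) (P : pred I) (F : I -> C) :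
  complex.Re (\sum_(i <- r | P i) F i) = \sum_(i <- r | P i) complex.Re (F i).
Proof. by elim/big_rec2: _ => // i y1 y2 _ <-; rewrite Re_add. Qed.

Lemma Im_sum (I : Type) (r : seq I) (P : pred I) (F : I -> C) :
  complex.Im (\sum_(i <- r | P i) F i) = \sum_(i <- r | P i) complex.Im (F i).
Proof. by elim/big_rec2: _ => // i y1 y2 _ <-; rewrite Im_add. Qed.

Lemma sqr_normcE z : normc z ^+ 2 = complex.Re z ^+ 2 + complex.Im z ^+ 2.
Proof. by case: z => a b /=; rewrite sqr_sqrtr// addr_ge0 ?sqr_ge0. Qed.

Lemma normc_ReP z : `|complex.Re z| <= normc z.
Proof.
by case: z => a b /=; rewrite -sqrtr_sqr ler_wsqrtr// lerDl sqr_ge0.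
Qed.

Lemma normc_ImP z : `|complex.Im z| <= normc z.
Proof.
by case: z => a b /=; rewrite -sqrtr_sqr ler_wsqrtr// lerDr sqr_ge0.
Qed.

Lemma normc_le_ReIm z : normc z <= `|complex.Re z| + `|complex.Im z|.
Proof.
rewrite -(@ler_pXn2r _ 2%N)// ?nnegrE ?normc_ge0 ?addr_ge0//.
rewrite sqr_normcE sqrrD !real_normK ?num_real// addrAC lerDl.
by rewrite mulrn_wge0// mulr_ge0.
Qed.

Lemma natrC n : (n%:R : R)%:C = n%:R :> C.
Proof. by rewrite rmorph_nat. Qed.

Lemma normc_nat n : normc (n%:R : C) = n%:R.
Proof. by rewrite -natrC normc_real ger0_norm. Qed.

End ComplexBasics.

Arguments normc : simpl never.

Lemma cvg_dist0 {R : realType} (u : nat -> R) (l : R) :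
  u @ \oo --> l -> `|u n - l| @[n --> \oo] --> (0 : R).
Proof.
move=> ul; rewrite -(@normr0 _ R) -(subrr l); apply: cvg_norm.
by apply: cvgB => //; exact: cvg_cst.
Qed.

Lemma cvg_subl0 {R : realType} (u : nat -> R) (l : R) :
  u @ \oo --> l -> l - u n @[n --> \oo] --> (0 : R).
Proof.
move=> ul; rewrite -[X in _ --> X](subrr l).
by apply: cvgB => //; exact: cvg_cst.
Qed.

Lemma eq_cvgn {T : topologicalType} (u v : nat -> T) (l : T) :
  (forall n, u n = v n) -> u @ \oo --> l -> v @ \oo --> l.
Proof. by move=> /funext ->. Qed.

Lemma cvgn_sum {R : realType} (u : nat -> nat -> R) (l : nat -> R) n :
  (forall m, u m @ \oo --> l m) ->
  \sum_(m < n) u m k @[k --> \oo] --> \sum_(m < n) l m.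
Proof.
move=> ul; elim: n => [|n IH].
  by rewrite big_ord0; apply: (eq_cvgn (u := fun=> 0)) => [k|]; [rewrite big_ord0|exact: cvg_cst].
rewrite big_ord_recr; apply: (eq_cvgn (u := fun k => \sum_(m < n) u m k + u n k)).
  by move=> k; rewrite big_ord_recr.
exact: cvgD.
Qed.

Section ComplexSequences.
Context {R : realType}.
Local Notation C := R[i].
Implicit Types (a b u v : nat -> C) (s l : C).

(** Convergence of complex sequences through the real-valued norm, so that the
theory of real sequences applies to it. *)
Definition ccvg u l := normc (u n - l) @[n --> \oo] --> (0 : R).

Lemma ccvg_le u l (e : nat -> R) :
  (\forall n \near \oo, normc (u n - l) <= e n) -> e @ \oo --> 0 -> ccvg u l.
Proof.
move=> le_e cv_e; apply: (@squeeze_cvgr _ _ _ _ (cst 0) e) => //.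
- by near=> n; rewrite normc_ge0 /=; near: n.
- exact: cvg_cst.
Unshelve. all: by end_near. Qed.

Lemma ccvg_cst l : ccvg (fun=> l) l.
Proof. by rewrite /ccvg; under eq_fun do rewrite subrr normc0; exact: cvg_cst. Qed.

Lemma ccvgD u v l s : ccvg u l -> ccvg v s -> ccvg (fun n => u n + v n) (l + s).
Proof.
move=> ul vs; apply: (@ccvg_le _ _ (fun n => normc (u n - l) + normc (v n - s))).
  near=> n; have -> : u n + v n - (l + s) = (u n - l) + (v n - s) by ring.
  exact: ler_normcD.
rewrite -[X in _ --> X]addr0; exact: cvgD.
Unshelve. all: by end_near. Qed.

Lemma ccvgM u v l s : ccvg u l -> ccvg v s -> ccvg (fun n => u n * v n) (l * s).
Proof.
move=> ul vs; apply: (@ccvg_le _ _ (fun n => normc (u n - l) * normc (v n - s)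
   + normc l * normc (v n - s) + normc s * normc (u n - l))).
  near=> n; have -> : u n * v n - l * s =
    (u n - l) * (v n - s) + l * (v n - s) + s * (u n - l) by ring.
  by rewrite (le_trans (ler_normcD _ _))// normcM lerD2r
    (le_trans (ler_normcD _ _))// !normcM.
have -> : (0 : R) = 0 * 0 + normc l * 0 + normc s * 0 by rewrite !mulr0 !addr0.
apply: cvgD; first apply: cvgD; first exact: cvgM.
- by apply: cvgM => //; exact: cvg_cst.
- by apply: cvgM => //; exact: cvg_cst.
Unshelve. all: by end_near. Qed.

Lemma ccvgZ c u l : ccvg u l -> ccvg (fun n => c * u n) (c * l).
Proof. by apply: ccvgM; exact: ccvg_cst. Qed.

Lemma ccvg_unique u l s : ccvg u l -> ccvg u s -> l = s.
Proof.
move=> ul us; apply/eqP; rewrite -subr_eq0 -normc_eq0; apply/eqP.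
have h1 : (fun=> normc (l - s)) @ \oo --> (0 : R).
  apply: (@squeeze_cvgr _ _ _ _ (cst 0)
     (fun n => normc (u n - l) + normc (u n - s))).
  - near=> n; rewrite normc_ge0 /= (normc_distC (u n)).
    have -> : l - s = (l - u n) + (u n - s) by ring.
    exact: ler_normcD.
  - exact: cvg_cst.
  - by rewrite -[X in _ --> X]addr0; exact: cvgD.
have h2 : (fun=> normc (l - s)) @ \oo --> normc (l - s) by exact: cvg_cst.
exact: (cvg_unique (@norm_hausdorff _ _) h2 h1).
Unshelve. all: by end_near. Qed.

Lemma ccvg_real (u : nat -> R) (l : R) :
  u @ \oo --> l -> ccvg (fun n => (u n)%:C) l%:C.
Proof.
move=> ul; rewrite /ccvg.
under eq_fun do rewrite -rmorphB normc_real.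
exact: cvg_dist0.
Qed.

Lemma ccvg_Re u l : ccvg u l -> complex.Re (u n) @[n --> \oo] --> complex.Re l.
Proof.
move=> ul; apply/cvgrPdistC_le => e e0.
have [N _ hN] := cvgr0_norm_le _ ul _ e0; exists N => // n /= /hN /=.
rewrite ger0_norm ?normc_ge0//.
by apply: le_trans; rewrite -Re_sub; exact: normc_ReP.
Qed.

Lemma ccvg_ReIm u (x y : R) : complex.Re (u n) @[n --> \oo] --> x ->
  complex.Im (u n) @[n --> \oo] --> y -> ccvg u (x +i* y).
Proof.
move=> ux uy; apply: (@ccvg_le _ _ (fun n => `|complex.Re (u n) - x| + `|complex.Im (u n) - y|)).
  near=> n; rewrite (le_trans (normc_le_ReIm _))//.
  by rewrite Re_sub Im_sub.
rewrite -[X in _ --> X]addr0; apply: cvgD.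
- exact: cvg_dist0.
- exact: cvg_dist0.
Unshelve. all: by end_near. Qed.

Lemma ccvg_norm u l : ccvg u l -> normc (u n) @[n --> \oo] --> normc l.
Proof.
move=> ul; apply/cvgrPdistC_le => e e0.
have [N _ hN] := cvgr0_norm_le _ ul _ e0; exists N => // n /= /hN /=.
rewrite ger0_norm ?normc_ge0//.
apply: le_trans.
rewrite ler_norml lerNl opprB !lerBlDr; apply/andP; split.
  rewrite -(normc_distC l) -[in leLHS](subrK (u n) l); exact: ler_normcD.
rewrite -[in leLHS](subrK l (u n)); exact: ler_normcD.
Qed.

End ComplexSequences.

(** * Absolutely convergent complex series *)

Section Sums.
Context {R : realType}.
Local Notation C := R[i].
Implicit Types (a b : nat -> C) (s t c : C) (M : R).

(** Absolute summability with its bound made explicit: the bounds of a family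
of series can then be summed or compared without choosing them. *)
Definition absb a M := forall n, \sum_(k < n) normc (a k) <= M.

(** The two limits exist, and the value is the sum, as soon as [absb] holds
([csumP]). *)
Definition csum a : C :=
  limn (fun n => \sum_(k < n) complex.Re (a k)) +i*
  limn (fun n => \sum_(k < n) complex.Im (a k)).

Arguments csum : simpl never.

Definition hasum a s := ccvg (fun n => \sum_(k < n) a k) s.

Lemma absb_ge0 a M : absb a M -> 0 <= M.
Proof. by move=> /(_ 0%N); rewrite big_ord0. Qed.

Lemma absb_le a b M : (forall k, normc (b k) <= normc (a k)) -> absb a M -> absb b M.
Proof. by move=> ba aM n; apply: le_trans (aM n); apply: ler_sum. Qed.

Lemma real_series_cvg (u : nat -> R) M :
  (forall n, \sum_(k < n) `|u k| <= M) ->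
  cvgn (fun n => \sum_(k < n) u k).
Proof.
move=> uM; have : cvgn [normed series u].
  apply: nondecreasing_is_cvgn.
    by apply: nondecreasing_series => n _ _ /=; exact: normr_ge0.
  exists M => _ [n _ <-].
  by have := uM n; rewrite -(big_mkord xpredT (fun k => `|u k|)).
by move/normed_cvg; rewrite seriesEord.
Qed.

Lemma csumP a M : absb a M -> hasum a (csum a).
Proof.
move=> aM; apply: ccvg_ReIm.
- apply: (eq_cvgn (u := fun n => \sum_(k < n) complex.Re (a k))).
    by move=> n; rewrite Re_sum.
  apply: (@real_series_cvg (fun k => complex.Re (a k)) M) => n.
  by apply: le_trans (aM n); apply: ler_sum => k _; exact: normc_ReP.
- apply: (eq_cvgn (u := fun n => \sum_(k < n) complex.Im (a k))).
    by move=> n; rewrite Im_sum.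
  apply: (@real_series_cvg (fun k => complex.Im (a k)) M) => n.
  by apply: le_trans (aM n); apply: ler_sum => k _; exact: normc_ImP.
Qed.

Lemma hasum_unique a s t : hasum a s -> hasum a t -> s = t.
Proof. exact: ccvg_unique. Qed.

Lemma hasum_csum a s M : absb a M -> hasum a s -> csum a = s.
Proof. by move=> /csumP; exact: hasum_unique. Qed.

Lemma eq_csum a b : a =1 b -> csum a = csum b.
Proof. by move=> /funext ->. Qed.

Lemma hasumD a b s t : hasum a s -> hasum b t -> hasum (fun k => a k + b k) (s + t).
Proof.
move=> sa sb; rewrite /hasum; under eq_fun do rewrite big_split.
exact: ccvgD.
Qed.

Lemma hasumZ c a s : hasum a s -> hasum (fun k => c * a k) (c * s).
Proof.
move=> sa; rewrite /hasum; under eq_fun do rewrite -mulr_sumr; exact: ccvgZ.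
Qed.

Lemma absbD a b M M' : absb a M -> absb b M' -> absb (fun k => a k + b k) (M + M').
Proof.
move=> aM bM n; apply: le_trans (lerD (aM n) (bM n)).
by rewrite -big_split; apply: ler_sum => k _; exact: ler_normcD.
Qed.

Lemma absbZ c a M : absb a M -> absb (fun k => c * a k) (normc c * M).
Proof.
move=> aM n; under eq_bigr do rewrite normcM.
by rewrite -mulr_sumr ler_wpM2l ?normc_ge0.
Qed.

Lemma csumD a b M M' : absb a M -> absb b M' ->
  csum (fun k => a k + b k) = csum a + csum b.
Proof.
move=> aM bM; apply: (hasum_csum (absbD aM bM)).
exact: hasumD (csumP aM) (csumP bM).
Qed.

Lemma csumZ c a M : absb a M -> csum (fun k => c * a k) = c * csum a.
Proof.
by move=> aM; apply: (hasum_csum (absbZ c aM)); exact: hasumZ (csumP aM).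
Qed.

Lemma hasum_norm_le a s M : hasum a s -> absb a M -> normc s <= M.
Proof.
move=> /ccvg_norm sa aM; apply: (ler_cvg_to sa (cvg_cst M)).
by near=> n; apply: le_trans (aM n); exact: normc_sum.
Unshelve. all: by end_near. Qed.

Lemma csum_norm_le a M : absb a M -> normc (csum a) <= M.
Proof. by move=> aM; exact: hasum_norm_le (csumP aM) aM. Qed.

Lemma hasum_shift a s n :
  hasum a s -> hasum (fun k => a (n + k)%N) (s - \sum_(k < n) a k).
Proof.
move=> sa.
have : ccvg (fun m => \sum_(k < m + n) a k + - \sum_(k < n) a k) (s + - \sum_(k < n) a k).
  apply: ccvgD; last exact: ccvg_cst.
  rewrite /ccvg (@cvg_shiftn n _ (fun m => normc (\sum_(k < m) a k - s))).
  exact: sa.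
rewrite /hasum; congr ccvg; apply: funext => m.
by rewrite addnC big_split_ord/= addrAC subrr add0r.
Qed.

Lemma absb_tail a M n : absb a M ->
  absb (fun k => a (n + k)%N) (M - \sum_(k < n) normc (a k)).
Proof.
move=> aM m; rewrite lerBrDr; apply: le_trans (aM (n + m)%N).
by rewrite big_split_ord/= addrC.
Qed.

Lemma hasum_fin a n : (forall k, (n <= k)%N -> a k = 0) -> hasum a (\sum_(k < n) a k).
Proof.
move=> a0; rewrite /hasum.
apply: (@ccvg_le _ _ _ (fun=> 0)); last exact: cvg_cst.
near=> m.
have nm : (n <= m)%N by near: m; exact: nbhs_infty_ge.
suff -> : \sum_(k < m) a k = \sum_(k < n) a k by rewrite subrr normc0.
rewrite -(subnKC nm) big_split_ord/= [X in _ + X]big1 ?addr0// => k _.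
by rewrite a0// leq_addr.
Unshelve. all: by end_near. Qed.

Lemma absb_fin a n : (forall k, (n <= k)%N -> a k = 0) ->
  absb a (\sum_(k < n) normc (a k)).
Proof.
move=> a0 m; case: (leqP n m) => nm.
  rewrite -(subnKC nm) big_split_ord/= [X in _ + X]big1 ?addr0// => k _.
  by rewrite a0 ?leq_addr// normc0.
rewrite -(subnKC (ltnW nm)) [leRHS]big_split_ord/= lerDl sumr_ge0// => k _.
exact: normc_ge0.
Qed.

Lemma csum_fin a n : (forall k, (n <= k)%N -> a k = 0) -> csum a = \sum_(k < n) a k.
Proof.
by move=> a0; apply: (hasum_csum (absb_fin a0)); exact: hasum_fin.
Qed.

Lemma sum_norm_cvg (u : nat -> nat -> C) (l : nat -> C) n M :
  (forall m, ccvg (u m) (l m)) ->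
  (forall K, \sum_(m < n) normc (u m K) <= M) ->
  \sum_(m < n) normc (l m) <= M.
Proof.
move=> ul uM.
have cv : (fun K => \sum_(m < n) normc (u m K)) @ \oo --> \sum_(m < n) normc (l m).
  by apply: (@cvgn_sum _ (fun m K => normc (u m K)) (fun m => normc (l m)) n) => m; exact: ccvg_norm (ul m).
by apply: (ler_cvg_to cv (cvg_cst M)); near=> K; exact: uM.
Unshelve. all: by end_near. Qed.

Section Fubini.
Variables (a : nat -> nat -> C) (B : nat -> R) (M : R).
Hypothesis aB : forall k, absb (a k) (B k).
Hypothesis BM : forall n, \sum_(k < n) B k <= M.

Lemma dsum_le K n : \sum_(m < n) \sum_(k < K) normc (a k m) <= M.
Proof.
rewrite exchange_big /=; apply: le_trans (BM K).
by apply: ler_sum => k _; exact: aB.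
Qed.

Lemma fubini_inner m : absb (fun k => a k m) M.
Proof.
move=> K; apply: le_trans (dsum_le K m.+1).
rewrite big_ord_recr /= lerDr sumr_ge0// => i _.
by rewrite sumr_ge0// => j _; exact: normc_ge0.
Qed.

Lemma fubini_outer : absb (fun m => csum (fun k => a k m)) M.
Proof.
move=> n; apply: (@sum_norm_cvg (fun m K => \sum_(k < K) a k m) (fun m => csum (a^~ m))).
  by move=> m; exact: csumP (@fubini_inner m).
move=> K; apply: le_trans (dsum_le K n).
by apply: ler_sum => m _; exact: normc_sum.
Qed.

Lemma fubini_row : absb (fun k => csum (a k)) M.
Proof.
move=> n; apply: le_trans (BM n); apply: ler_sum => k _; exact: csum_norm_le.
Qed.

Lemma hasum_sum K : hasum (fun m => \sum_(k < K) a k m) (\sum_(k < K) csum (a k)).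
Proof.
elim: K => [|K IH].
  have := @hasum_fin (fun m => \sum_(k < 0) a k m) 0.
  by rewrite !big_ord0; apply => m _; rewrite big_ord0.
rewrite (_ : (fun _ => _) = (fun m => \sum_(k < K) a k m + a K m)); last first.
  by apply: funext => m; rewrite big_ord_recr.
rewrite big_ord_recr; apply: hasumD => //; exact: csumP (aB K).
Qed.

(** Both iterated sums are limits of [\sum_(k < K) csum (a k)]: the rows from
[K] on contribute at most the tail of [\sum B] to the sum by columns. *)
Lemma csum_fubini : csum (fun k => csum (a k)) = csum (fun m => csum (fun k => a k m)).
Proof.
apply: (hasum_csum fubini_row).
have B0 k : 0 <= B k by exact: absb_ge0 (aB k).
have cB : cvgn (fun n => \sum_(k < n) B k).
  by apply: (@real_series_cvg _ M) => n; under eq_bigr do rewrite ger0_norm//.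
set S := limn (fun n => \sum_(k < n) B k) in cB.
apply: (@ccvg_le _ _ _ (fun K => S - \sum_(k < K) B k)); last first.
  exact: cvg_subl0.
near=> K; rewrite normc_distC.
have h1 := hasumD (csumP fubini_outer) (hasumZ (-1) (hasum_sum K)).
rewrite mulN1r in h1; apply: (hasum_norm_le h1) => n.
have -> : \sum_(k < n) normc (csum (fun k0 => a k0 k) + -1 * \sum_(k0 < K) a k0 k)
  = \sum_(k < n) normc (csum (fun k0 => a (K + k0)%N k)).
  apply: eq_bigr => m _; congr normc; rewrite mulN1r.
  apply: (hasum_unique (hasum_shift K (csumP (@fubini_inner m)))).
  have /csumP : absb (fun k => a (K + k)%N m) (M - \sum_(k < K) normc (a k m)).
    exact: (@absb_tail (fun k => a k m) M K (@fubini_inner m)).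
  exact.
apply: (@sum_norm_cvg (fun m L => \sum_(k < L) a (K + k)%N m)
  (fun m => csum (fun k => a (K + k)%N m))).
  by move=> m; exact: csumP (@absb_tail (fun k => a k m) M K (@fubini_inner m)).
move=> L.
apply: (@le_trans _ _ (\sum_(k < L) B (K + k)%N)).
  apply: (@le_trans _ _ (\sum_(m < n) \sum_(k < L) normc (a (K + k)%N m))).
    by apply: ler_sum => m _; exact: normc_sum.
  by rewrite exchange_big /=; apply: ler_sum => k _; exact: aB.
rewrite lerBrDl.
have -> : \sum_(k < K) B k + \sum_(k < L) B (K + k)%N = \sum_(k < K + L) B k.
  by rewrite big_split_ord.
have nd : {homo (fun n => \sum_(k < n) B k) : x y / (x <= y)%N >-> x <= y}.
  move=> x y xy; rewrite -(subnKC xy) [leRHS]big_split_ord/= lerDl.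
  by rewrite sumr_ge0.
exact: (nondecreasing_cvgn_le nd cB).
Unshelve. all: by end_near. Qed.

End Fubini.

(** Cut all series at the same [K]: the tails are at most the tail of [\sum B],
uniformly in [n], and the finite heads converge. *)
Lemma tannery (f : nat -> nat -> C) (g : nat -> C) (B : nat -> R) M :
  (forall k, ccvg (fun n => f n k) (g k)) ->
  (forall n k, normc (f n k) <= B k) ->
  (forall n, \sum_(k < n) B k <= M) ->
  ccvg (fun n => csum (f n)) (csum g).
Proof.
move=> fg fB BM.
have B0 k : 0 <= B k by exact: le_trans (normc_ge0 _) (fB 0%N k).
have gB k : normc (g k) <= B k.
  apply: (ler_cvg_to (ccvg_norm (fg k)) (cvg_cst (B k))).
  by near=> n; exact: fB.
have aM n : absb (f n) M.
  by move=> K; apply: le_trans (BM K); exact: ler_sum.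
have gM : absb g M by move=> K; apply: le_trans (BM K); exact: ler_sum.
have cB : cvgn (fun n => \sum_(k < n) B k).
  by apply: (@real_series_cvg _ M) => n; under eq_bigr do rewrite ger0_norm//.
set S := limn (fun n => \sum_(k < n) B k) in cB.
have nd : {homo (fun n => \sum_(k < n) B k) : x y / (x <= y)%N >-> x <= y}.
  move=> x y xy; rewrite -(subnKC xy) [leRHS]big_split_ord/= lerDl.
  by rewrite sumr_ge0.
have tl (h : nat -> C) K : absb h M -> (forall k, normc (h k) <= B k) ->
    normc (csum h - \sum_(k < K) h k) <= S - \sum_(k < K) B k.
  move=> hM hB; apply: (hasum_norm_le (hasum_shift K (csumP hM))) => L.
  rewrite lerBrDl; apply: le_trans (nondecreasing_cvgn_le nd cB (K + L)%N).
  by rewrite big_split_ord/= lerD2l; exact: ler_sum.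
have tail0 : S - \sum_(k < K) B k @[K --> \oo] --> (0 : R).
  exact: cvg_subl0.
apply/cvgr0Pnorm_le => e e0.
have e4 : 0 < e / 4 by rewrite divr_gt0.
have [K _ hK] := cvgr0_norm_le _ tail0 _ e4.
have {}hK : S - \sum_(k < K) B k <= e / 4.
  by apply: le_trans (hK K (leqnn K)); rewrite ler_norm.
have cK : ccvg (fun n => \sum_(k < K) f n k) (\sum_(k < K) g k).
  elim: {hK}K => [|K IH].
    under eq_fun do rewrite big_ord0.
    by rewrite big_ord0; exact: ccvg_cst.
  under eq_fun do rewrite big_ord_recr /=.
  by rewrite big_ord_recr; exact: ccvgD.
have e2 : 0 < e / 2 by rewrite divr_gt0.
have [N _ hN] := cvgr0_norm_le _ cK _ e2; exists N => // n /= /hN /=.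
rewrite !ger0_norm ?normc_ge0// => hn.
have -> : csum (f n) - csum g = (csum (f n) - \sum_(k < K) f n k) +
  (\sum_(k < K) f n k - \sum_(k < K) g k) - (csum g - \sum_(k < K) g k) by ring.
apply: (le_trans (ler_normcB _ _)).
have h3 := tl _ K gM gB.
have h1 := tl _ K (aM n) (fB n).
have h2 := ler_normcD (csum (f n) - \sum_(k < K) f n k) (\sum_(k < K) f n k - \sum_(k < K) g k).
lra.
Unshelve. all: by end_near. Qed.

End Sums.

(** * Power series with weighted bounds *)

Section PowerSeries.
Context {R : realType}.
Local Notation C := R[i].
Implicit Types (c d : nat -> C) (z w : C) (r M : R).

Definition ps c z : C := csum (fun n => c n * z ^+ n).

(** The norm of the Wiener algebra of the disc of radius [r]. It is
submultiplicative, so sums, products, exponentials and theta series of power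
series are again power series on the same disc, with bounds. *)
Definition wnorm c r M := forall n, \sum_(k < n) normc (c k) * r ^+ k <= M.

Lemma wnorm_ge0 c r M : wnorm c r M -> 0 <= M.
Proof. by move=> /(_ 0%N); rewrite big_ord0. Qed.

Lemma wnorm_le c d r M : 0 <= r -> (forall n, normc (d n) <= normc (c n)) ->
  wnorm c r M -> wnorm d r M.
Proof.
move=> r0 dc cM n; apply: le_trans (cM n); apply: ler_sum => k _.
by rewrite ler_wpM2r// exprn_ge0.
Qed.

Lemma wnorm_leM c r M M' : M <= M' -> wnorm c r M -> wnorm c r M'.
Proof. by move=> MM cM n; exact: le_trans (cM n) MM. Qed.

Lemma wnorm_absb c r M z : wnorm c r M -> normc z <= r ->
  absb (fun n => c n * z ^+ n) M.
Proof.
move=> cM zr n; apply: le_trans (cM n); apply: ler_sum => k _.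
rewrite normcM normcX ler_wpM2l ?normc_ge0// lerXn2r// nnegrE ?normc_ge0//.
exact: le_trans (normc_ge0 _) zr.
Qed.

Lemma wnormD c d r M M' : 0 <= r -> wnorm c r M -> wnorm d r M' ->
  wnorm (fun n => c n + d n) r (M + M').
Proof.
move=> r0 cM dM n; apply: le_trans (lerD (cM n) (dM n)).
rewrite -big_split /=; apply: ler_sum => k _.
by rewrite -mulrDl ler_wpM2r ?exprn_ge0// ler_normcD.
Qed.

Lemma psD c d r M M' z : wnorm c r M -> wnorm d r M' -> normc z <= r ->
  ps (fun n => c n + d n) z = ps c z + ps d z.
Proof.
move=> cM dM zr; rewrite -(csumD (wnorm_absb cM zr) (wnorm_absb dM zr)).
by apply: eq_csum => n; rewrite mulrDl.
Qed.

Lemma wnormZ a c r M : 0 <= r -> wnorm c r M -> wnorm (fun n => a * c n) r (normc a * M).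
Proof.
move=> r0 cM n; apply: (@le_trans _ _ (\sum_(k < n) normc a * (normc (c k) * r ^+ k))).
  by apply: ler_sum => k _; rewrite normcM mulrA.
by rewrite -mulr_sumr ler_wpM2l ?normc_ge0.
Qed.

Lemma psZ a c r M z : wnorm c r M -> normc z <= r ->
  ps (fun n => a * c n) z = a * ps c z.
Proof.
move=> cM zr; rewrite -(csumZ a (wnorm_absb cM zr)).
by apply: eq_csum => n; rewrite mulrA.
Qed.

(** A summable family of power series is summed coefficientwise; the exchange
is [csum_fubini] at every point of the disc. *)
Lemma wnorm_sum (c : nat -> nat -> C) r (B : nat -> R) M : 0 <= r ->
  (forall k, wnorm (c k) r (B k)) -> (forall n, \sum_(k < n) B k <= M) ->
  wnorm (fun m => csum (fun k => c k m)) r M /\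
  forall z, normc z <= r -> ps (fun m => csum (fun k => c k m)) z = csum (fun k => ps (c k) z).
Proof.
move=> r0 cB BM.
have H z : normc z <= r -> forall m, csum (fun k => c k m * z ^+ m) = csum (fun k => c k m) * z ^+ m.
  move=> zr m; have [->|z0] := eqVneq (z ^+ m) 0.
    rewrite mulr0 (_ : (fun k => _) = fun=> 0) ?(@csum_fin _ _ 0) ?big_ord0//.
    by apply: funext => k; rewrite mulr0.
  rewrite mulrC -(@csumZ _ _ _ (normc (z ^- m) * M)).
    by apply: eq_csum => k; rewrite mulrC.
  rewrite (_ : (fun k => c k m) = (fun k => z ^- m * (c k m * z ^+ m))); last first.
    by apply: funext => k; rewrite mulrC mulfK.
  apply: absbZ; exact: (fubini_inner (fun k => wnorm_absb (cB k) zr) BM m).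
split.
  have rr : normc r%:C <= r by rewrite normc_real ger0_norm.
  have h := fubini_outer (fun k => wnorm_absb (cB k) rr) BM.
  move=> n; apply: le_trans (h n); apply: ler_sum => m _.
  by rewrite H// normcM normcX normc_real ger0_norm.
move=> z zr; rewrite /ps -[RHS]/(csum (fun k => csum (fun m => c k m * z ^+ m))).
rewrite (csum_fubini (fun k => wnorm_absb (cB k) zr) BM).
by apply: eq_csum => m; rewrite H.
Qed.

Definition cauchyp c d n : C := \sum_(k < n.+1) c k * d (n - k)%N.

(** Used on the rows of a Cauchy product: the [k]-th row is a multiple of the
second series delayed by [k] places. *)
Lemma csum_delay (a : nat -> C) k M : absb a M ->
  absb (fun m => if (k <= m)%N then a (m - k)%N else 0) M /\
  csum (fun m => if (k <= m)%N then a (m - k)%N else 0) = csum a.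
Proof.
move=> aM; set b := fun m => _.
have bs n : \sum_(m < k + n) b m = \sum_(m < n) a m.
  rewrite big_split_ord/= [X in X + _]big1 ?add0r.
    by apply: eq_bigr => i _; rewrite /b leq_addr addKn.
  by move=> i _; rewrite /b leqNgt ltn_ord.
have bM : absb b M.
  move=> n; apply: le_trans (aM n).
  apply: (@le_trans _ _ (\sum_(m < k + n) normc (b m))).
    rewrite addnC big_split_ord/= lerDl sumr_ge0// => i _; exact: normc_ge0.
  rewrite big_split_ord/= [X in X + _]big1 ?add0r.
    by apply: ler_sum => i _; rewrite /b leq_addr addKn.
  by move=> i _; rewrite /b leqNgt ltn_ord/= normc0.
split => //; apply: (hasum_unique _ (csumP aM)).
  have := hasum_shift k (csumP bM).
  have -> : \sum_(k0 < k) b k0 = 0.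
    by have := bs 0%N; rewrite addn0 big_ord0.
  rewrite subr0.
  by rewrite (_ : (fun k0 => _) = a)//; apply: funext => i; rewrite /b leq_addr addKn.
Qed.

(** In the double series [c k * d (m - k) * z^m], rows sum to [c k * z^k] times
the second series, columns to the terms of the Cauchy product. *)
Lemma cauchyp_wnorm c d r M M' : 0 <= r -> wnorm c r M -> wnorm d r M' ->
  wnorm (cauchyp c d) r (M * M') /\
  forall z, normc z <= r -> ps (cauchyp c d) z = ps c z * ps d z.
Proof.
move=> r0 cM dM.
pose a k m : C := if (k <= m)%N then c k * d (m - k)%N else 0.
have am m : (fun k => a k m) = fun k => if (k < m.+1)%N then c k * d (m - k)%N else 0.
  by apply: funext.
have M0 := wnorm_ge0 dM.
have aE m : csum (fun k => a k m) = cauchyp c d m.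
  rewrite (@csum_fin _ _ m.+1) => [|k mk]; last by rewrite /a leqNgt mk.
  by apply: eq_bigr => k _; rewrite /a -ltnS ltn_ord.
have aw z : normc z <= r -> forall k,
   absb (fun m => a k m * z ^+ m) ((normc (c k) * r ^+ k) * M') /\
   csum (fun m => a k m * z ^+ m) = c k * z ^+ k * ps d z.
  move=> zr k; have dz := wnorm_absb dM zr.
  have [h1 h2] := csum_delay k (absbZ (c k * z ^+ k) dz).
  have E : (fun m => a k m * z ^+ m) = (fun m =>
     if (k <= m)%N then c k * z ^+ k * (d (m - k)%N * z ^+ (m - k)) else 0).
    apply: funext => m; rewrite /a; case: ifPn => km; last by rewrite mul0r.
    by rewrite -[in LHS](subnKC km) addKn exprD; ring.
  rewrite E; split; last by rewrite h2 (csumZ _ dz).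
  move=> n; apply: le_trans (h1 n) _.
  rewrite normcM normcX ler_wpM2r// ler_wpM2l ?normc_ge0// lerXn2r ?nnegrE ?normc_ge0//.
have BM n : \sum_(k < n) (normc (c k) * r ^+ k) * M' <= M * M'.
  by rewrite -mulr_suml ler_wpM2r.
have -> : cauchyp c d = (fun m => csum (fun k => a k m)) by apply: funext => m; rewrite aE.
have aB k : wnorm (a k) r (normc (c k) * r ^+ k * M').
  have rr : normc r%:C <= r by rewrite normc_real ger0_norm.
  move=> n; have [/(_ n) + _] := aw r%:C rr k; apply: le_trans.
  by apply: ler_sum => m _; rewrite normcM normcX normc_real ger0_norm.
have [h1 h2] := @wnorm_sum a r (fun k => (normc (c k) * r ^+ k) * M') (M * M') r0 aB BM.
split=> // z zr; rewrite h2// [RHS]mulrC -(csumZ _ (wnorm_absb cM zr)).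
apply: eq_csum => k; have [_ E] := aw z zr k.
by rewrite /ps E mulrC.
Qed.

Fixpoint cauchyX c k : nat -> C :=
  if k is k'.+1 then cauchyp c (cauchyX c k') else fun n => (n == 0%N)%:R.

Lemma ps_one r z : 0 <= r -> wnorm (fun n => (n == 0%N)%:R : C) r 1 /\
  ps (fun n => (n == 0%N)%:R) z = 1.
Proof.
move=> r0; split.
  case=> [|n]; first by rewrite big_ord0.
  rewrite big_ord_recl /= normc1 expr0 mulr1 big1 ?addr0// => i _.
  by rewrite normc0 mul0r.
rewrite /ps (@csum_fin _ _ 1%N) ?big_ord_recl ?big_ord0 /= ?expr0 ?mulr1 ?addr0//.
by case=> // k _; rewrite mul0r.
Qed.

Lemma cauchyX_wnorm c r M k : 0 <= r -> wnorm c r M ->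
  wnorm (cauchyX c k) r (M ^+ k) /\
  forall z, normc z <= r -> ps (cauchyX c k) z = ps c z ^+ k.
Proof.
move=> r0 cM; elim: k => [|k [IH1 IH2]].
  by split=> [|z zr]; [exact: (ps_one 0 r0).1 | rewrite expr0 (ps_one z r0).2].
have [h1 h2] := cauchyp_wnorm r0 cM IH1; rewrite exprS; split=> // z zr.
by rewrite /= h2// IH2// exprS.
Qed.

(** If [c n] is the first coefficient that may be nonzero, the remaining terms
at [x] are [O(x^(n+1))], so [c n = O(x)] for all small [x]. *)
Lemma ps_unique c r M : 0 < r -> wnorm c r M ->
  (forall x : R, 0 < x -> x <= r -> ps c x%:C = 0) -> forall n, c n = 0.
Proof.
move=> r0 cM c0 n; elim/ltn_ind: n => n IH.
apply/eqP; rewrite -normc_eq0; apply/eqP/le_anti; rewrite normc_ge0 andbT.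
have M0 := wnorm_ge0 cM.
have key x : 0 < x -> x <= r -> normc (c n) <= x * (M / r ^+ n.+1).
  move=> x0 xr.
  have xC : normc x%:C <= r by rewrite normc_real gtr0_norm.
  have hs := hasum_shift n.+1 (csumP (wnorm_absb cM xC)).
  rewrite -/(ps c x%:C) c0// sub0r big_ord_recr /= big1 ?add0r in hs; last first.
    by move=> i _; rewrite IH// mul0r.
  have : normc (- (c n * x%:C ^+ n)) <= x ^+ n.+1 * (M / r ^+ n.+1).
    apply: (hasum_norm_le hs) => K.
    have -> : x ^+ n.+1 * (M / r ^+ n.+1) = (x / r) ^+ n.+1 * M.
      by rewrite expr_div_n; ring.
    apply: (@le_trans _ _ ((x / r) ^+ n.+1 * \sum_(k < K) normc (c (n.+1 + k)%N) * r ^+ (n.+1 + k))).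
      rewrite mulr_sumr; apply: ler_sum => k _.
      rewrite normcM normcX normc_real gtr0_norm// !exprD mulrCA.
      have rn : r ^+ n.+1 != 0 by rewrite expf_neq0// gt_eqF.
      rewrite [leRHS](_ : _ = x ^+ n.+1 * (normc (c (n.+1 + k)%N) * r ^+ k)); last first.
        by rewrite expr_div_n; field.
      by rewrite !ler_wpM2l ?exprn_ge0 ?normc_ge0 ?(ltW x0)// lerXn2r ?nnegrE// ltW.
    rewrite ler_wpM2l ?exprn_ge0 ?divr_ge0 ?(ltW x0) ?(ltW r0)//.
    apply: le_trans (cM (n.+1 + K)%N).
    rewrite [leRHS]big_split_ord/= lerDr sumr_ge0// => i _.
    by rewrite mulr_ge0 ?normc_ge0// exprn_ge0// ltW.
  rewrite normcNE normcM normcX normc_real gtr0_norm// exprS.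
  rewrite [X in _ <= X](_ : _ = (x * (M / r ^+ n.+1)) * x ^+ n); last by ring.
  by rewrite ler_pM2r// exprn_gt0.
set K := M / r ^+ n.+1 in key.
have K0 : 0 <= K by rewrite divr_ge0// exprn_ge0// ltW.
rewrite leNgt; apply/negP => cn0.
have [K00|Kn0] := eqVneq K 0.
  by have := key r r0 (lexx r); rewrite K00 mulr0 leNgt cn0.
have {}K0 : 0 < K by rewrite lt_neqAle eq_sym Kn0.
pose x := Num.min r (normc (c n) / K / 2).
have x0 : 0 < x by rewrite /x lt_min r0 /= divr_gt0 ?ltr0n // divr_gt0.
have := key x x0 _; rewrite ge_min lexx => /(_ isT).
have : x * K <= normc (c n) / K / 2 * K by rewrite ler_pM2r// ge_min lexx orbT.
have -> : normc (c n) / K / 2 * K = normc (c n) / 2 by field.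
lra.
Qed.

End PowerSeries.

(** * The power series of the complex exponential *)

Section ComplexExp.
Context {R : realType}.
Local Notation C := R[i].
Implicit Types (z w : C) (x y r M : R).

Lemma expC0 : expC 0 = 1 :> C.
Proof. by rewrite /expC /= expR0 cos0 sin0 mulr1 mulr0. Qed.

Lemma expCD z w : expC (z + w) = expC z * expC w.
Proof.
case: z => a b; case: w => c d; rewrite /expC /= expRD cosD sinD.
by apply/eqP; rewrite eq_complex /=; apply/andP; split; apply/eqP; ring.
Qed.

Lemma expC_real x : expC x%:C = (expR x)%:C.
Proof. by rewrite /expC /= cos0 sin0 mulr1 mulr0. Qed.

Lemma normc_expC z : normc (expC z) = expR (complex.Re z).
Proof.
rewrite /expC /normc /= !exprMn -mulrDr cos2Dsin2 mulr1 sqrtr_sqr.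
by rewrite gtr0_norm// expR_gt0.
Qed.

Lemma expC_neq0 z : expC z != 0.
Proof. by rewrite -normc_gt0 normc_expC expR_gt0. Qed.

Lemma expCN z : expC (- z) = (expC z)^-1.
Proof.
apply: (mulfI (expC_neq0 z)).
by rewrite -expCD subrr expC0 divff// expC_neq0.
Qed.

Lemma expCMn z n : expC (z *+ n) = expC z ^+ n.
Proof.
elim: n => [|n IH]; first by rewrite mulr0n expC0.
by rewrite mulrS expCD IH exprS.
Qed.

Definition expc_coeff z (n : nat) : C := z ^+ n / n`!%:R.

Lemma sum_exp_coeff_le x n : 0 <= x -> \sum_(k < n) x ^+ k / k`!%:R <= expR x.
Proof.
move=> x0.
have nd : {homo series (exp_coeff x) : a b / (a <= b)%N >-> a <= b}.
  by apply: nondecreasing_series => k _ _; rewrite exp_coeff_ge0.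
have := nondecreasing_cvgn_le nd (is_cvg_series_exp_coeff x) n.
by rewrite -/(expR x) seriesEord.
Qed.

Lemma normc_expc_coeff z n : normc (expc_coeff z n) = normc z ^+ n / n`!%:R.
Proof. by rewrite normcM normcV normcX normc_nat. Qed.

Lemma absb_expc_coeff z : absb (expc_coeff z) (expR (normc z)).
Proof.
move=> n; under eq_bigr do rewrite normc_expc_coeff.
by rewrite sum_exp_coeff_le ?normc_ge0.
Qed.

Lemma expc_coeff_wnorm z : wnorm (expc_coeff z) 1 (expR (normc z)).
Proof.
move=> n; apply: le_trans (absb_expc_coeff z n).
by apply: ler_sum => k _; rewrite expr1n mulr1.
Qed.

Lemma cauchyp_expc_coeff z w n :
  cauchyp (expc_coeff z) (expc_coeff w) n = expc_coeff (z + w) n.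
Proof.
rewrite /expc_coeff addrC exprDn mulr_suml; apply: eq_bigr => k _.
have kn : (k <= n)%N by rewrite -ltnS ltn_ord.
have f0 m : (m`!%:R : C) != 0 by rewrite pnatr_eq0 -lt0n fact_gt0.
apply: (mulIf (f0 n)); rewrite divfK// -mulr_natr.
rewrite -(bin_fact kn) !natrM.
have h1 := f0 k; have h2 := f0 (n - k)%N.
by field; apply/andP.
Qed.

Lemma csum_expc_coeffD z w :
  csum (expc_coeff (z + w)) = csum (expc_coeff z) * csum (expc_coeff w).
Proof.
have [_ h] := cauchyp_wnorm ler01 (expc_coeff_wnorm z) (expc_coeff_wnorm w).
have ps1 (c : nat -> C) : ps c 1 = csum c.
  by apply: eq_csum => k; rewrite expr1n mulr1.
have := h 1; rewrite !ps1 normc1 lexx => /(_ isT) <-.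
by apply: eq_csum => n; rewrite cauchyp_expc_coeff.
Qed.

Lemma expc_coeff_i y n : expc_coeff (0 +i* y) n = cos_coeff y n +i* sin_coeff y n.
Proof.
rewrite /expc_coeff (_ : 0 +i* y = 'i * y%:C); last by simpc.
rewrite exprMn -[_%:C ^+ _]rmorphXn -natrC.
rewrite (_ : (n`!%:R)%:C^-1 = (n`!%:R^-1)%:C); last by rewrite fmorphV.
rewrite -mulrA -rmorphM /= /cos_coeff /sin_coeff /=.
rewrite -[in 'i ^+ n](odd_double_half n) exprD -mul2n exprM sqr_i.
have -> : (-1 : C) ^+ n./2 = ((-1) ^+ n./2)%:C by rewrite rmorphXn rmorphN rmorph1.
case: (boolP (odd n)) => on /=.
  have -> : n.-1./2 = n./2 by case: n on => //= n; rewrite uphalf_half => /negbTE ->.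
  apply/eqP; rewrite expr1 eq_complex /= -?exprnP; apply/andP; split; apply/eqP; ring.
apply/eqP; rewrite expr0 eq_complex /= -?exprnP; apply/andP; split; apply/eqP; ring.
Qed.

(** Both sides turn sums into products, which leaves real and purely imaginary
arguments, where the series are those of [expR], [cos] and [sin]. *)
Lemma expC_csum z : expC z = csum (expc_coeff z).
Proof.
have Ei y : csum (expc_coeff (0 +i* y)) = cos y +i* sin y.
  apply: (hasum_csum (absb_expc_coeff _)); apply: ccvg_ReIm.
    apply: (eq_cvgn (u := fun n => series (cos_coeff y) n)).
      move=> n; rewrite Re_sum seriesEord; apply: eq_bigr => k _.
      by rewrite expc_coeff_i.
    by rewrite unlock; exact: is_cvg_series_cos_coeff.
  apply: (eq_cvgn (u := fun n => series (sin_coeff y) n)).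
    move=> n; rewrite Im_sum seriesEord; apply: eq_bigr => k _.
    by rewrite expc_coeff_i.
  by rewrite unlock; exact: is_cvg_series_sin_coeff.
have Er x : csum (expc_coeff x%:C) = (expR x)%:C.
  apply: (hasum_csum (absb_expc_coeff _)); rewrite /hasum.
  have := @ccvg_real _ (series (exp_coeff x)) (expR x) (is_cvg_series_exp_coeff x).
  rewrite /ccvg; apply: eq_cvgn => n; congr (normc (_ - _)).
  rewrite seriesEord rmorph_sum; apply: eq_bigr => k _.
  by rewrite /expc_coeff /exp_coeff /= rmorphM fmorphV rmorphXn rmorph_nat.
case: z => x y.
have -> : x +i* y = x%:C + (0 +i* y) by simpc.
rewrite csum_expc_coeffD Er Ei /expC /=; simpc.
by [].
Qed.

(** Second order Taylor bound: it is what differentiates q-series term by term.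
*)
Lemma expC_order2 z : normc (expC z - 1 - z) <= normc z ^+ 2 * expR (normc z).
Proof.
have := hasum_shift 2 (csumP (absb_expc_coeff z)).
rewrite -expC_csum 2!big_ord_recl big_ord0 /= addr0 /expc_coeff /bump /=.
rewrite expr0 expr1 fact0 factS fact0 divr1 muln1 divr1 opprD addrA.
move=> h; apply: (hasum_norm_le h) => n.
apply: (@le_trans _ _ (\sum_(k < n) normc z ^+ 2 * (normc z ^+ k / k`!%:R))).
  apply: ler_sum => k _; rewrite normc_expc_coeff exprD -mulrA.
  rewrite ler_wpM2l ?exprn_ge0 ?normc_ge0//.
  rewrite ler_wpM2l ?exprn_ge0 ?normc_ge0// lef_pV2 ?posrE ?ltr0n ?fact_gt0//.
  by rewrite ler_nat !add2n !factS mulnA leq_pmull.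
by rewrite -mulr_sumr ler_wpM2l ?exprn_ge0 ?normc_ge0// sum_exp_coeff_le ?normc_ge0.
Qed.

(** The exponential of a power series is the sum of its powers [cauchyX c k]
over [k`!]. *)
Lemma ps_exp (c : nat -> C) r M : 0 <= r -> wnorm c r M ->
  exists e, wnorm e r (expR M) /\ forall z, normc z <= r -> ps e z = expC (ps c z).
Proof.
move=> r0 cM.
have M0 := wnorm_ge0 cM.
have h1 k : wnorm (fun n => (k`!%:R)^-1 * cauchyX c k n) r (M ^+ k / k`!%:R).
  have := wnormZ (k`!%:R)^-1 r0 (cauchyX_wnorm k r0 cM).1.
  by rewrite normcV normc_nat mulrC.
have h2 n : \sum_(k < n) M ^+ k / k`!%:R <= expR M by exact: sum_exp_coeff_le.
have [w1 w2] := wnorm_sum r0 h1 h2.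
eexists; split; first exact: w1.
move=> z zr; rewrite w2// expC_csum; apply: eq_csum => k.
by rewrite (psZ _ (cauchyX_wnorm k r0 cM).1 zr) (cauchyX_wnorm k r0 cM).2// mulrC.
Qed.

End ComplexExp.

(** * The theta series and the continuation of its inversion formula *)

Section Theta.
Context {R : realType}.
Local Notation C := R[i].
Implicit Types (z w s : C) (x y r M : R).

Lemma geo_le x n : 0 <= x -> x < 1 -> \sum_(k < n) x ^+ k <= (1 - x)^-1.
Proof.
move=> x0 x1; have x1' : 0 < 1 - x by rewrite subr_gt0.
rewrite -(ler_pM2l x1') divff ?gt_eqF//.
have -> : (1 - x) * \sum_(k < n) x ^+ k = 1 - x ^+ n.
  by rewrite -[RHS]opprB subrX1; ring.
by rewrite gerBl exprn_ge0.
Qed.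

Lemma expR_geo_le (d : R) n : 0 < d ->
  \sum_(k < n) expR (- (d * k.+1%:R ^+ 2)) <= (1 - expR (- d))^-1.
Proof.
move=> d0; have e1 : expR (- d) < 1 by rewrite expR_lt1 oppr_lt0.
apply: le_trans (geo_le n (expR_ge0 _) e1); apply: ler_sum => k _.
rewrite -expRM_natl ler_expR mulrN lerN2 [leLHS]mulrC ler_pM2l//.
by rewrite -natrX ler_nat (@leq_trans k.+1)// -{1}(expn1 k.+1) leq_pexp2l.
Qed.

(** The sum of [exp (- pi n^2 w)] over all integers, with [n] and [- n] taken
together. *)
Definition theta w : C :=
  1 + 2 * csum (fun n => expC (- (pi * n.+1%:R ^+ 2)%:C * w)).

Lemma theta_absb w : 0 < complex.Re w ->
  absb (fun n => expC (- (pi * n.+1%:R ^+ 2)%:C * w)) ((1 - expR (- (pi * complex.Re w)))^-1).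
Proof.
move=> w0 n; apply: le_trans (expR_geo_le n (mulr_gt0 (pi_gt0 R) w0)).
apply: ler_sum => k _; rewrite normc_expC -rmorphN Re_scale.
by rewrite le_eqVlt; apply/orP; left; apply/eqP; congr expR; ring.
Qed.

(** Writing [w = w0 + ps b z] turns every term of the theta series into the
exponential of a power series; [B < Re w0] makes the bounds of these
exponentials summable. This is how both sides of the inversion formula become
power series in a local parameter. *)
Lemma theta_compose (b : nat -> C) w0 r B : 0 <= r -> wnorm b r B ->
  B < complex.Re w0 ->
  exists e K, wnorm e r K /\
    forall z, normc z <= r -> ps e z = theta (w0 + ps b z).
Proof.
move=> r0 bB Bw.
pose l n : C := - (pi * n.+1%:R ^+ 2)%:C.
have ln n : normc (l n) = pi * n.+1%:R ^+ 2.
  by rewrite normcNE normc_real ger0_norm// mulr_ge0// ?pi_ge0 ?exprn_ge0.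
have bn n := wnormZ (l n) r0 bB.
have [f hf] := choice (fun n => ps_exp r0 (bn n)).
have d0 : 0 < pi * (complex.Re w0 - B) by rewrite mulr_gt0 ?pi_gt0// subr_gt0.
have h1 n : wnorm (fun k => expC (l n * w0) * f n k) r
    (expR (- (pi * (complex.Re w0 - B) * n.+1%:R ^+ 2))).
  have := wnormZ (expC (l n * w0)) r0 (hf n).1.
  apply: wnorm_leM; rewrite normc_expC -expRD ln /l -rmorphN Re_scale.
  by rewrite le_eqVlt; apply/orP; left; apply/eqP; congr expR; ring.
have [w1 w2] := wnorm_sum r0 h1 (fun n => expR_geo_le n d0).
have [one1 one2] := ps_one (0 : C) r0.
set e := fun m => csum (fun k => expC (l k * w0) * f k m) in w1 w2.
exists (fun n => (n == 0%N)%:R + 2 * e n); eexists; split.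
  by apply: (wnormD r0 one1); exact: wnormZ r0 w1.
move=> z zr; rewrite (psD one1 (wnormZ 2 r0 w1) zr) (psZ _ w1 zr) (ps_one z r0).2.
rewrite w2// /theta; congr (1 + 2 * _); apply: eq_csum => n.
by rewrite (psZ _ (hf n).1 zr) (hf n).2// (psZ _ bB zr) mulrDr expCD.
Qed.

(** The inversion formula at [w = s^2]: the square root is the parameter, so
that no branch has to be chosen. *)
Definition inversion_at s := theta (s ^+ 2)^-1 = s * theta (s ^+ 2).

Lemma ps_X r z : 0 <= r -> wnorm (fun n => (n == 1%N)%:R : C) r r /\
  ps (fun n => (n == 1%N)%:R) z = z.
Proof.
move=> r0; split.
  case=> [|[|n]]; first by rewrite big_ord0.
    by rewrite big_ord_recl big_ord0 /= normc0 mul0r addr0.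
  rewrite 2!big_ord_recl /= normc0 normc1 mul0r mul1r expr1 add0r big1 ?addr0//.
  by move=> i _; rewrite mul0r.
rewrite /ps (@csum_fin _ _ 2%N) ?big_ord_recl ?big_ord0 /= ?mul0r ?mul1r ?add0r ?expr1 ?addr0//.
by case=> [|[|k]] // _; rewrite mul0r.
Qed.

Lemma ps_geo r z : 0 <= r -> r < 1 -> wnorm (fun n => (n != 0%N)%:R : C) r (r / (1 - r)) /\
  (normc z <= r -> ps (fun n => (n != 0%N)%:R) z = z / (1 - z)).
Proof.
move=> r0 r1; have h1 : wnorm (fun n => (n != 0%N)%:R : C) r (r / (1 - r)).
  case=> [|n]; first by rewrite big_ord0 divr_ge0// subr_ge0 ltW.
  rewrite big_ord_recl /= normc0 mul0r add0r.
  apply: (@le_trans _ _ (r * \sum_(k < n) r ^+ k)).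
    by rewrite mulr_sumr; apply: ler_sum => i _; rewrite normc1 mul1r -exprS.
  by rewrite ler_wpM2l// geo_le.
split=> // zr.
have z1 : 1 - z != 0.
  rewrite subr_eq0; apply: contraTneq zr => <-; by rewrite normc1 -ltNge.
apply: (mulIf z1); rewrite divfK//.
have [a1 a2] := ps_one z r0; have [x1 x2] := ps_X z r0.
have hd := wnormD r0 a1 (wnormZ (-1) r0 x1).
have [g1 g2] := cauchyp_wnorm r0 h1 hd.
have : ps (cauchyp (fun n => (n != 0%N)%:R) (fun n => (n == 0%N)%:R + -1 * (n == 1%N)%:R)) z = z.
  rewrite -[RHS]x2; apply: eq_csum => n; congr (_ * _).
  case: n => [|n]; first by rewrite /cauchyp big_ord_recl big_ord0 /= mul0r addr0.
  case: n => [|n]; first by rewrite /cauchyp !big_ord_recl big_ord0 /= /bump /=; ring.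
  rewrite /cauchyp big_ord_recr /= big_ord_recr /= big1 ?add0r.
    by rewrite subnn subSn// subnn /=; ring.
  move=> i _; rewrite subn_eq0 leqNgt ltnS (ltnW (ltn_ord i)) /=.
  have -> : ((n.+2 - i)%N == 1%N) = false.
    by have := ltn_ord i; lia.
  by rewrite (_ : false%:R = 0 :> C)// mulr0 addr0 mulr0.
by rewrite g2// (psD a1 (wnormZ (-1) r0 x1) zr) (psZ _ x1 zr) a2 x2 mulN1r.
Qed.

(** In the parameter [z] with [s = s0 (1 - z)], the two sides are power series
on the disc of radius [r]: the squares of [1 - z] and of its inverse stay in
the half plane of convergence by the two numerical hypotheses. The difference
vanishes on the real segment, so all its coefficients vanish. *)
Lemma inversion_at_disc s0 r : 0 < r -> r < 1 ->
  normc s0 ^+ 2 * (2 * r + r ^+ 2) < complex.Re (s0 ^+ 2) ->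
  (normc s0 ^+ 2)^-1 * (2 * (r / (1 - r)) + (r / (1 - r)) ^+ 2) <
     complex.Re ((s0 ^+ 2)^-1) ->
  (forall x, 0 < x -> x <= r -> inversion_at (s0 * (1 - x%:C))) ->
  forall z, normc z <= r -> inversion_at (s0 * (1 - z)).
Proof.
move=> r0 r1 h1 h2 hx; have r0' := ltW r0.
have [a1 a2] := ps_one (0 : C) r0'; have [x1 _] := ps_X (0 : C) r0'.
have [g1 _] := ps_geo (0 : C) r0' r1.
have [xx1 xx2] := cauchyp_wnorm r0' x1 x1.
have [gg1 gg2] := cauchyp_wnorm r0' g1 g1.
have p1 := wnormD r0' (wnormZ (-2) r0' x1) xx1.
have q1 := wnormD r0' (wnormZ 2 r0' g1) gg1.
rewrite normcNE normc_nat -expr2 in p1; rewrite normc_nat -expr2 in q1.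
have p2 := wnormZ (s0 ^+ 2) r0' p1.
have q2 := wnormZ ((s0 ^+ 2)^-1) r0' q1.
rewrite normcX in p2; rewrite normcV normcX in q2.
have [e [K [e1 e2]]] := theta_compose r0' p2 h1.
have [f [L [f1 f2]]] := theta_compose r0' q2 h2.
have pE z : normc z <= r -> ps e z = theta ((s0 * (1 - z)) ^+ 2).
  move=> zr; rewrite e2// (psZ _ p1 zr) (psD (wnormZ (-2) r0' x1) xx1 zr).
  rewrite (psZ _ x1 zr) xx2// !(ps_X z r0').2; congr theta; ring.
have z1 z : normc z <= r -> 1 - z != 0.
  move=> zr; rewrite subr_eq0; apply: contraTneq zr => <-.
  by rewrite normc1 -ltNge.
have s00 : s0 != 0.
  by apply: contraTneq h1 => ->; rewrite normc0 !expr2 !mul0r ltxx.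
have qE z : normc z <= r -> ps f z = theta ((s0 * (1 - z)) ^+ 2)^-1.
  move=> zr; rewrite f2// (psZ _ q1 zr) (psD (wnormZ 2 r0' g1) gg1 zr).
  rewrite (psZ _ g1 zr) gg2// !((ps_geo z r0' r1).2 zr); congr theta.
  have := z1 z zr; by move=> ?; field; apply/andP.
have [m1 m2] := cauchyp_wnorm r0' (wnormD r0' a1 (wnormZ (-1) r0' x1)) e1.
have dM := wnormD r0' f1 (wnormZ (- s0) r0' m1).
have dE z : normc z <= r -> ps (fun n => f n + - s0 *
    cauchyp (fun n => (n == 0%N)%:R + -1 * (n == 1%N)%:R) e n) z =
    theta ((s0 * (1 - z)) ^+ 2)^-1 - s0 * (1 - z) * theta ((s0 * (1 - z)) ^+ 2).
  move=> zr; rewrite (psD f1 (wnormZ (- s0) r0' m1) zr) (psZ _ m1 zr) m2//.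
  rewrite (psD a1 (wnormZ (-1) r0' x1) zr) (psZ _ x1 zr) (ps_one z r0').2 (ps_X z r0').2.
  rewrite pE// qE//; ring.
have d0 := ps_unique r0 dM _.
move=> z zr; rewrite /inversion_at; apply/eqP; rewrite -subr_eq0 -dE//.
apply/eqP; rewrite /ps (_ : (fun n => _) = fun=> 0); last first.
  apply: funext => n; rewrite d0 ?mul0r// => x x0 xr.
  have xC : normc x%:C <= r by rewrite normc_real gtr0_norm.
  by rewrite dE// hx// subrr.
by rewrite (@csum_fin _ _ 0%N)// big_ord0.
Qed.

Lemma Re_sqr s : complex.Re (s ^+ 2) = complex.Re s ^+ 2 - complex.Im s ^+ 2.
Proof. by rewrite expr2 Re_mul -!expr2. Qed.

Lemma Re_inv w : complex.Re w^-1 = complex.Re w / normc w ^+ 2.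
Proof. by rewrite sqr_normcE; case: w. Qed.

(** As long as the slope [Im s / Re s] stays at most [q < 1],
[inversion_at_disc] applies with a radius [r] that depends only on [q]. If the
formula holds on the ray of some slope, it then holds on all rays whose slope
differs by at most [r]; starting from the real axis, [N] such steps with [q / N
<= r] reach the slope of [s]. *)
Lemma inversion_at_sector :
  (forall x, 0 < x -> inversion_at x%:C) ->
  forall s, `|complex.Im s| < complex.Re s -> inversion_at s.
Proof.
move=> hx s sI.
set a := complex.Re s in sI; set b := complex.Im s in sI.
have a0 : 0 < a by exact: le_lt_trans (normr_ge0 _) sI.
pose q := `|b| / a.
have q0 : 0 <= q by rewrite divr_ge0// ltW.
have q1 : q < 1 by rewrite ltr_pdivrMr// mul1r.
(* [c0 |s|^2 <= Re (s^2)] in the whole sector of slope at most [q] *)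
pose c0 := (1 - q ^+ 2) / 2.
have qq : q ^+ 2 < 1 by rewrite expr_lt1.
have c00 : 0 < c0 by rewrite divr_gt0// subr_gt0.
have qq0 : 0 <= q ^+ 2 by exact: exprn_ge0.
have c01 : c0 <= 1 / 2 by rewrite /c0; lra.
pose r := c0 / 8.
have r0 : 0 < r by rewrite divr_gt0.
have r16 : r <= 1 / 16 by rewrite /r; lra.
have r1 : r < 1 by lra.
have hr1 : 2 * r + r ^+ 2 < c0.
  have : r ^+ 2 <= r * 1 by rewrite expr2 ler_wpM2l// ltW.
  by rewrite /r; lra.
have hr2 : 2 * (r / (1 - r)) + (r / (1 - r)) ^+ 2 < c0.
  have hr : r / (1 - r) <= c0 / 7.
    rewrite ler_pdivrMr ?subr_gt0// /r.
    have : c0 * (1 - c0 / 8) >= c0 * (7 / 8) by rewrite ler_pM2l//; lra.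
    lra.
  have hr0 : 0 <= r / (1 - r) by rewrite divr_ge0 ?(ltW r0)// subr_ge0 ltW.
  have : (r / (1 - r)) ^+ 2 <= r / (1 - r) * 1.
    by rewrite expr2 ler_wpM2l//; lra.
  lra.
have slope (a' b' : R) : 0 < a' -> `|b'| <= q * a' ->
    c0 * normc (a' +i* b') ^+ 2 <= complex.Re ((a' +i* b') ^+ 2).
  move=> a'0 hb; rewrite Re_sqr sqr_normcE /=.
  have : b' ^+ 2 <= q ^+ 2 * a' ^+ 2.
    by rewrite -(real_normK (num_real b')) -exprMn lerXn2r ?nnegrE// mulr_ge0// ltW.
  have := sqr_ge0 b'; set B := b' ^+ 2; set A := a' ^+ 2 => B0 BA.
  have A0 : 0 <= A by exact: sqr_ge0.
  have : c0 * (A + B) <= c0 * (A + A).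
    rewrite ler_pM2l// lerD2l (le_trans BA)// -[leRHS]mul1r ler_wpM2r// ltW//.
  rewrite /c0; lra.
have step (a' b' : R) : 0 < a' -> `|b'| <= q * a' ->
    (forall x, 0 < x -> x <= r -> inversion_at ((a' +i* b') * (1 - x%:C))) ->
    forall z, normc z <= r -> inversion_at ((a' +i* b') * (1 - z)).
  move=> a'0 hb; have hs := slope a' b' a'0 hb.
  have n0 : 0 < normc (a' +i* b') ^+ 2.
    rewrite sqr_normcE /= ltr_wpDr ?sqr_ge0// exprn_gt0//.
  apply: inversion_at_disc => //.
    by apply: lt_le_trans hs; rewrite mulrC ltr_pM2r.
  rewrite Re_inv normcX -exprM; apply: (@lt_le_trans _ _ ((normc (a' +i* b') ^+ 2)^-1 * c0)).
    by rewrite ltr_pM2l ?invr_gt0.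
  rewrite exprM; set m := normc _ ^+ 2 in n0 hs *; set X := complex.Re _ in hs *.
  have -> : X / m ^+ 2 = m^-1 * (X / m) by field; rewrite gt_eqF.
  by apply: ler_wpM2l; rewrite ?invr_ge0 ?(ltW n0)// ler_pdivlMr.
pose N := (Num.truncn (q / r)).+1.
have N0 : 0 < N%:R :> R by rewrite ltr0n.
have qN : q / N%:R <= r.
  rewrite ler_pdivrMr// mulrC -ler_pdivrMr//.
  have /truncn_itv/andP[_] : 0 <= q / r by rewrite divr_ge0// ltW.
  by move/ltW.
have Q k : (k <= N)%N -> forall a' b' : R, 0 < a' -> `|b'| <= k%:R / N%:R * q * a' ->
    inversion_at (a' +i* b').
  elim: k => [|k IH] kN a' b' a'0 hb.
    rewrite !mul0r in hb; have /eqP : b' = 0 by apply/eqP; rewrite -normr_le0.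
    by move/eqP => ->; exact: hx.
  pose b0 := b' * (k%:R / k.+1%:R).
  have k1 : 0 < k.+1%:R :> R by rewrite ltr0n.
  have hb0 : `|b0| <= k%:R / N%:R * q * a'.
    rewrite normrM [X in _ * X]ger0_norm ?divr_ge0// mulrA ler_pdivrMr//.
    rewrite [leRHS](_ : _ = k.+1%:R / N%:R * q * a' * k%:R); last by ring.
    by rewrite ler_wpM2r.
  have kN1 : k%:R / N%:R <= 1 :> R by rewrite ler_pdivrMr// mul1r ler_nat ltnW.
  have hb1 : `|b0| <= q * a'.
    apply: le_trans hb0 _; rewrite -[leRHS]mul1r -mulrA ler_wpM2r//.
    by rewrite mulr_ge0// ltW.
  have s0N : a' +i* b0 != 0 by rewrite eq_complex /= gt_eqF.
  have -> : a' +i* b' = (a' +i* b0) * (1 - (a' +i* b0 - (a' +i* b')) / (a' +i* b0)).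
    by field.
  apply: step => //.
    move=> x x0 xr.
    have -> : (a' +i* b0) * (1 - x%:C) = (a' * (1 - x)) +i* (b0 * (1 - x)).
      by apply/eqP; rewrite eq_complex /=; apply/andP; split; apply/eqP; ring.
    have x1 : 0 < 1 - x by lra.
    apply: IH; first exact: ltnW.
      by rewrite mulr_gt0.
    by rewrite normrM (gtr0_norm x1) mulrA ler_pM2r.
  have -> : a' +i* b0 - (a' +i* b') = (0 +i* (b0 - b')).
    by apply/eqP; rewrite eq_complex /= subrr !eqxx.
  rewrite normcM normcV ler_pdivrMr ?normc_gt0//.
  have -> : normc (0 +i* (b0 - b')) = `|b'| / k.+1%:R.
    rewrite /normc expr0n /= add0r sqrtr_sqr.
    have -> : b0 - b' = - (b' / k.+1%:R).
      rewrite /b0 -natr1; field; rewrite natr1; exact: lt0r_neq0.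
    by rewrite normrN normrM normfV [X in _ / X]ger0_norm.
  apply: (@le_trans _ _ (r * a')); last first.
    rewrite ler_pM2l//; have := normc_ReP (a' +i* b0); rewrite /= gtr0_norm//.
  rewrite ler_pdivrMr//; apply: le_trans hb _.
  rewrite [leLHS](_ : _ = (q / N%:R) * a' * k.+1%:R); last by ring.
  by rewrite ler_pM2r// ler_pM2r.
have -> : s = a +i* b by rewrite /a /b; case: (s).
apply: (Q N (leqnn N)) => //; rewrite divff ?gt_eqF// mul1r /q divfK// gt_eqF//.
Qed.

End Theta.

(** * Trigonometric bounds and roots of unity *)

Section SineBounds.
Context {R : realType}.
Implicit Types (x y : R).

Lemma ge0_deriv_le (f df : R -> R) y :
  (forall x, is_derive x (1 : R) f (df x)) -> (forall x, 0 <= x -> 0 <= df x) ->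
  0 <= y -> f 0 <= f y.
Proof.
move=> fd d0 y0; have [->//|yn0] := eqVneq y 0.
have yp : 0 < y by rewrite lt_neqAle eq_sym yn0.
have cf : {within `[0, y], continuous f}.
  apply: derivable_within_continuous => x _.
  by case: (fd x).
have [c] := MVT yp (fun x _ => fd x) cf.
rewrite in_itv /= => /andP[c0 _] e.
by rewrite -subr_ge0 e mulr_ge0 ?d0 ?subr_ge0// ltW.
Qed.

Lemma sin_le_id y : 0 <= y -> sin y <= y.
Proof.
move=> y0; have := @ge0_deriv_le (fun x => x - sin x) (fun x => 1 - cos x) y.
rewrite sin0 subr0 subr_ge0; apply => // [x _]; by rewrite subr_ge0 cos_le1.
Qed.

Lemma cos_ge y : 0 <= y -> 1 - y ^+ 2 / 2 <= cos y.
Proof.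
move=> y0; have := @ge0_deriv_le (fun x => cos x + (2^-1 * x ^+ 2 - 1)) (fun x => x - sin x) y.
rewrite cos0 expr0n /= mulr0 sub0r subrr => h.
have : 0 <= cos y + (2^-1 * y ^+ 2 - 1).
  apply: h => // x.
    apply: is_derive_eq; rewrite /GRing.scale /=; field.
    by [].
  by rewrite subr_ge0; exact: sin_le_id.
lra.
Qed.

Lemma sin_ge y : 0 <= y -> y - y ^+ 3 / 6 <= sin y.
Proof.
move=> y0; have := @ge0_deriv_le (fun x => sin x + (6^-1 * x ^+ 3 - x)) (fun x => cos x + (x ^+ 2 / 2 - 1)) y.
rewrite sin0 expr0n /= mulr0 subr0 addr0 => h.
have : 0 <= sin y + (6^-1 * y ^+ 3 - y).
  apply: h => // x.
    apply: is_derive_eq; rewrite /GRing.scale /=; field.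
    by [].
  by move=> /cos_ge; lra.
lra.
Qed.

Lemma expR_le_1Bx x : 0 <= x -> x < 1 -> expR (- (x / (1 - x))) <= 1 - x.
Proof.
move=> x0 x1; have x1' : 0 < 1 - x by rewrite subr_gt0.
rewrite expRN -[leRHS]invrK lef_pV2 ?posrE ?expR_gt0 ?invr_gt0//.
apply: le_trans (expR_ge1Dx _); rewrite le_eqVlt; apply/orP; left; apply/eqP.
by field; rewrite gt_eqF.
Qed.

End SineBounds.

Section RootsOfUnity.
Context {R : realType}.
Local Notation C := R[i].

Definition cis (x : R) : C := expC (0 +i* x).

Lemma cisE x : cis x = cos x +i* sin x.
Proof. by rewrite /cis /expC /= expR0 !mul1r. Qed.

Lemma cisD x y : cis (x + y) = cis x * cis y.
Proof. by rewrite /cis -expCD; congr expC; simpc. Qed.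

Lemma cisX x n : cis x ^+ n = cis (x * n%:R).
Proof.
elim: n => [|n IH]; first by rewrite expr0 (_ : x * 0%:R = 0) ?mulr0// cisE cos0 sin0.
by rewrite exprS IH -cisD -natr1; congr cis; ring.
Qed.

Lemma cis_2pi n : cis (2 * pi * n%:R) = 1.
Proof.
rewrite -cisX cisE.
have -> : 2 * pi = pi *+ 2 :> R by rewrite mulr_natl.
by rewrite cos2pi sin2pi expr1n.
Qed.

(** A geometric sum: it vanishes unless the root of unity is 1. *)
Lemma sum_roots (l m : nat) : (0 < l)%N ->
  \sum_(j < l) cis (2 * pi * m%:R / l%:R) ^+ j = ((l %| m) * l)%N%:R.
Proof.
move=> l0; have l0' : l%:R != 0 :> R by rewrite pnatr_eq0 -lt0n.
set z := cis _.
have zl : z ^+ l = 1.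
  by rewrite cisX divfK// cis_2pi.
(* reduced to an angle below [2 pi], where [cis] can only be 1 at angle 0 *)
have zE : z = cis (2 * pi * (m %% l)%:R / l%:R).
  have -> : 2 * pi * (m %% l)%:R / l%:R = 2 * pi * m%:R / l%:R - 2 * pi * (m %/ l)%:R :> R.
    have e : m%:R = (m %/ l)%:R * l%:R + (m %% l)%:R :> R.
      by rewrite -natrM -natrD -divn_eq.
    by rewrite e; field.
  rewrite -[RHS]mulr1 -(cis_2pi (m %/ l)) -cisD; congr cis; ring.
case: (boolP (l %| m)%N) => lm.
  have -> : z = 1 by rewrite zE (eqP lm) mulr0 mul0r cisE cos0 sin0.
  by under eq_bigr do rewrite expr1n; rewrite sumr_const card_ord mul1n.
rewrite mul0n.
have zn1 : z - 1 != 0.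
  rewrite subr_eq0; apply/negP => /eqP.
  have ml : (0 < m %% l)%N by rewrite lt0n; apply: contra lm => /eqP h; apply/eqP.
  pose x : R := pi * (m %% l)%:R / l%:R.
  have xE : 2 * pi * (m %% l)%:R / l%:R = x *+ 2 by rewrite /x -mulr_natr; field.
  have x0 : 0 < sin x.
    apply: sin_gt0_pi; apply/andP; split.
      by rewrite !mulr_gt0 ?pi_gt0 ?invr_gt0 ?ltr0n.
    by rewrite /x -mulrA gtr_pMr ?pi_gt0// ltr_pdivrMr ?ltr0n// mul1r ltr_nat ltn_mod.
  rewrite zE cisE => /(congr1 (@complex.Re _)) /=; rewrite xE cos_mulr2n.
  have := cos2Dsin2 x; have : 0 < sin x ^+ 2 by rewrite exprn_gt0.
  rewrite -mulr_natr; lra.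
apply: (mulfI zn1); rewrite mulr0 -subrX1 zl subrr//.
Qed.

(** Expand [(u + 1 / u)^(2 n)] for [u = exp (i pi j / l)] and sum over [j]:
only exponents divisible by [l] survive. Since [u^(2 l) = 1], the factor [u^(-
2 n)] may be written [u^(2 (l - 1) n)], which keeps all exponents natural. *)
Lemma binomial_filter (l n : nat) : (0 < l)%N ->
  \sum_(j < l) (2 * cos (pi * j%:R / l%:R) : R) ^+ (2 * n) =
  l%:R * \sum_(k < (2 * n).+1) ((l %| k + (l - 1) * n) * 'C(2 * n, k))%N%:R.
Proof.
move=> l0; have l0' : l%:R != 0 :> R by rewrite pnatr_eq0 -lt0n.
apply: (@complexI R); rewrite rmorph_sum rmorphM rmorph_sum /=.
pose u (j : nat) : C := cis (pi * j%:R / l%:R).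
have uu j : (2 * cos (pi * j%:R / l%:R))%:C = u j + (u j)^-1.
  rewrite /u {2}/cis -expCN /cis /expC /= oppr0 expR0 !mul1r cosN sinN.
  by apply/eqP; rewrite eq_complex /=; apply/andP; split; apply/eqP; ring.
have u2l j : u j ^+ (2 * l) = 1.
  by rewrite /u cisX -(cis_2pi j) natrM; congr cis; field.
have u0 j : u j != 0 by exact: expC_neq0.
have key (j : 'I_l) : ((2 * cos (pi * j%:R / l%:R)) ^+ (2 * n))%:C =
    \sum_(k < (2 * n).+1) 'C(2 * n, k)%:R *
      cis (2 * pi * (k + (l - 1) * n)%:R / l%:R) ^+ j.
  rewrite rmorphXn /= uu.
  have -> : (u j + (u j)^-1) ^+ (2 * n) = (1 + u j ^+ 2) ^+ (2 * n) * u j ^+ (2 * ((l - 1) * n)).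
    have -> : u j + (u j)^-1 = (1 + u j ^+ 2) / u j by field.
    rewrite expr_div_n; congr (_ * _).
    apply: (mulfI (expf_neq0 (2 * n) (u0 j))).
    rewrite divff ?expf_neq0// -exprD.
    have -> : (2 * n + 2 * ((l - 1) * n) = 2 * l * n)%N by nia.
    by rewrite exprM u2l expr1n.
  rewrite exprDn mulr_suml; apply: eq_bigr => k _.
  rewrite expr1n mul1r -[in LHS]mulr_natr mulrC mulrA mulrC; congr (_ * _).
  rewrite -exprM -exprD -mulnDr addnC !cisX; congr cis.
  by rewrite natrM; ring.
under eq_bigr do rewrite key.
rewrite exchange_big /= mulr_sumr; apply: eq_bigr => k _.
rewrite -mulr_sumr sum_roots// !natrC -!natrM; congr (_%:R); lia.
Qed.

End RootsOfUnity.

(** * Polya's finite inversion identity *)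

Section Polya.
Context {R : realType}.
Local Notation C := R[i].
Implicit Types (x y s : R) (l m p : nat).

Lemma sum_multiples (F : nat -> nat) l m : (0 < l)%N ->
  (\sum_(d < m * l) (l %| d.+1) * F d.+1 = \sum_(i < m) F (l * i.+1))%N.
Proof.
move=> l0; elim: m => [|m IH]; first by rewrite mul0n !big_ord0.
rewrite mulSnr big_split_ord /= IH big_ord_recr /=; congr (_ + _)%N.
case: l l0 {IH} => // l _; rewrite big_ord_recr /= big1 ?add0n.
  have -> : ((m * l.+1 + l).+1 = l.+1 * m.+1)%N by nia.
  by rewrite dvdn_mulr// mul1n.
move=> j _; rewrite -addnS dvdn_addr ?dvdn_mull//.
by rewrite gtnNdvd// ltnS.
Qed.

(** The surviving indices are [k = m + l i] for integers [i]; the symmetry of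
binomial coefficients folds [i] and [- i] together. *)
Lemma binomial_multiples l m : (0 < l)%N ->
  (\sum_(k < (2 * m).+1) (l %| k + (l - 1) * m) * 'C(2 * m, k) =
   'C(2 * m, m) + 2 * \sum_(i < m) 'C(2 * m, m + l * i.+1))%N.
Proof.
move=> l0.
have E : (\sum_(d < m) (l %| d.+1) * 'C(2 * m, m + d.+1) =
          \sum_(i < m) 'C(2 * m, m + l * i.+1))%N.
  rewrite -(sum_multiples (fun d => 'C(2 * m, m + d)) m l0).
  have -> : (m * l = m + m * (l - 1))%N by nia.
  rewrite big_split_ord /= [X in (_ + X)%N]big1 ?addn0// => i _.
  by rewrite bin_small ?muln0//; lia.
have -> : (2 * m).+1 = (m + (1 + m))%N by lia.
rewrite big_split_ord big_split_ord /= big_ord1 /= addn0.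
have -> : (l %| m + (l - 1) * m)%N.
  have -> : (m + (l - 1) * m = l * m)%N by nia.
  exact: dvdn_mulr.
rewrite mul1n -E; set S := (\sum_(d < m) _)%N.
suff [-> ->] : (\sum_(i < m) (l %| i + (l - 1) * m) * 'C(2 * m, i) = S)%N /\
  (\sum_(i < m) (l %| m + (1 + i) + (l - 1) * m) * 'C(2 * m, m + (1 + i)) = S)%N by lia.
split.
  rewrite /S (reindex_inj rev_ord_inj) /=; apply: eq_bigr => d _.
  have dm := ltn_ord d.
  have -> : (l %| m - d.+1 + (l - 1) * m)%N = (l %| d.+1)%N.
    have h : (m - d.+1 + (l - 1) * m + d.+1 = l * m)%N by nia.
    have h1 : (l %| m - d.+1 + (l - 1) * m + d.+1)%N by rewrite h dvdn_mulr.
    by apply/idP/idP => h2; move: h1; rewrite ?(dvdn_addr _ h2) ?(dvdn_addl _ h2).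
  by congr (_ * _)%N; rewrite -bin_sub; [congr 'C(_, _); lia|lia].
apply: eq_bigr => d _; rewrite add1n addnS; congr (_ * _)%N.
have -> : ((m + d).+1 + (l - 1) * m = d.+1 + l * m)%N by nia.
by rewrite dvdn_addl// dvdn_mulr.
Qed.

(** Even powers of the cosine have period [pi], so [j] and [l - j] give the
same term. *)
Lemma cos_sum_fold p m :
  \sum_(j < 2 * p + 1) cos (pi * j%:R / (2 * p + 1)%:R) ^+ (2 * m) =
  1 + 2 * \sum_(j < p) cos (pi * j.+1%:R / (2 * p + 1)%:R) ^+ (2 * m) :> R.
Proof.
set l := (2 * p + 1)%N.
have l0 : l%:R != 0 :> R by rewrite pnatr_eq0 /l addn1.
have fold (F : nat -> R) : \sum_(j < l) F j =
    F 0%N + \sum_(j < p) F j.+1 + \sum_(j < p) F (1 + p + (p - j.+1))%N.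
  have -> : l = (1 + p + p)%N by rewrite /l; lia.
  rewrite big_split_ord big_split_ord /= big_ord1 /=; congr (_ + _).
  by rewrite (reindex_inj rev_ord_inj).
rewrite (fold (fun j => cos (pi * j%:R / l%:R) ^+ (2 * m))) mulr0 mul0r cos0 expr1n.
rewrite -addrA; congr (_ + _); rewrite mulr_natl mulr2n; congr (_ + _).
apply: eq_bigr => j _.
have jp := ltn_ord j.
have -> : pi * (1 + p + (p - j.+1))%:R / l%:R = - (pi * j.+1%:R / l%:R) + pi :> R.
  have -> : (1 + p + (p - j.+1) = l - j.+1)%N by rewrite /l; lia.
  by rewrite natrB; [field|rewrite /l; lia].
by rewrite cosDpi cosN !exprM sqrrN.
Qed.

(** In the limit of large [m], this is the Gaussian [exp (- k^2 / m)]. *)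
Definition cratio m k : R := 'C(2 * m, m + k)%:R / 'C(2 * m, m)%:R.

(** A finite form of the inversion formula of theta: for [2 p + 1] close to a
multiple of the square root of [m], the left-hand sum tends to a theta series
by [cos x^(2 m) ~ exp (- m x^2)], the right-hand sum to the theta series at the
inverse argument by [cratio m k ~ exp (- k^2 / m)]. *)
Lemma polya_identity p m :
  1 + 2 * \sum_(j < p) cos (pi * j.+1%:R / (2 * p + 1)%:R) ^+ (2 * m) =
  (2 * p + 1)%:R * ('C(2 * m, m)%:R / 4 ^+ m) *
  (1 + 2 * \sum_(i < m) cratio m ((2 * p + 1) * i.+1)) :> R.
Proof.
rewrite -cos_sum_fold; set l := (2 * p + 1)%N.
have l0 : (0 < l)%N by rewrite /l addn1.
have c0 : 'C(2 * m, m)%:R != 0 :> R by rewrite pnatr_eq0 -lt0n bin_gt0; lia.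
have f0 : 4 ^+ m != 0 :> R by rewrite expf_neq0.
have := @binomial_filter R l m l0.
under eq_bigr do rewrite exprMn exprM -natrX /=.
rewrite -mulr_sumr -natr_sum binomial_multiples// => h.
apply: (mulfI f0); rewrite [LHS]h natrD natrM natr_sum.
rewrite /cratio -mulr_suml; field; exact/andP.
Qed.

Lemma cratio0 m : cratio m 0 = 1.
Proof.
by rewrite /cratio addn0 divff// pnatr_eq0 -lt0n bin_gt0; lia.
Qed.

Lemma cratioS m k : (m + k.+1)%:R * cratio m k.+1 = (m%:R - k%:R) * cratio m k \/ (m < k)%N.
Proof.
case: (leqP k m) => km; [left|by right].
rewrite /cratio !mulrA; congr (_ / _); rewrite -natrB// -!natrM; congr (_%:R).
by rewrite addnS mul_bin_left; congr (_ * _)%N; lia.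
Qed.

Lemma cratio_ge0 m k : 0 <= cratio m k.
Proof. by rewrite divr_ge0. Qed.

Lemma cratio_gt m k : (m < k)%N -> cratio m k = 0.
Proof. by move=> mk; rewrite /cratio bin_small ?mul0r//; lia. Qed.

(** The ratio of consecutive terms is [1 - (2 k + 1) / (m + k + 1)], at most
[exp (- (2 k + 1) / d)], and the odd numbers add up to [k^2]. *)
Lemma cratio_le m k (d : R) : 0 < d -> (m + k)%:R <= d ->
  cratio m k <= expR (- (k%:R ^+ 2 / d)).
Proof.
move=> d0; elim: k => [|k IH] kd.
  by rewrite cratio0 expr0n mul0r oppr0 expR0.
have {}IH : cratio m k <= expR (- (k%:R ^+ 2 / d)).
  by apply: IH; apply: le_trans kd; rewrite ler_nat; lia.
have [h|mk] := cratioS m k; last by rewrite cratio_gt ?expR_ge0//; lia.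
case: (leqP k m) => km; last by rewrite cratio_gt ?expR_ge0//; lia.
have mk0 : 0 < (m + k.+1)%:R :> R by rewrite ltr0n addnS.
have -> : cratio m k.+1 = (1 - (2 * k%:R + 1) / (m + k.+1)%:R) * cratio m k.
  apply: (mulfI (lt0r_neq0 mk0)); rewrite h.
  have n0 := lt0r_neq0 mk0; have -> : m%:R - k%:R = (m + k.+1)%:R - (2 * k%:R + 1) :> R.
    by rewrite natrD -natr1; ring.
  by generalize (cratio m k) => c; field.
have -> : - (k.+1%:R ^+ 2 / d) = - ((2 * k%:R + 1) / d) + - (k%:R ^+ 2 / d).
  by rewrite -natr1; field; exact: lt0r_neq0.
rewrite expRD; apply: ler_pM => //; last 1 first.
- apply: le_trans (expR_ge1Dx _); rewrite lerD2l lerN2 ler_wpM2l//.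
  by rewrite lef_pV2 ?posrE.
- rewrite subr_ge0 ler_pdivrMr// mul1r natrD -natr1.
  have : k%:R <= m%:R :> R by rewrite ler_nat.
  lra.
- exact: cratio_ge0.
Qed.

(** The lower bound matching [cratio_le]: here the ratio of consecutive terms
is the inverse of [1 + (2 k + 1) / (m - k)]. *)
Lemma cratio_ge m k (d : R) : (k <= m)%N -> 0 < d -> d <= m%:R - k%:R + 1 ->
  expR (- (k%:R ^+ 2 / d)) <= cratio m k.
Proof.
move=> + d0; elim: k => [|k IH] km kd.
  by rewrite cratio0 expr0n mul0r oppr0 expR0.
have {}IH : expR (- (k%:R ^+ 2 / d)) <= cratio m k.
  by apply: IH; [lia|apply: le_trans kd _; rewrite -natr1; lra].
have [h|mk] := cratioS m k; last by lia.
have mk0 : 0 < (m + k.+1)%:R :> R by rewrite ltr0n addnS.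
have km0 : 0 < m%:R - k%:R :> R by rewrite subr_gt0 ltr_nat.
have -> : cratio m k.+1 = (1 + (2 * k%:R + 1) / (m%:R - k%:R))^-1 * cratio m k.
  apply: (mulfI (lt0r_neq0 mk0)); rewrite h.
  have -> : (m + k.+1)%:R = m%:R + k%:R + 1 :> R by rewrite natrD -natr1 addrA.
  have k0 : 0 <= k%:R :> R by [].
  by generalize (cratio m k) => c; field; apply/andP; split; apply: lt0r_neq0 => //; lra.
have -> : - (k.+1%:R ^+ 2 / d) = - ((2 * k%:R + 1) / d) + - (k%:R ^+ 2 / d).
  by rewrite -natr1; field; exact: lt0r_neq0.
rewrite expRD; apply: ler_pM => //; rewrite ?expR_ge0//.
have h0 : 0 <= (2 * k%:R + 1) / (m%:R - k%:R) :> R.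
  by rewrite divr_ge0 ?(ltW km0)// addr_ge0 ?mulr_ge0.
rewrite expRN lef_pV2 ?posrE ?expR_gt0//; last by rewrite ltr_pwDl.
apply: le_trans (expR_ge1Dx _); rewrite lerD2l ler_wpM2l//.
by rewrite lef_pV2 ?posrE//; move: kd; rewrite -natr1; lra.
Qed.

End Polya.

(** * The inversion formula of the theta series *)

Section RealInversion.
Context {R : realType}.
Local Notation C := R[i].
Implicit Types (x y s : R) (l m p : nat).

Lemma near_eq_cvgn (u v : nat -> R) (l : R) :
  (\forall n \near \oo, u n = v n) -> u @ \oo --> l -> v @ \oo --> l.
Proof.
move=> [N _ hN] ul; apply/cvgrPdistC_le => e e0.
move/cvgrPdistC_le: ul => /(_ e e0) [K _ hK].
exists (maxn N K) => // n /=; rewrite geq_max => /andP[Nn Kn].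
by rewrite -(hN n Nn); exact: hK.
Qed.

Lemma cvgnM (u v : nat -> R) (a b : R) :
  u @ \oo --> a -> v @ \oo --> b -> u n * v n @[n --> \oo] --> a * b.
Proof. exact: cvgM. Qed.

Lemma cvgnD (u v : nat -> R) (a b : R) :
  u @ \oo --> a -> v @ \oo --> b -> u n + v n @[n --> \oo] --> a + b.
Proof. exact: cvgD. Qed.

Lemma cvgnB (u v : nat -> R) (a b : R) :
  u @ \oo --> a -> v @ \oo --> b -> u n - v n @[n --> \oo] --> a - b.
Proof. exact: cvgB. Qed.

Lemma cvgnV (u : nat -> R) (a : R) : a != 0 ->
  u @ \oo --> a -> (u n)^-1 @[n --> \oo] --> a^-1.
Proof. exact: cvgV. Qed.

Lemma cvgnX2 (u : nat -> R) (a : R) :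
  u @ \oo --> a -> u n ^+ 2 @[n --> \oo] --> a ^+ 2.
Proof.
move=> ua; apply: (eq_cvgn (u := fun n => u n * u n)) => [n|]; first by rewrite expr2.
by rewrite expr2; exact: cvgnM.
Qed.

Definition sqrtS (m : nat) : R := Num.sqrt m.+1%:R.

Lemma sqrtS_gt0 m : 0 < sqrtS m. Proof. by rewrite sqrtr_gt0. Qed.

Lemma sqr_sqrtS m : sqrtS m ^+ 2 = m.+1%:R.
Proof. by rewrite sqr_sqrtr. Qed.

Lemma sqrtS_ge1 m : 1 <= sqrtS m.
Proof. by rewrite -[leLHS](@sqrtr1 R) ler_wsqrtr// ler1n. Qed.

Lemma invsqrt_cvg0 : (sqrtS n)^-1 @[n --> \oo] --> (0 : R).
Proof.
apply: (eq_cvgn (u := fun n => Num.sqrt (n.+1%:R^-1))).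
  by move=> n; rewrite /sqrtS sqrtrV.
rewrite -[X in _ --> X](@sqrtr0 R).
by apply: (continuous_cvg _ (@sqrt_continuous R 0)); exact: cvg_harmonic.
Qed.

(** Squeezed between the exponentials given by [1 - x <= exp (- x)] and
[expR_le_1Bx]. *)
Lemma exp_lim (x : nat -> R) (X : R) :
  (forall m, 0 <= x m <= 1) ->
  m.+1%:R * x m @[m --> \oo] --> X ->
  (1 - x m) ^+ m.+1 @[m --> \oo] --> expR (- X).
Proof.
move=> x01 xX.
have x0 : x @ \oo --> (0 : R).
  apply: (eq_cvgn (u := fun m => m.+1%:R^-1 * (m.+1%:R * x m))).
    by move=> m; rewrite mulKf.
  by rewrite -[X in _ --> X](mul0r X); apply: cvgnM => //; exact: cvg_harmonic.
have lo : expR (- (m.+1%:R * x m / (1 - x m))) @[m --> \oo] --> expR (- X).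
  apply: (continuous_cvg _ (@continuous_expR R _)); apply: cvgN.
  rewrite -[X in _ --> X]divr1; apply: cvgnM => //.
  apply: cvgV; first exact: oner_neq0.
  rewrite -[X in _ --> X]subr0; apply: cvgB => //; exact: cvg_cst.
have hi : expR (- (m.+1%:R * x m)) @[m --> \oo] --> expR (- X).
  by apply: (continuous_cvg _ (@continuous_expR R _)); apply: cvgN.
apply: (squeeze_cvgr _ lo hi).
have xlt : \forall m \near \oo, x m < 1.
  by apply: (cvgr_lt _ x0); exact: ltr01.
near=> m; have xm1 : x m < 1 by near: m.
have /andP[xm0 _] := x01 m.
have h1 := expR_le_1Bx xm0 xm1.
have h2 : 1 - x m <= expR (- x m) by apply: le_trans (expR_ge1Dx _); rewrite lexx.
apply/andP; split.
  rewrite -mulrA -mulrN expRM_natl lerXn2r ?nnegrE ?expR_ge0// subr_ge0 ltW//.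
by rewrite -mulrN expRM_natl lerXn2r ?nnegrE ?expR_ge0// subr_ge0 ltW.
Unshelve. all: by end_near. Qed.

Section Scale.
Variable s : R.
Hypothesis s0 : 0 < s.

(** With [l] the odd number [lscale m] close to [alpha] times the square root
of [m + 1], the angles [pi (j + 1) / l] and the multiples [l (i + 1)] have the
right size for both sides of [polya_identity] to converge to theta series at
[s^2] and at its inverse. *)
Definition alpha : R := Num.sqrt pi / s.

Definition pscale (m : nat) : nat := Num.truncn (alpha * sqrtS m / 2).
Definition lscale (m : nat) : nat := (2 * pscale m + 1)%N.
Definition lratio (m : nat) : R := (lscale m)%:R / sqrtS m.

Let alpha_gt0 : 0 < alpha. Proof. by rewrite divr_gt0// sqrtr_gt0 pi_gt0. Qed.
Let sp0 : Num.sqrt pi != 0 :> R.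
Proof. by rewrite gt_eqF// sqrtr_gt0 pi_gt0. Qed.

Let sn0 : s != 0. Proof. by rewrite gt_eqF. Qed.

Let sM0 m : 0 < sqrtS m. Proof. exact: sqrtS_gt0. Qed.

Let sMn0 m : sqrtS m != 0. Proof. exact: lt0r_neq0. Qed.

Let lbounds m : alpha * sqrtS m / 2 <= (lscale m)%:R /\ `|(lscale m)%:R - alpha * sqrtS m| <= 1 :> R.
Proof.
have h0 : 0 <= alpha * sqrtS m / 2 by rewrite divr_ge0// mulr_ge0 ?ltW.
have /andP[h1 h2] := truncn_itv h0.
rewrite -/(pscale m) in h1 h2.
have p0 : 0 <= (pscale m)%:R :> R by [].
rewrite /lscale natrD natrM; rewrite -[X in _ < X]natr1 in h2; split.
  lra.
rewrite ler_norml; apply/andP; split; lra.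
Qed.

Let lratio_dist m : `|lratio m - alpha| <= (sqrtS m)^-1.
Proof.
have [_] := lbounds m; rewrite /lratio.
have -> : (lscale m)%:R / sqrtS m - alpha = ((lscale m)%:R - alpha * sqrtS m) / sqrtS m.
  by field; exact: lt0r_neq0.
rewrite normrM (gtr0_norm (_ : 0 < (sqrtS m)^-1)) ?invr_gt0// => h.
by rewrite ler_pdivrMr// mulVf// lt0r_neq0.
Qed.

Let lratio_cvg : lratio @ \oo --> alpha.
Proof.
apply/cvgrPdistC_le => e e0.
have [N _ hN] := cvgr0_norm_le _ invsqrt_cvg0 _ e0; exists N => // m /= /hN /=.
rewrite ger0_norm ?invr_ge0 ?(ltW (sqrtS_gt0 m))//; apply: le_trans; exact: lratio_dist.
Qed.

Let lratio_ge m : alpha / 2 <= lratio m.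
Proof. by rewrite /lratio ler_pdivlMr//; have [h _] := lbounds m; rewrite mulrAC. Qed.

Let lratio_le m : lratio m <= alpha + 1.
Proof.
rewrite /lratio ler_pdivrMr//; have [_] := lbounds m; have := sqrtS_ge1 m.
rewrite ler_norml => h1 /andP[_ h2]; lra.
Qed.

Let lratio_gt0 m : 0 < lratio m.
Proof. by apply: lt_le_trans (lratio_ge m); rewrite divr_gt0. Qed.

Definition angle (j m : nat) : R := pi * j.+1%:R / (lscale m)%:R.

Let l0 m : 0 < (lscale m)%:R :> R. Proof. by rewrite ltr0n /lscale addn1. Qed.

Let angle_gt0 j m : 0 < angle j m.
Proof. by rewrite divr_gt0// mulr_gt0 ?pi_gt0. Qed.

Let angleE j m : angle j m * sqrtS m = pi * j.+1%:R / lratio m.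
Proof.
rewrite /angle /lratio; field; apply/andP; split; exact: lt0r_neq0.
Qed.

Let angle_scaled_cvg j : angle j m * sqrtS m @[m --> \oo] --> pi * j.+1%:R / alpha.
Proof.
apply: (eq_cvgn (u := fun m => pi * j.+1%:R / lratio m)) => [m|]; first by rewrite angleE.
apply: cvgnM; first exact: cvg_cst.
by apply: cvgnV; [exact: lt0r_neq0|exact: lratio_cvg].
Qed.

Let angle_cvg0 j : angle j @ \oo --> (0 : R).
Proof.
apply: (eq_cvgn (u := fun m => (angle j m * sqrtS m) * (sqrtS m)^-1)).
  by move=> m; rewrite mulfK// lt0r_neq0.
rewrite -[X in _ --> X](mulr0 (pi * j.+1%:R / alpha)).
by apply: cvgnM; [exact: angle_scaled_cvg|exact: invsqrt_cvg0].
Qed.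

Let sin_cvg j : m.+1%:R * sin (angle j m) ^+ 2 @[m --> \oo] --> (pi * j.+1%:R / alpha) ^+ 2.
Proof.
apply: (eq_cvgn (u := fun m => (sin (angle j m) * sqrtS m) ^+ 2)).
  by move=> m; rewrite exprMn sqr_sqrtS mulrC.
suff h : sin (angle j m) * sqrtS m @[m --> \oo] --> pi * j.+1%:R / alpha.
  exact: cvgnX2.
have lo : angle j m * sqrtS m * (1 - angle j m * angle j m / 6) @[m --> \oo] --> pi * j.+1%:R / alpha.
  rewrite -[X in _ --> X]mulr1; apply: cvgnM; first exact: angle_scaled_cvg.
  rewrite -[X in _ --> X]subr0; apply: cvgnB; first exact: cvg_cst.
  have -> : (0 : R) = 0 * 0 / 6 by rewrite !mul0r.
  apply: cvgnM; last exact: cvg_cst.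
  by apply: cvgnM; exact: angle_cvg0.
apply: (squeeze_cvgr _ lo (@angle_scaled_cvg j)).
near=> m; apply/andP; split.
  have := sin_ge (ltW (angle_gt0 j m)); rewrite -(ler_pM2r (sqrtS_gt0 m)); apply: le_trans.
  by rewrite le_eqVlt; apply/orP; left; apply/eqP; field.
by rewrite ler_pM2r// sin_le_id// ltW.
Unshelve. all: by end_near. Qed.

Let cosE j m : cos (angle j m) ^+ (2 * m.+1) = (1 - sin (angle j m) ^+ 2) ^+ m.+1.
Proof. by rewrite exprM cos2sin2. Qed.

Let sin01 (y : R) : 0 <= sin y ^+ 2 <= 1.
Proof. by rewrite sqr_ge0 /= -[leRHS](cos2Dsin2 y) lerDr sqr_ge0. Qed.

Let cos_cvg j : cos (angle j m) ^+ (2 * m.+1) @[m --> \oo] -->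
  expR (- (pi * j.+1%:R ^+ 2 * s ^+ 2)).
Proof.
apply: (eq_cvgn (u := fun m => (1 - sin (angle j m) ^+ 2) ^+ m.+1)).
  by move=> m; rewrite cosE.
have -> : pi * j.+1%:R ^+ 2 * s ^+ 2 = (pi * j.+1%:R / alpha) ^+ 2.
  have hp : Num.sqrt pi ^+ 2 = pi :> R by rewrite sqr_sqrtr// pi_ge0.
  by rewrite /alpha -{1 2}hp; field; rewrite ?sp0 ?sn0.
apply: exp_lim; [by move=> m; exact: sin01|exact: sin_cvg].
Qed.

Let cos_le j m : (j < pscale m)%N -> 0 <= cos (angle j m) ^+ (2 * m.+1) <=
   expR (- (pi ^+ 2 / (9 * (alpha + 1) ^+ 2) * j.+1%:R ^+ 2)).
Proof.
move=> jp; rewrite cosE exprn_ge0 ?subr_ge0; last by have /andP[] := sin01 (angle j m).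
have y2 : angle j m <= 2.
  apply: le_trans (ltW (pihalf_lt2 R)); rewrite /angle ler_pdivrMr//.
  rewrite -[leRHS]mulrA ler_pM2l ?pi_gt0// mulrC ler_pdivlMr// -natrM ler_nat /lscale.
  lia.
have h1 : 1 - sin (angle j m) ^+ 2 <= expR (- sin (angle j m) ^+ 2) by exact: expR_ge1Dx.
apply: (@le_trans _ _ (expR (- sin (angle j m) ^+ 2) ^+ m.+1)).
  by rewrite lerXn2r ?nnegrE ?expR_ge0// subr_ge0; have /andP[] := sin01 (angle j m).
rewrite -expRM_natl ler_expR mulrN lerN2.
have hs : angle j m / 3 <= sin (angle j m).
  apply: le_trans (sin_ge (ltW (angle_gt0 j m))).
  have hy : angle j m ^+ 3 <= 4 * angle j m.
    rewrite exprSr ler_pM2r//.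
    have -> : 4 = 2 ^+ 2 :> R by rewrite -natrX.
    by rewrite lerXn2r ?nnegrE// ltW.
  lra.
have hs2 : (angle j m / 3) ^+ 2 <= sin (angle j m) ^+ 2.
  rewrite lerXn2r ?nnegrE ?(le_trans _ hs)// divr_ge0// ltW//.
apply: (@le_trans _ _ (m.+1%:R * (angle j m / 3) ^+ 2)); last by rewrite ler_pM2l.
have -> : m.+1%:R * (angle j m / 3) ^+ 2 = pi ^+ 2 / (9 * lratio m ^+ 2) * j.+1%:R ^+ 2.
  rewrite -(sqr_sqrtS m); have -> : sqrtS m ^+ 2 * (angle j m / 3) ^+ 2 = (angle j m * sqrtS m) ^+ 2 / 9 by field.
  by rewrite angleE; field; exact: lt0r_neq0.
rewrite ler_pM2r ?exprn_gt0// ler_pM2l ?exprn_gt0 ?pi_gt0//.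
have A0 : 0 < alpha + 1 by rewrite addr_gt0.
have h2 : 0 < 9 * (alpha + 1) ^+ 2 by rewrite mulr_gt0// exprn_gt0.
have h3 : 0 < 9 * lratio m ^+ 2 by rewrite mulr_gt0// exprn_gt0.
rewrite lef_pV2 ?posrE// ler_pM2l//.
by apply: lerXn2r; rewrite ?nnegrE ?(ltW A0) ?(ltW (lratio_gt0 m))// lratio_le.
Qed.

Definition lmul (i m : nat) : nat := (lscale m * i.+1)%N.

Let lmulE i m : (lmul i m)%:R = lratio m * i.+1%:R * sqrtS m :> R.
Proof. by rewrite /lmul natrM /lratio; field; exact: lt0r_neq0. Qed.

Let ratio_cvg i : cratio m.+1 (lmul i m) @[m --> \oo] -->
  expR (- (pi * i.+1%:R ^+ 2 * (s ^+ 2)^-1)).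
Proof.
have -> : pi * i.+1%:R ^+ 2 * (s ^+ 2)^-1 = (alpha * i.+1%:R) ^+ 2.
  have hp : Num.sqrt pi ^+ 2 = pi :> R by rewrite sqr_sqrtr// pi_ge0.
  by rewrite /alpha -{1}hp; field; rewrite ?sn0.
have q1 : lratio m * i.+1%:R @[m --> \oo] --> alpha * i.+1%:R.
  by apply: cvgnM; [exact: lratio_cvg|exact: cvg_cst].
have q2 : lratio m * i.+1%:R / sqrtS m @[m --> \oo] --> (0 : R).
  rewrite -[X in _ --> X](mulr0 (alpha * i.+1%:R)).
  by apply: cvgnM; [exact: q1|exact: invsqrt_cvg0].
have q3 : sqrtS m ^- 2 @[m --> \oo] --> (0 : R).
  apply: (eq_cvgn (u := fun m => (m.+1%:R : R)^-1)) => [m|]; first by rewrite sqr_sqrtS.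
  exact: cvg_harmonic.
have lim1 (f : nat -> R) : f @ \oo --> (1 : R) ->
    expR (- ((lratio m * i.+1%:R) ^+ 2 / f m)) @[m --> \oo] --> expR (- (alpha * i.+1%:R) ^+ 2).
  move=> f1; apply: (continuous_cvg _ (@continuous_expR R _)); apply: cvgN.
  rewrite -[X in _ --> X]divr1; apply: cvgnM; last by apply: cvgnV => //; exact: oner_neq0.
  exact: cvgnX2.
have hi := lim1 (fun m => 1 + lratio m * i.+1%:R / sqrtS m) _.
have lo := lim1 (fun m => 1 - lratio m * i.+1%:R / sqrtS m + sqrtS m ^- 2) _.
have {}hi : expR (- ((lratio m * i.+1%:R) ^+ 2 / (1 + lratio m * i.+1%:R / sqrtS m)))
   @[m --> \oo] --> expR (- (alpha * i.+1%:R) ^+ 2).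
  by apply: hi; rewrite -[X in _ --> X]addr0; apply: cvgnD => //; exact: cvg_cst.
have {}lo : expR (- ((lratio m * i.+1%:R) ^+ 2 / (1 - lratio m * i.+1%:R / sqrtS m + sqrtS m ^- 2)))
   @[m --> \oo] --> expR (- (alpha * i.+1%:R) ^+ 2).
  apply: lo; rewrite -[X in _ --> X]addr0; apply: cvgnD => //.
  by rewrite -[X in _ --> X]subr0; apply: cvgnB => //; exact: cvg_cst.
apply: (squeeze_cvgr _ lo hi).
have q2lt : \forall m \near \oo, lratio m * i.+1%:R / sqrtS m < 1.
  by apply: (cvgr_lt _ q2); exact: ltr01.
near=> m; have hm : lratio m * i.+1%:R / sqrtS m < 1 by near: m.
have s0' := lt0r_neq0 (sqrtS_gt0 m).
have K0 : 0 <= lratio m * i.+1%:R / sqrtS m := divr_ge0 (mulr_ge0 (ltW (lratio_gt0 m)) (ler0n R i.+1)) (ltW (sM0 m)).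
have KM : (lmul i m <= m.+1)%N.
  rewrite -(ler_nat R) lmulE -(sqr_sqrtS m) expr2 ler_pM2r//.
  by move/ltW: hm; rewrite ler_pdivrMr// mul1r.
have E (c : R) : (lmul i m)%:R ^+ 2 / (m.+1%:R * c) = (lratio m * i.+1%:R) ^+ 2 / c.
  have [->|c0] := eqVneq c 0; first by rewrite mulr0 invr0 !mulr0.
  by rewrite lmulE -(sqr_sqrtS m); field; apply/andP.
apply/andP; split.
  rewrite -E; apply: cratio_ge => //.
    apply: mulr_gt0 => //; rewrite ltr_pwDr ?invr_gt0 ?exprn_gt0//.
    by rewrite subr_ge0 ltW.
  by rewrite lmulE -(sqr_sqrtS m) le_eqVlt; apply/orP; left; apply/eqP; field.
rewrite -E; apply: cratio_le.
  by rewrite mulr_gt0// ltr_pwDl.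
by rewrite natrD lmulE -(sqr_sqrtS m) le_eqVlt; apply/orP; left; apply/eqP; field.
Unshelve. all: by end_near. Qed.

Let ratio_le i m : cratio m.+1 (lmul i m) <= expR (- (alpha ^+ 2 / 8 * i.+1%:R ^+ 2)).
Proof.
case: (leqP (lmul i m) m.+1) => KM; last by rewrite cratio_gt// expR_ge0.
apply: le_trans (@cratio_le R m.+1 (lmul i m) (2 * m.+1%:R) _ _) _.
- by rewrite mulr_gt0.
- by rewrite -natrM ler_nat; lia.
rewrite ler_expR lerN2 lmulE -(sqr_sqrtS m).
have -> : (lratio m * i.+1%:R * sqrtS m) ^+ 2 / (2 * sqrtS m ^+ 2) = lratio m ^+ 2 / 2 * i.+1%:R ^+ 2.
  by field; exact: lt0r_neq0.
rewrite ler_pM2r ?exprn_gt0//.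
have : (alpha / 2) ^+ 2 <= lratio m ^+ 2.
  apply: lerXn2r; last exact: lratio_ge.
    by rewrite nnegrE divr_ge0// ltW.
  by rewrite nnegrE ltW.
lra.
Qed.

Lemma theta_real (x : R) : theta x%:C =
  1 + 2 * csum (fun n => (expR (- (pi * n.+1%:R ^+ 2 * x)))%:C).
Proof.
rewrite /theta; congr (1 + 2 * _); apply: eq_csum => n.
by rewrite -rmorphN -rmorphM expC_real mulNr.
Qed.

Definition cos_side (m : nat) : R := 1 + 2 *
  \sum_(j < pscale m) cos (pi * j.+1%:R / (lscale m)%:R) ^+ (2 * m.+1).
Definition binom_side (m : nat) : R := 1 + 2 *
  \sum_(i < m.+1) cratio m.+1 (lscale m * i.+1).

(** Dominated convergence: for [j < pscale m] the angle is below [pi / 2],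
where [sin y >= y / 3] bounds the powers of the cosine by a Gaussian in [j]
with a rate independent of [m]. *)
Lemma cos_side_cvg : ccvg (fun m => (cos_side m)%:C) (theta (s%:C ^+ 2)).
Proof.
rewrite -rmorphXn /= theta_real.
pose f m j : C := (if (j < pscale m)%N then cos (angle j m) ^+ (2 * m.+1) else 0)%:C.
have -> : (fun m => (cos_side m)%:C) = (fun m => 1 + 2 * csum (f m)).
  apply: funext => m; rewrite (@csum_fin _ _ (pscale m)); last first.
    by move=> k; rewrite /f leqNgt => /negbTE ->.
  rewrite /cos_side rmorphD rmorphM rmorph1 rmorph_sum /= natrC; congr (_ + _ * _).
  by apply: eq_bigr => j _; rewrite /f ltn_ord.
apply: ccvgD; first exact: ccvg_cst.
apply: ccvgZ.
have c0 : 0 < pi ^+ 2 / (9 * (alpha + 1) ^+ 2) :> R.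
  by rewrite divr_gt0 ?exprn_gt0 ?pi_gt0// mulr_gt0// exprn_gt0// addr_gt0.
apply: (tannery (B := fun j => expR (- (pi ^+ 2 / (9 * (alpha + 1) ^+ 2) * j.+1%:R ^+ 2)))
  _ _ (fun n => expR_geo_le n c0)).
- move=> j; apply: ccvg_real.
  apply: (@near_eq_cvgn (fun m => cos (angle j m) ^+ (2 * m.+1))); last exact: cos_cvg.
  have ylt : \forall m \near \oo, angle j m < 1.
    by apply: (cvgr_lt _ (angle_cvg0 j)); exact: ltr01.
  near=> m; have : angle j m < 1 by near: m.
  rewrite /angle ltr_pdivrMr// mul1r => h.
  have : 2 * j.+1%:R < (lscale m)%:R :> R.
    by apply: le_lt_trans h; rewrite ler_pM2r// pi_ge2.
  rewrite -natrM ltr_nat /lscale => h2.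
  by have -> : (j < pscale m)%N by lia.
- move=> m j; rewrite normc_real /f; case: ifPn => jp; last by rewrite normr0 expR_ge0.
  have /andP[h1 h2] := cos_le jp.
  by rewrite ger0_norm.
Unshelve. all: by end_near. Qed.

(** Dominated convergence, the termwise limits coming from [cratio_ge] and
[cratio_le] and the majorant from [cratio_le] with [d = 2 (m + 1)]. *)
Lemma binom_side_cvg : ccvg (fun m => (binom_side m)%:C) (theta (s%:C ^+ 2)^-1).
Proof.
rewrite -rmorphXn -fmorphV /= theta_real.
pose f m i : C := (cratio m.+1 (lmul i m))%:C.
have -> : (fun m => (binom_side m)%:C) = (fun m => 1 + 2 * csum (f m)).
  apply: funext => m; rewrite (@csum_fin _ _ m.+1); last first.
    move=> k km; rewrite /f cratio_gt// /lmul.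
    by apply: (@leq_trans k.+1) => //; rewrite leq_pmull// /lscale addn1.
  by rewrite /binom_side rmorphD rmorphM rmorph1 rmorph_sum /= natrC.
apply: ccvgD; first exact: ccvg_cst.
apply: ccvgZ.
have c0 : 0 < alpha ^+ 2 / 8 by rewrite divr_gt0// exprn_gt0.
apply: (tannery (B := fun j => expR (- (alpha ^+ 2 / 8 * j.+1%:R ^+ 2)))
  _ _ (fun n => expR_geo_le n c0)).
- by move=> i; apply: ccvg_real; exact: ratio_cvg.
- move=> m i; rewrite normc_real ger0_norm ?cratio_ge0//; exact: ratio_le.
Qed.

Lemma polya_sides m : cos_side m = (lscale m)%:R * ('C(2 * m.+1, m.+1)%:R / 4 ^+ m.+1) * binom_side m.
Proof. exact: polya_identity. Qed.

Lemma lscale_cvg : (lscale m)%:R / sqrtS m @[m --> \oo] --> Num.sqrt pi / s.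
Proof. exact: lratio_cvg. Qed.

End Scale.

Lemma theta_real_neq0 (x : R) : 0 < x -> theta x%:C != 0.
Proof.
move=> x0; have ha := theta_absb (_ : 0 < complex.Re x%:C).
have h : 1 <= complex.Re (theta x%:C).
  have /ccvg_Re := csumP (ha x0).
  move=> cv; rewrite /theta Re_add -(@natrC R 2) Re_scale.
  have : 0 <= complex.Re (csum (fun n => expC (- (pi * n.+1%:R ^+ 2)%:C * x%:C))).
    apply: (ler_cvg_to (cvg_cst 0) cv).
    near=> n; rewrite Re_sum sumr_ge0// => i _.
    by rewrite -rmorphN -rmorphM expC_real /= expR_ge0.
  by move=> h; rewrite lerDl mulr_ge0.
apply/eqP => e; move: h; rewrite e /= => h.
by have := lt_le_trans ltr01 h; rewrite ltxx.
Unshelve. all: by end_near. Qed.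

(** The identity at [x] is divided by the one at [1]: the central binomial
coefficient cancels, and what remains is the ratio of the two values of [l],
which tends to [1 / x]. *)
Lemma inversion_at_real (x : R) : 0 < x -> inversion_at x%:C.
Proof.
move=> x0; rewrite /inversion_at.
have L1 := cos_side_cvg x0; have R1 := binom_side_cvg x0.
have L2 := @cos_side_cvg 1 ltr01; have R2 := @binom_side_cvg 1 ltr01.
rewrite rmorph1 expr1n in L2; rewrite rmorph1 expr1n invr1 in R2.
have t1 : theta (1 : C) != 0 by rewrite -(rmorph1 (real_complex R)) theta_real_neq0.
have sp0 : Num.sqrt pi != 0 :> R by rewrite gt_eqF// sqrtr_gt0 pi_gt0.
have lr : (lscale x m)%:R / (lscale 1 m)%:R @[m --> \oo] --> x^-1.
  apply: (eq_cvgn (u := fun m => ((lscale x m)%:R / sqrtS m) / ((lscale 1 m)%:R / sqrtS m))).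
    move=> m; have h1 : sqrtS m != 0 by rewrite gt_eqF// sqrtS_gt0.
    have h2 : (lscale 1 m)%:R != 0 :> R by rewrite pnatr_eq0 /lscale addn1.
    by field; apply/andP.
  have -> : x^-1 = (Num.sqrt pi / x) / (Num.sqrt pi / 1).
    by rewrite divr1; field; rewrite sp0 gt_eqF.
  apply: cvgnM; first exact: lscale_cvg.
  by apply: cvgnV; [rewrite divr1|exact: lscale_cvg].
have e1 := ccvgM L1 R2.
have e2 := ccvgM (ccvg_real lr) (ccvgM R1 L2).
have E m : (cos_side x m)%:C * (binom_side 1 m)%:C =
   ((lscale x m)%:R / (lscale 1 m)%:R)%:C * ((binom_side x m)%:C * (cos_side 1 m)%:C) :> C.
  rewrite -!rmorphM; congr (_%:C); rewrite !polya_sides.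
  have h2 : (lscale 1 m)%:R != 0 :> R by rewrite pnatr_eq0 /lscale addn1.
  have f0 : 4 ^+ m.+1 != 0 :> R by rewrite expf_neq0.
  by field; apply/andP.
have := ccvg_unique e1 _; move: e2.
have -> : (fun n => ((lscale x n)%:R / (lscale 1 n)%:R)%:C * ((binom_side x n)%:C * (cos_side 1 n)%:C))
  = (fun n => (cos_side x n)%:C * (binom_side 1 n)%:C) :> (nat -> C) by apply: funext => m; rewrite E.
move=> e2 /(_ _ e2); rewrite mulrA => /(mulIf t1) ->.
by rewrite fmorphV mulVKf// fmorph_eq0 gt_eqF.
Qed.

Lemma theta_inversion (s : C) : `|complex.Im s| < complex.Re s ->
  theta (s ^+ 2)^-1 = s * theta (s ^+ 2).
Proof. exact: (inversion_at_sector inversion_at_real). Qed.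

End RealInversion.

(** * The Jacobi triple product *)

Section TripleProduct.
Context {R : realType}.
Local Notation C := R[i].
Implicit Types (q x y z : R) (k l m n N M : nat).

(** The q-Pochhammer symbol [(q; q)_n]. *)
Definition qpoch q n : R := \prod_(i < n) (1 - q ^+ i.+1).

(** The Gaussian binomial coefficient, defined by its Pascal rule so that it
makes sense for all [q] and all indices. *)
Fixpoint qbin q M k : R :=
  match M, k with
  | _, 0 => 1
  | 0, _.+1 => 0
  | M'.+1, k'.+1 => qbin q M' k + q ^+ (M' - k') * qbin q M' k'
  end.

Lemma qbin0 q M : qbin q M 0 = 1. Proof. by case: M. Qed.

Lemma qbin_gt q M k : (M < k)%N -> qbin q M k = 0.
Proof.
elim: M k => [|M IH] [|k] //= Mk; rewrite !IH ?mulr0 ?addr0//; exact: ltnW.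
Qed.

Lemma qpochS q n : qpoch q n.+1 = qpoch q n * (1 - q ^+ n.+1).
Proof. by rewrite /qpoch big_ord_recr. Qed.

Lemma qpoch0 q : qpoch q 0 = 1. Proof. by rewrite /qpoch big_ord0. Qed.

Lemma qbinE q M k : (k <= M)%N -> qbin q M k * (qpoch q k * qpoch q (M - k)) = qpoch q M.
Proof.
elim: M k => [|M IH] [|k] //= kM; rewrite ?qpoch0 ?mul1r ?subn0//.
rewrite subSS; have {}kM : (k <= M)%N by [].
have h2 := IH k kM.
move: kM; rewrite leq_eqVlt => /orP[/eqP kM|kM].
  rewrite -kM subnn qpoch0 mulr1 qbin_gt// add0r expr0 mul1r.
  by rewrite -kM subnn qpoch0 mulr1 in h2; rewrite qpochS mulrA h2.
have h1 := IH k.+1 kM.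
have e : (M - k = (M - k.+1).+1)%N by lia.
rewrite e qpochS in h2 *; rewrite qpochS in h1 *; rewrite qpochS -e.
have -> : q ^+ M.+1 = q ^+ (M - k) * q ^+ k.+1 by rewrite -exprD; congr (_ ^+ _); lia.
rewrite -e in h2.
transitivity (qbin q M k.+1 * (qpoch q k * (1 - q ^+ k.+1) * qpoch q (M - k.+1)) * (1 - q ^+ (M - k)) +
   q ^+ (M - k) * (qbin q M k * (qpoch q k * (qpoch q (M - k.+1) * (1 - q ^+ (M - k))))) * (1 - q ^+ k.+1)).
  ring.
by rewrite h1 h2; ring.
Qed.

(** Induction on [M] with the Pascal rule; the new factor [1 + x q^M] shifts
the exponent [C(k, 2)] to [C(k + 1, 2)] at the cost of [q^(M - k)]. *)
Lemma cauchy_binomial q x M :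
  \prod_(i < M) (1 + x * q ^+ i) = \sum_(k < M.+1) q ^+ 'C(k, 2) * qbin q M k * x ^+ k.
Proof.
elim: M => [|M IH].
  by rewrite big_ord0 big_ord_recl big_ord0 /= bin0n expr0 !mulr1 addr0.
rewrite big_ord_recr IH /= [RHS]big_ord_recl /= bin0n expr0 !mulr1.
have -> : \sum_(i < M.+1) q ^+ 'C(bump 0 i, 2) * (qbin q M (bump 0 i) + q ^+ (M - i) * qbin q M i) * x ^+ bump 0 i =
  \sum_(i < M.+1) q ^+ 'C(i.+1, 2) * qbin q M i.+1 * x ^+ i.+1 +
  x * q ^+ M * \sum_(k < M.+1) q ^+ 'C(k, 2) * qbin q M k * x ^+ k.
  rewrite mulr_sumr -big_split; apply: eq_bigr => i _; rewrite /bump /= add1n.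
  have iM : (i <= M)%N by rewrite -ltnS.
  rewrite mulrDr mulrDl; congr (_ + _).
  rewrite binS bin1 addnC exprD exprS.
  have -> : q ^+ M = q ^+ i * q ^+ (M - i) by rewrite -exprD; congr (_ ^+ _); lia.
  ring.
rewrite addrA mulrDr mulr1 [X in _ + X]mulrC; congr (_ + _).
rewrite [in LHS]big_ord_recl /= bin0n expr0 !mulr1 qbin0; congr (_ + _).
  by rewrite mulr1.
rewrite [RHS]big_ord_recr /= qbin_gt// mulr0 mul0r addr0; apply: eq_bigr => i _.
by rewrite /bump /= add1n.
Qed.

(** The [2 N] factors of the Cauchy product in base [q^2], started at [z q^(1 -
2 N)], are the factors of the triple product, except that the first [N] appear
as [1 + z q^(- (2 i + 1))]; pulling out [z q^(- (2 i + 1))] from these turns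
them into [1 + z^-1 q^(2 i + 1)]. *)
Lemma prod_symmetrize q z N : q != 0 -> z != 0 ->
  \prod_(i < 2 * N) (1 + z * q / q ^+ (2 * N) * (q ^+ 2) ^+ i) =
  z ^+ N / q ^+ (N ^ 2) *
  \prod_(i < N) ((1 + z * q ^+ (2 * i + 1)) * (1 + z^-1 * q ^+ (2 * i + 1))).
Proof.
move=> q0 z0.
have -> : (2 * N = N + N)%N by lia.
rewrite big_split_ord /= (reindex_inj rev_ord_inj) /=.
have h1 : \prod_(j < N) (1 + z * q / q ^+ (N + N) * q ^+ 2 ^+ (N - j.+1)) =
  z ^+ N / q ^+ (N ^ 2) * \prod_(i < N) (1 + z^-1 * q ^+ (2 * i + 1)).
  have -> : z ^+ N / q ^+ (N ^ 2) = \prod_(i < N) (z / q ^+ (2 * i + 1)).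
    rewrite big_split prodr_const card_ord prodfV; congr (_ / _).
    rewrite -(big_mkord xpredT (fun i => q ^+ (2 * i + 1))) -expr_sum; congr (_ ^+ _).
    elim: N => [|N IH]; first by rewrite big_nil.
    by rewrite big_nat_recr //= -IH; lia.
  rewrite -big_split; apply: eq_bigr => j _ /=; have jN := ltn_ord j.
  have qq n : q ^+ n != 0 by exact: expf_neq0.
  have e : q ^+ (N + N) = q ^+ 2 ^+ (N - j.+1) * q ^+ (2 * j + 1) * q.
    by rewrite -exprM -exprD -exprSr; congr (_ ^+ _); lia.
  by rewrite e; field; rewrite ?expf_neq0//= ?q0 ?z0 ?qq ?expf_neq0.
have h2 : \prod_(i < N) (1 + z * q / q ^+ (N + N) * q ^+ 2 ^+ (N + i)) =
  \prod_(i < N) (1 + z * q ^+ (2 * i + 1)).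
  apply: eq_bigr => i _; congr (1 + _).
  have e : q ^+ 2 ^+ (N + i) = q ^+ (N + N) * q ^+ (2 * i).
    by rewrite -exprM -exprD; congr (_ ^+ _); lia.
  rewrite e addn1 exprS; field; exact: expf_neq0.
by rewrite h1 h2 big_split /=; ring.
Qed.

Lemma qbin_sym q N j : (j <= N)%N -> (forall n, qpoch q n != 0) ->
  qbin q (2 * N) (N - j) = qbin q (2 * N) (N + j).
Proof.
move=> jN q0.
have h1 := @qbinE q (2 * N) (N - j); have h2 := @qbinE q (2 * N) (N + j).
have e1 : (2 * N - (N - j) = N + j)%N by lia.
have e2 : (2 * N - (N + j) = N - j)%N by lia.
rewrite e1 in h1; rewrite e2 in h2.
have nz : qpoch q (N + j) * qpoch q (N - j) != 0 by rewrite mulf_neq0.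
apply: (mulIf nz); rewrite h2; last by lia.
by rewrite mulrC mulrC [_ * qpoch q (N - j)]mulrC h1//; lia.
Qed.

(** The Cauchy binomial theorem at the symmetrized product, with the index
counted from the middle. *)
Lemma triple_product_finite q z N : q != 0 -> z != 0 -> (forall n, qpoch (q ^+ 2) n != 0) ->
  \prod_(i < N) ((1 + z * q ^+ (2 * i + 1)) * (1 + z^-1 * q ^+ (2 * i + 1))) =
  qbin (q ^+ 2) (2 * N) N + \sum_(j < N) qbin (q ^+ 2) (2 * N) (N + j.+1) *
     (q ^+ (j.+1 ^ 2) * (z ^+ j.+1 + z ^- j.+1)).
Proof.
move=> q0 z0 qq0.
have qn n : q ^+ n != 0 by exact: expf_neq0.
have zn n : z ^+ n != 0 by exact: expf_neq0.
have c0 : z ^+ N / q ^+ (N ^ 2) != 0 by rewrite mulf_neq0// invr_eq0.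
apply: (mulfI c0); rewrite -prod_symmetrize// cauchy_binomial.
(* the [k]-th term of the Cauchy sum without its Gaussian coefficient *)
pose T k := q ^+ 2 ^+ 'C(k, 2) * (z * q / q ^+ (2 * N)) ^+ k.
have TE k : T k = q ^+ (k ^ 2) * z ^+ k / q ^+ (2 * N * k).
  rewrite /T expr_div_n -!exprM [(z * q) ^+ k]exprMn.
  have -> : (k ^ 2 = 2 * 'C(k, 2) + k)%N.
    by elim: k => // k IH; rewrite binS bin1; lia.
  by rewrite exprD; ring.
have T1 : T N = z ^+ N / q ^+ (N ^ 2).
  rewrite TE; have -> : (2 * N * N = N ^ 2 + N ^ 2)%N by lia.
  by rewrite exprD; field.
have T2 j : T (N + j)%N = z ^+ N / q ^+ (N ^ 2) * (q ^+ (j ^ 2) * z ^+ j).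
  rewrite TE; have -> : (2 * N * (N + j) = N ^ 2 + N ^ 2 + 2 * N * j)%N by lia.
  have -> : ((N + j) ^ 2 = N ^ 2 + 2 * N * j + j ^ 2)%N by lia.
  by rewrite !exprD; field; rewrite !qn.
have T3 j : (j <= N)%N -> T (N - j)%N = z ^+ N / q ^+ (N ^ 2) * (q ^+ (j ^ 2) * z ^- j).
  move=> jN; rewrite TE.
  have e : q ^+ ((N - j) ^ 2) * q ^+ (N ^ 2) = q ^+ (2 * N * (N - j)) * q ^+ (j ^ 2).
    rewrite -!exprD; congr (_ ^+ _).
    have [d ->] : exists d, N = (j + d)%N by exists (N - j)%N; rewrite subnKC.
    by rewrite addKn; lia.
  have e2 : z ^+ N = z ^+ (N - j) * z ^+ j by rewrite -exprD subnK.
  rewrite e2; apply: (mulIf (qn (N ^ 2)%N)); apply: (mulIf (qn (2 * N * (N - j))%N)).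
  transitivity (q ^+ ((N - j) ^ 2) * q ^+ (N ^ 2) * z ^+ (N - j)).
    by field; rewrite ?qn.
  by rewrite e; field; rewrite ?qn ?zn.
have fold (F : nat -> R) :
    \sum_(k < (2 * N).+1) F k = \sum_(i < N) F i + (F N + \sum_(i < N) F (N + (1 + i))%N).
  have -> : ((2 * N).+1 = N + (1 + N))%N by lia.
  by rewrite big_split_ord big_split_ord /= big_ord1 /= addn0.
rewrite (fold (fun k => q ^+ 2 ^+ 'C(k, 2) * qbin (q ^+ 2) (2 * N) k * (z * q / q ^+ (2 * N)) ^+ k)).
have -> : q ^+ 2 ^+ 'C(N, 2) * qbin (q ^+ 2) (2 * N) N * (z * q / q ^+ (2 * N)) ^+ N =
   z ^+ N / q ^+ (N ^ 2) * qbin (q ^+ 2) (2 * N) N.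
  by rewrite -T1 /T; ring.
rewrite addrCA mulrDr; congr (_ + _).
rewrite (reindex_inj rev_ord_inj) -big_split mulr_sumr; apply: eq_bigr => j _ /=.
have jN := ltn_ord j.
rewrite qbin_sym// add1n.
transitivity (qbin (q ^+ 2) (2 * N) (N + j.+1) * (T (N - j.+1)%N + T (N + j.+1)%N)).
  by rewrite /T; ring.
by rewrite T2 T3//; ring.
Qed.

Section Infinite.
Variable q : R.
Hypothesis q01 : 0 < q < 1.

Let q0 : 0 < q. Proof. by case/andP: q01. Qed.
Let q1 : q < 1. Proof. by case/andP: q01. Qed.

Lemma qfac_gt0 i : 0 < 1 - q ^+ i.+1.
Proof. by rewrite subr_gt0 exprn_ilt1// ltW. Qed.

Lemma qpoch_gt0 n : 0 < qpoch q n.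
Proof. by apply: prodr_gt0 => i _; exact: qfac_gt0. Qed.

Lemma qpoch_le m n : (m <= n)%N -> qpoch q n <= qpoch q m.
Proof.
move=> mn; rewrite -(subnKC mn); elim: (n - m)%N => [|k IH]; first by rewrite addn0.
rewrite addnS qpochS; apply: le_trans IH.
by rewrite ger_pMr ?qpoch_gt0// gerBl exprn_ge0// ltW.
Qed.

(** Euler's product [(q; q)_oo]. *)
Definition qinf : R := limn (qpoch q).

Lemma qpoch_cvg : qpoch q @ \oo --> qinf.
Proof.
apply: nonincreasing_is_cvgn; first by move=> m n; exact: qpoch_le.
by exists 0 => _ [n _ <-]; exact: ltW (qpoch_gt0 n).
Qed.

Lemma qinf_le n : qinf <= qpoch q n.
Proof. by apply: (nonincreasing_cvgn_ge _ qpoch_cvg) => m k; exact: qpoch_le. Qed.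

(** Every factor is bounded below by [1 - x >= exp (- x / (1 - x))], and the
exponents [q^(i+1) / (1 - q)] are summable. *)
Lemma qinf_gt0 : 0 < qinf.
Proof.
apply: (@lt_le_trans _ _ (expR (- ((1 - q)^-1 * (1 - q)^-1)))); first exact: expR_gt0.
apply: (ler_cvg_to (cvg_cst _) qpoch_cvg); near=> n.
apply: (@le_trans _ _ (expR (- ((1 - q)^-1 * \sum_(i < n) q ^+ i)))).
  rewrite ler_expR lerN2 ler_pM2l ?invr_gt0 ?subr_gt0//.
  exact: geo_le (ltW q0) q1.
rewrite mulr_sumr -sumrN expR_sum; apply: ler_prod => i _.
rewrite expR_ge0 /=.
apply: le_trans (expR_le_1Bx (_ : 0 <= q ^+ i.+1) _); last 2 first.
- by rewrite exprn_ge0// ltW.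
- by rewrite exprn_ilt1// ltW.
rewrite ler_expR lerN2 mulrC; apply: ler_pM.
- by rewrite invr_ge0 ltW// qfac_gt0.
- by rewrite exprn_ge0// ltW.
- rewrite lef_pV2 ?posrE ?qfac_gt0 ?subr_gt0// lerD2l lerN2.
  by rewrite exprS ger_pMr// exprn_ile1// ltW.
- by rewrite exprS ger_pMl ?exprn_gt0// ltW.
Unshelve. all: by end_near. Qed.

Lemma sub_cvgn (u : nat -> R) (l : R) (f : nat -> nat) :
  u @ \oo --> l -> (forall K, exists N0, forall N, (N0 <= N)%N -> (K <= f N)%N) ->
  u (f n) @[n --> \oo] --> l.
Proof.
move=> ul fK; apply/cvgrPdistC_le => e e0.
move/cvgrPdistC_le: ul => /(_ e e0) [K _ hK].
have [N0 hN] := fK K; exists N0 => // n /= /hN Kn; exact: hK.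
Qed.

End Infinite.

Lemma sqr_in01 q : 0 < q < 1 -> 0 < q ^+ 2 < 1.
Proof.
by move=> /andP[q0 q1]; rewrite exprn_gt0//= exprn_ilt1// ltW.
Qed.

(** Term by term, [qbin (q^2) (2 N) (N + j)] tends to the inverse of [qinf
(q^2)] and stays below it, so dominated convergence applies. The stated bound
is what the three values [1], [- 1] and [q] of [z] satisfy. *)
Lemma triple_product_limit q z : 0 < q < 1 -> z != 0 ->
  (forall j, `|q ^+ (j.+1 ^ 2) * (z ^+ j.+1 + z ^- j.+1)| <= 2 * q ^+ j) ->
  ccvg (fun N => (\prod_(i < N)
        ((1 + z * q ^+ (2 * i + 1)) * (1 + z^-1 * q ^+ (2 * i + 1))))%:C)
   ((qinf (q ^+ 2))^-1%:C *
     (1 + csum (fun j => (q ^+ (j.+1 ^ 2) * (z ^+ j.+1 + z ^- j.+1))%:C))).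
Proof.
move=> q01 z0 hb; have /andP[q0 q1] := q01.
have Q01 := sqr_in01 q01; set Q := q ^+ 2 in Q01 *.
have E0 := qinf_gt0 Q01.
have En0 : qinf Q != 0 by exact: lt0r_neq0.
have qq0 n : qpoch Q n != 0 by exact: lt0r_neq0 (qpoch_gt0 Q01 n).
pose w j := q ^+ (j.+1 ^ 2) * (z ^+ j.+1 + z ^- j.+1).
pose f N j : C := (if (j < N)%N then qbin Q (2 * N) (N + j.+1) * w j else 0)%:C.
have qbE N j : (j <= N)%N -> qbin Q (2 * N) (N + j) = qpoch Q (2 * N) / (qpoch Q (N + j) * qpoch Q (N - j)).
  move=> jN; have := @qbinE Q (2 * N) (N + j).
  have -> : (2 * N - (N + j) = N - j)%N by lia.
  move=> <-; last by lia.
  by rewrite mulfK// mulf_neq0.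
have qb_lim j : qpoch Q (2 * N) / (qpoch Q (N + j) * qpoch Q (N - j)) @[N --> \oo] --> (qinf Q)^-1.
  have -> : (qinf Q)^-1 = qinf Q / (qinf Q * qinf Q) by field.
  apply: cvgnM; first by apply: (sub_cvgn (qpoch_cvg Q01)) => K; exists K => N; lia.
  apply: cvgnV; first by rewrite mulf_neq0.
  apply: cvgnM; first by apply: (sub_cvgn (qpoch_cvg Q01)) => K; exists K => N; lia.
  by apply: (sub_cvgn (qpoch_cvg Q01)) => K; exists (K + j)%N => N; lia.
have qb_le N j : (j <= N)%N -> 0 <= qpoch Q (2 * N) / (qpoch Q (N + j) * qpoch Q (N - j)) <= (qinf Q)^-1.
  move=> jN; have p n := qpoch_gt0 Q01 n.
  apply/andP; split; first by rewrite divr_ge0 ?mulr_ge0// ltW.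
  rewrite ler_pdivrMr ?mulr_gt0// mulrC.
  rewrite -[leLHS]mulr1 -mulrA; apply: ler_pM; rewrite ?(ltW (p _))//.
    by apply: qpoch_le => //; lia.
  by rewrite ler_pdivlMr// mul1r qinf_le.
have -> : (fun N => (\prod_(i < N) ((1 + z * q ^+ (2 * i + 1)) * (1 + z^-1 * q ^+ (2 * i + 1))))%:C)
   = (fun N => (qbin Q (2 * N) N)%:C + csum (f N)) :> (nat -> C).
  apply: funext => N; rewrite triple_product_finite//; last exact: lt0r_neq0.
  rewrite rmorphD rmorph_sum (@csum_fin _ _ N); last first.
    by move=> k; rewrite /f leqNgt => /negbTE ->.
  by congr (_ + _); apply: eq_bigr => j _; rewrite /f ltn_ord.
rewrite mulrDr mulr1; apply: ccvgD.
  apply: ccvg_real; apply: (eq_cvgn (u := fun N => qpoch Q (2 * N) / (qpoch Q (N + 0) * qpoch Q (N - 0)))).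
    by move=> N; rewrite -(qbE N 0%N)// addn0.
  exact: qb_lim.
have wM : absb (fun j => (w j)%:C) (2 * (1 - q)^-1).
  move=> n; apply: (@le_trans _ _ (\sum_(k < n) 2 * q ^+ k)).
    by apply: ler_sum => k _; rewrite normc_real; exact: hb.
  by rewrite -mulr_sumr ler_pM2l// geo_le// ltW.
rewrite -(csumZ _ wM).
apply: (tannery (B := fun j => (qinf Q)^-1 * (2 * q ^+ j)) (M := (qinf Q)^-1 * (2 * (1 - q)^-1))).
- move=> j; rewrite -rmorphM; apply: ccvg_real.
  apply: (@near_eq_cvgn _ (fun N => qpoch Q (2 * N) / (qpoch Q (N + j.+1) * qpoch Q (N - j.+1)) * w j)).
    exists j.+1 => // N /= jN.
    by rewrite jN qbE.
  by apply: cvgnM; [exact: qb_lim|exact: cvg_cst].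
- move=> N j; rewrite /f normc_real; case: ifPn => jN; last first.
    by rewrite normr0 !mulr_ge0// ?invr_ge0 ?exprn_ge0 ?(ltW E0) ?(ltW q0).
  rewrite qbE// normrM; have /andP[h1 h2] := qb_le N j.+1 jN.
  by rewrite ger0_norm//; apply: ler_pM => //; exact: hb.
- move=> n; rewrite -mulr_sumr ler_pM2l ?invr_gt0// -mulr_sumr ler_pM2l//.
  by rewrite geo_le// ltW.
Qed.

End TripleProduct.

(** * Theta constants: translation and inversion *)

Section ParitySplit.
Context {R : realType}.
Local Notation C := R[i].
Implicit Types (a b : nat -> C) (M : R).

Lemma absb_even a M : absb a M -> absb (fun k => a (2 * k)%N) M.
Proof.
move=> aM n; apply: le_trans (aM (2 * n)%N).
elim: n => [|n IH]; first by rewrite muln0 !big_ord0.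
have -> : (2 * n.+1 = (2 * n).+2)%N by lia.
rewrite big_ord_recr !big_ord_recr /= -addrA.
by apply: lerD IH _; rewrite lerDl normc_ge0.
Qed.

Lemma absb_odd a M : absb a M -> absb (fun k => a (2 * k).+1) M.
Proof.
move=> aM n; apply: le_trans (aM (2 * n)%N).
elim: n => [|n IH]; first by rewrite muln0 !big_ord0.
have -> : (2 * n.+1 = (2 * n).+2)%N by lia.
rewrite big_ord_recr !big_ord_recr /= lerD2r.
by apply: le_trans IH _; rewrite lerDl normc_ge0.
Qed.

Lemma csum_parity a M : absb a M ->
  csum a = csum (fun k => a (2 * k)%N) + csum (fun k => a (2 * k).+1).
Proof.
move=> aM; have h1 := csumP aM.
have h2 := hasumD (csumP (absb_even aM)) (csumP (absb_odd aM)).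
apply: (ccvg_unique (u := fun n => \sum_(k < 2 * n) a k)).
  apply: (@sub_cvgn _ (fun n => normc (\sum_(k < n) a k - csum a)) 0 (fun n => 2 * n)%N) => //.
  by move=> K; exists K => N; lia.
have -> : (fun n => \sum_(k < 2 * n) a k) = (fun n => \sum_(k < n) (a (2 * k)%N + a (2 * k).+1)).
  apply: funext; elim=> [|n IH]; first by rewrite muln0 !big_ord0.
  have -> : (2 * n.+1 = (2 * n).+2)%N by lia.
  by rewrite !big_ord_recr /= IH addrA.
exact: h2.
Qed.

End ParitySplit.

Section Theta234.
Context {R : realType}.
Local Notation C := R[i].
Implicit Types (w : C) (y q : R).

(** The part of the theta series carried by odd integers. Translation by [i]
acts on it and on the even part [theta (4 w)] by scalars. *)
Definition thodd w : C :=
  2 * csum (fun k => expC (- (pi * (2 * k).+1%:R ^+ 2)%:C * w)).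

(** The three classical theta constants, written through [theta] alone:
duplication formulas such as [th3 w = th3 (4 w) + th2 (4 w)] are then
immediate. *)
Definition th2 w : C := theta (w / 4) - theta w.
Definition th3 w : C := theta w.
Definition th4 w : C := 2 * theta (4 * w) - theta w.

Lemma theta_parity w : 0 < complex.Re w -> theta w = theta (4 * w) + thodd w.
Proof.
move=> w0; rewrite /theta (csum_parity (theta_absb w0)) /thodd.
rewrite mulrDr [2 * _ + _]addrC addrA; congr (1 + 2 * _ + _).
apply: eq_csum => k; congr expC.
have -> : (2 * k).+2 = (2 * k.+1)%N by lia.
ring.
Qed.

Lemma Re_div4 w : complex.Re (w / 4) = complex.Re w / 4.
Proof. by rewrite mulrC -(@natrC R 4) -fmorphV Re_scale mulrC. Qed.

Lemma th2E w : 0 < complex.Re w -> th2 w = thodd (w / 4).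
Proof.
move=> w0; rewrite /th2 theta_parity ?Re_div4 ?divr_gt0//.
have -> : 4 * (w / 4) = w by field.
by rewrite addrAC subrr add0r.
Qed.

Lemma th4E w : 0 < complex.Re w -> th4 w = theta (4 * w) - thodd w.
Proof. by move=> w0; rewrite /th4 (theta_parity w0); ring. Qed.

Lemma thodd_absb w : 0 < complex.Re w ->
  absb (fun k => expC (- (pi * (2 * k).+1%:R ^+ 2)%:C * w)) ((1 - expR (- (pi * complex.Re w)))^-1).
Proof. by move=> w0; exact: absb_even (theta_absb w0). Qed.

Lemma expC_2pin n : expC ((2 * pi * n%:R)%:C * 'i) = 1 :> C.
Proof.
have -> : (2 * pi * n%:R)%:C * 'i = 0 +i* (2 * pi * n%:R) :> C.
  by apply/eqP; rewrite eq_complex /=; apply/andP; split; apply/eqP; ring.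
by rewrite /expC /= expR0 !mul1r; have := cis_2pi (R := R) n; rewrite cisE.
Qed.

Lemma expC_pi : expC (pi%:C * 'i) = -1 :> C.
Proof.
have -> : pi%:C * 'i = 0 +i* pi :> C.
  by apply/eqP; rewrite eq_complex /=; apply/andP; split; apply/eqP; ring.
rewrite /expC /= expR0 !mul1r cospi sinpi.
by apply/eqP; rewrite eq_complex /= oppr0 !eqxx.
Qed.

(** The factor [exp (i pi / 4)] by which translation multiplies [th2]: odd
squares are 1 modulo 8. *)
Definition zeta : C := expC ((pi / 4)%:C * 'i).

Lemma zeta8 : zeta ^+ 8 = 1.
Proof.
rewrite /zeta -expCMn -[RHS](expC_2pin 1); congr expC.
by field.
Qed.

Lemma zetaE : zeta = (Num.sqrt 2)^-1%:C * (1 + 'i).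
Proof.
have -> : zeta = cos (pi / 4) +i* sin (pi / 4).
  have e : (pi / 4)%:C * 'i = 0 +i* (pi / 4) :> C.
    by apply/eqP; rewrite eq_complex /=; apply/andP; split; apply/eqP; ring.
  by rewrite /zeta e /expC /= expR0 !mul1r.
have c0 : 0 < cos (pi / 4 : R).
  apply: cos_gt0_pihalf; have := pi_gt0 R; set p := pi => p0; lra.
have s2 : sin (pi / 4 : R) = cos (pi / 4).
  by rewrite -cosBpihalf -cosN; congr cos; field.
have c2 : cos (pi / 4 : R) = (Num.sqrt 2)^-1.
  have := cos2Dsin2 (pi / 4 : R); rewrite s2 => h.
  have h2 : cos (pi / 4 : R) ^+ 2 = 2^-1 by lra.
  by rewrite -[LHS]ger0_norm ?(ltW c0)// -sqrtr_sqr h2 sqrtrV.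
by rewrite s2 c2; apply/eqP; rewrite eq_complex /=; apply/andP; split; apply/eqP; ring.
Qed.

Lemma theta4_shift w : theta (4 * (w - 'i)) = theta (4 * w).
Proof.
rewrite /theta; congr (1 + 2 * _); apply: eq_csum => n.
rewrite -[RHS]mulr1 -[X in _ = _ * X](expC_2pin (2 * n.+1 ^ 2)) -expCD; congr expC.
ring.
Qed.

Lemma thodd_shift w : 0 < complex.Re w -> thodd (w - 'i) = - thodd w.
Proof.
move=> w0; rewrite /thodd -mulrN -mulN1r -(csumZ _ (thodd_absb w0)).
congr (_ * _); apply: eq_csum => k.
rewrite -expC_pi -[RHS]mulr1 -[X in _ = _ * X](expC_2pin (2 * (k * k.+1))) -!expCD; congr expC.
ring.
Qed.

(** For odd [n], [n^2 = 4 k (k + 1) + 1] with [k (k + 1)] even, so [exp (i pi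
n^2 / 4)] does not depend on [n]. *)
Lemma thodd_shift4 w : 0 < complex.Re w -> thodd ((w - 'i) / 4) = zeta * thodd (w / 4).
Proof.
move=> w0; rewrite /thodd mulrCA; congr (_ * _).
have w4 : 0 < complex.Re (w / 4) by rewrite Re_div4 divr_gt0.
rewrite -(csumZ _ (thodd_absb w4)); apply: eq_csum => k.
rewrite /zeta -expCD.
have [m e] : exists m, (k * k.+1 = 2 * m)%N.
  exists ((k * k.+1)./2); rewrite mul2n -[LHS]odd_double_half.
  by rewrite oddM /= andbN.
rewrite -[RHS]mulr1 -[X in _ = _ * X](expC_2pin m) -expCD; congr expC.
have -> : (2 * k).+1%:R ^+ 2 = 8 * m%:R + 1 :> R.
  have -> : 8 * m%:R = 4 * (2 * m)%:R :> R by ring.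
  by rewrite -e; ring.
by field.
Qed.

Lemma Re_subi w : complex.Re (w - 'i) = complex.Re w.
Proof. by rewrite Re_sub /= subr0. Qed.

Lemma th3_shift w : 0 < complex.Re w -> th3 (w - 'i) = th4 w.
Proof.
move=> w0; rewrite /th3 th4E// theta_parity ?Re_subi//.
by rewrite theta4_shift thodd_shift.
Qed.

Lemma th4_shift w : 0 < complex.Re w -> th4 (w - 'i) = th3 w.
Proof.
move=> w0; rewrite /th3 th4E ?Re_subi// (theta_parity w0).
by rewrite theta4_shift thodd_shift// opprK.
Qed.

Lemma th2_shift w : 0 < complex.Re w -> th2 (w - 'i) = zeta * th2 w.
Proof. by move=> w0; rewrite !th2E ?Re_subi// thodd_shift4. Qed.

(** [Re w > 0] is exactly the condition for a square root in the sector where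
[theta_inversion] applies. *)
Lemma rhp_sqrt w : 0 < complex.Re w ->
  exists s : C, w = s ^+ 2 /\ `|complex.Im s| < complex.Re s.
Proof.
move=> w0.
have [s sw] : exists s : C, s ^+ 2 = w by exists (sqrtc w); exact: sqr_sqrtc.
have h : complex.Im s ^+ 2 < complex.Re s ^+ 2 by rewrite -subr_gt0 -Re_sqr sw.
have h2 : `|complex.Im s| < `|complex.Re s|.
  by rewrite -ltr_sqr ?nnegrE// !real_normK ?num_real.
have [s0|s0] := leP 0 (complex.Re s).
  by exists s; rewrite sw; split=> //; rewrite -(ger0_norm s0).
exists (- s); rewrite sqrrN sw; split=> //.
have -> : complex.Im (- s) = - complex.Im s by case: (s).
have -> : complex.Re (- s) = - complex.Re s by case: (s).
by rewrite normrN -(ltr0_norm s0).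
Qed.

Lemma th3_inv (s : C) : `|complex.Im s| < complex.Re s ->
  th3 (s ^+ 2)^-1 = s * th3 (s ^+ 2).
Proof. exact: theta_inversion. Qed.

Lemma slope_scale (x : R) (s : C) : 0 < x -> `|complex.Im s| < complex.Re s ->
  `|complex.Im (x%:C * s)| < complex.Re (x%:C * s).
Proof. by move=> x0 h; rewrite Re_scale Im_scale normrM gtr0_norm// ltr_pM2l. Qed.

Lemma th2_inv (s : C) : `|complex.Im s| < complex.Re s ->
  th2 (s ^+ 2)^-1 = s * th4 (s ^+ 2).
Proof.
move=> h; rewrite /th2 /th4 theta_inversion// mulrBr; congr (_ - _).
have h2 : `|complex.Im ((2%:R : R)%:C * s)| < complex.Re ((2%:R : R)%:C * s) by exact: slope_scale.
have := theta_inversion h2; rewrite natrC exprMn (_ : 2 ^+ 2 = 4); last by ring.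
have -> : (s ^+ 2)^-1 / 4 = (4 * s ^+ 2)^-1 by rewrite -invfM mulrC.
move=> e.
by rewrite e; ring.
Qed.

Lemma th4_inv (s : C) : `|complex.Im s| < complex.Re s ->
  th4 (s ^+ 2)^-1 = s * th2 (s ^+ 2).
Proof.
move=> h; rewrite /th2 /th4 theta_inversion// mulrBr; congr (_ - _).
have h2 : `|complex.Im ((2^-1 : R)%:C * s)| < complex.Re ((2^-1 : R)%:C * s).
  by apply: slope_scale; rewrite ?invr_gt0.
have e0 : (2^-1 : R)%:C = 2^-1 :> C by field.
have := theta_inversion h2; rewrite e0 exprMn => e.
have e1 : 2^-1 ^+ 2 * s ^+ 2 = s ^+ 2 / 4 by field.
have e2 : (2^-1 ^+ 2 * s ^+ 2)^-1 = 4 * (s ^+ 2)^-1.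
  by rewrite e1 invf_div.
by rewrite -e2 e e1; field.
Qed.

End Theta234.

(** * Theta constants: products on the positive axis *)

Section Products.
Context {R : realType}.
Local Notation C := R[i].
Implicit Types (y q : R).

Lemma exp_in01 q n : 0 < q < 1 -> 0 < q ^+ n.+1 < 1.
Proof. by move=> /andP[q0 q1]; rewrite exprn_gt0//= exprn_ilt1// ltW. Qed.

(** Separates odd from even exponents; dividing by the even part gives products
over odd exponents. *)
Lemma qpoch_double q N :
  qpoch q (2 * N) = (\prod_(i < N) (1 - q ^+ (2 * i + 1))) * qpoch (q ^+ 2) N.
Proof.
elim: N => [|N IH]; first by rewrite muln0 !qpoch0 big_ord0 mul1r.
have -> : (2 * N.+1 = (2 * N).+2)%N by lia.
rewrite !qpochS IH big_ord_recr /= -exprM addn1.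
have -> : (2 * N.+1 = (2 * N).+2)%N by lia.
ring.
Qed.

Lemma qpoch_sqr q N :
  qpoch (q ^+ 2) N = qpoch q N * \prod_(i < N) (1 + q ^+ i.+1).
Proof.
rewrite /qpoch -big_split; apply: eq_bigr => i _ /=.
by rewrite -exprM mulnC exprM; ring.
Qed.

Lemma cvgn_double (u : nat -> R) (l : R) : u @ \oo --> l -> (fun n => u (2 * n)%N) @ \oo --> l.
Proof. by move=> h; apply: (sub_cvgn h) => K; exists K => N; lia. Qed.

Lemma prod_odd_minus q : 0 < q < 1 ->
  \prod_(i < N) (1 - q ^+ (2 * i + 1)) @[N --> \oo] --> qinf q / qinf (q ^+ 2).
Proof.
move=> q01; have Q01 := sqr_in01 q01.
apply: (eq_cvgn (u := fun N => qpoch q (2 * N) / qpoch (q ^+ 2) N)).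
  by move=> N; rewrite qpoch_double mulfK// gt_eqF// qpoch_gt0.
apply: cvgnM; first exact: cvgn_double (qpoch_cvg q01).
by apply: cvgnV (qpoch_cvg Q01); rewrite gt_eqF// qinf_gt0.
Qed.

Lemma prod_plus q : 0 < q < 1 ->
  \prod_(i < N) (1 + q ^+ i.+1) @[N --> \oo] --> qinf (q ^+ 2) / qinf q.
Proof.
move=> q01; have Q01 := sqr_in01 q01.
apply: (eq_cvgn (u := fun N => qpoch (q ^+ 2) N / qpoch q N)).
  by move=> N; rewrite qpoch_sqr mulrAC divff ?mul1r// gt_eqF// qpoch_gt0.
apply: cvgnM; first exact: qpoch_cvg Q01.
by apply: cvgnV (qpoch_cvg q01); rewrite gt_eqF// qinf_gt0.
Qed.

Lemma prod_odd_plus q : 0 < q < 1 ->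
  \prod_(i < N) (1 + q ^+ (2 * i + 1)) @[N --> \oo] -->
  qinf (q ^+ 2) ^+ 2 / (qinf q * qinf (q ^+ 4)).
Proof.
move=> q01; have Q01 := sqr_in01 q01.
have E1 := qinf_gt0 q01; have E2 := qinf_gt0 Q01.
have E4 := qinf_gt0 (exp_in01 3 q01).
have -> : qinf (q ^+ 2) ^+ 2 / (qinf q * qinf (q ^+ 4)) =
   (qinf (q ^+ 2) / qinf ((q ^+ 2) ^+ 2)) / (qinf q / qinf (q ^+ 2)).
  by rewrite -exprM; field; rewrite !gt_eqF.
apply: (eq_cvgn (u := fun N => (\prod_(i < N) (1 - (q ^+ 2) ^+ (2 * i + 1))) /
   \prod_(i < N) (1 - q ^+ (2 * i + 1)))).
  move=> N; rewrite -prodf_div; apply: eq_bigr => i _.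
  have h : 0 < 1 - q ^+ (2 * i + 1).
    by rewrite addn1; exact: qfac_gt0.
  by rewrite -exprM mulnC exprM; field; rewrite gt_eqF.
apply: cvgnM; first exact: prod_odd_minus.
apply: cvgnV; last exact: prod_odd_minus.
by rewrite gt_eqF// divr_gt0.
Qed.

Section OnAxis.
Variable y : R.
Hypothesis y0 : 0 < y.
Let q := expR (- (pi * y)).

Lemma nome_in01 : 0 < expR (- (pi * y)) < 1.
Proof. by rewrite expR_gt0 expR_lt1 oppr_lt0 mulr_gt0// pi_gt0. Qed.

Let q01 : 0 < q < 1 := nome_in01.
Let E1 : 0 < qinf q := qinf_gt0 q01.
Let E2 : 0 < qinf (q ^+ 2) := qinf_gt0 (exp_in01 1 q01).
Let E4 : 0 < qinf (q ^+ 4) := qinf_gt0 (exp_in01 3 q01).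

Lemma nomeX n : q ^+ n = expR (- (pi * n%:R * y)).
Proof. by rewrite /q -expRM_natl; congr expR; ring. Qed.

Lemma nomeX_le m n : (n <= m)%N -> q ^+ m <= q ^+ n.
Proof. by have /andP[q0 q1] := q01; move=> mn; rewrite ler_wiXn2l// ltW. Qed.

Lemma theta_nome : theta y%:C = 1 + 2 * csum (fun n => (q ^+ (n.+1 ^ 2))%:C).
Proof.
rewrite theta_real; congr (1 + 2 * _); apply: eq_csum => n.
by rewrite nomeX natrX.
Qed.

Lemma nome_absb (f : nat -> nat) : (forall n, n <= f n)%N ->
  absb (fun n => (q ^+ f n)%:C) (1 - q)^-1.
Proof.
have /andP[q0 q1] := q01; move=> hf n; apply: le_trans (geo_le n (ltW q0) q1).
apply: ler_sum => k _; rewrite normc_real ger0_norm ?exprn_ge0 ?(ltW q0)//.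
by apply: nomeX_le.
Qed.

(** The two values [z = 1] and [z = - 1], for which the two factors of the
triple product coincide. *)
Lemma triple_product_sign (z : R) : z != 0 -> (forall n, z ^- n = z ^+ n) -> (forall n, `|z ^+ n| = 1) ->
  ccvg (fun N => (\prod_(i < N) (1 + z * q ^+ (2 * i + 1)) ^+ 2)%:C)
   ((qinf (q ^+ 2))^-1%:C * (1 + 2 * csum (fun j => (z ^+ j.+1 * q ^+ (j.+1 ^ 2))%:C))).
Proof.
move=> z0 zV z1; have /andP[q0 q1] := q01.
have hw j : q ^+ (j.+1 ^ 2) * (z ^+ j.+1 + z ^- j.+1) = 2 * (z ^+ j.+1 * q ^+ (j.+1 ^ 2)).
  by rewrite zV; ring.
have hb j : `|q ^+ (j.+1 ^ 2) * (z ^+ j.+1 + z ^- j.+1)| <= 2 * q ^+ j.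
  rewrite hw !normrM z1 mul1r normr_nat ler_pM2l//.
  rewrite ger0_norm ?exprn_ge0 ?(ltW q0)//; apply: nomeX_le; lia.
have := triple_product_limit q01 z0 hb.
have ab : absb (fun j => (z ^+ j.+1 * q ^+ (j.+1 ^ 2))%:C) (1 - q)^-1.
  apply: absb_le (nome_absb (f := fun n => n.+1 ^ 2)%N _); last by move=> n; lia.
  by move=> k; rewrite !normc_real normrM z1 mul1r.
rewrite -(csumZ _ ab).
have -> : csum (fun j => (q ^+ (j.+1 ^ 2) * (z ^+ j.+1 + z ^- j.+1))%:C) =
   csum (fun k => 2 * (z ^+ k.+1 * q ^+ (k.+1 ^ 2))%:C).
  by apply: eq_csum => j; rewrite hw rmorphM /= natrC.
congr (ccvg _ _); apply: funext => N; congr (_%:C); apply: eq_bigr => i _.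
by have := zV 1%N; rewrite expr1 => ->; ring.
Qed.

Lemma th3_prod : th3 y%:C = (qinf (q ^+ 2) ^+ 5 / (qinf q * qinf (q ^+ 4)) ^+ 2)%:C.
Proof.
have oV n : (1 : R) ^- n = 1 ^+ n by rewrite expr1n invr1.
have oN n : `|(1 : R) ^+ n| = 1 by rewrite expr1n normr1.
have := triple_product_sign (oner_neq0 _) oV oN.
have e : csum (fun j => (1 ^+ j.+1 * q ^+ (j.+1 ^ 2))%:C) = csum (fun j => (q ^+ (j.+1 ^ 2))%:C).
  by apply: eq_csum => j; rewrite expr1n mul1r.
rewrite e -theta_nome => h1.
have h2 := prod_odd_plus q01.
have h3 : ccvg (fun N => (\prod_(i < N) (1 + 1 * q ^+ (2 * i + 1)) ^+ 2)%:C)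
   ((qinf (q ^+ 2) ^+ 2 / (qinf q * qinf (q ^+ 4))) ^+ 2)%:C.
  apply: ccvg_real; apply: (eq_cvgn _ (cvgnX2 h2)) => N.
  by rewrite prodrXl; congr (_ ^+ 2); apply: eq_bigr => i _; rewrite mul1r.
have h4 := ccvg_unique h1 h3.
have E2C : (qinf (q ^+ 2))%:C != 0 :> C by rewrite (fmorph_eq0 (real_complex R)) gt_eqF.
apply: (mulfI (invr_neq0 E2C)); rewrite -fmorphV h4.
by rewrite -rmorphM; congr (_%:C); field; rewrite !gt_eqF.
Qed.

Lemma th4_prod : th4 y%:C = (qinf q ^+ 2 / qinf (q ^+ 2))%:C.
Proof.
have m1 : (-1 : R) != 0 by rewrite oppr_eq0 oner_neq0.
have mV n : (-1 : R) ^- n = (-1) ^+ n by rewrite -exprVn invrN invr1.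
have mN n : `|(-1 : R) ^+ n| = 1 by rewrite normrX normrN normr1 expr1n.
have h1 := triple_product_sign m1 mV mN.
have ab : absb (fun j => (q ^+ (j.+1 ^ 2))%:C) (1 - q)^-1.
  by apply: nome_absb => n; lia.
have ab' : absb (fun j => ((-1) ^+ j.+1 * q ^+ (j.+1 ^ 2))%:C) (1 - q)^-1.
  by apply: absb_le ab => k; rewrite !normc_real normrM mN mul1r.
have e4 : theta (4 * y%:C) = 1 + 2 * csum (fun k => (q ^+ ((2 * k).+2 ^ 2))%:C).
  rewrite -(@natrC R 4) -rmorphM theta_real; congr (1 + 2 * _); apply: eq_csum => n.
  rewrite nomeX; congr (expR _)%:C.
  have -> : (2 * n).+2 = (2 * n.+1)%N by lia.
  ring.
have e : 1 + 2 * csum (fun j => ((-1) ^+ j.+1 * q ^+ (j.+1 ^ 2))%:C) = th4 y%:C.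
  rewrite /th4 e4 theta_nome (csum_parity ab) (csum_parity ab').
  have -> : csum (fun k => ((-1) ^+ (2 * k).+1 * q ^+ ((2 * k).+1 ^ 2))%:C) =
      -1 * csum (fun k => (q ^+ ((2 * k).+1 ^ 2))%:C).
    rewrite -(csumZ _ (absb_even ab)); apply: eq_csum => k.
    by rewrite exprS exprM sqrrN expr1n expr1n mulr1 rmorphM rmorphN rmorph1.
  have -> : csum (fun k => ((-1) ^+ (2 * k).+2 * q ^+ ((2 * k).+2 ^ 2))%:C) =
      csum (fun k => (q ^+ ((2 * k).+2 ^ 2))%:C).
    apply: eq_csum => k.
    by rewrite 2!exprS exprM sqrrN expr1n expr1n mulr1 mulrNN mulr1 mul1r.
  ring.
rewrite e in h1.
have h3 : ccvg (fun N => (\prod_(i < N) (1 + -1 * q ^+ (2 * i + 1)) ^+ 2)%:C)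
   ((qinf q / qinf (q ^+ 2)) ^+ 2)%:C.
  apply: ccvg_real; apply: (eq_cvgn _ (cvgnX2 (prod_odd_minus q01))) => N.
  by rewrite prodrXl; congr (_ ^+ 2); apply: eq_bigr => i _; rewrite mulN1r.
have h4 := ccvg_unique h1 h3.
have E2C : (qinf (q ^+ 2))%:C != 0 :> C by rewrite (fmorph_eq0 (real_complex R)) gt_eqF.
apply: (mulfI (invr_neq0 E2C)); rewrite -fmorphV h4.
by rewrite -rmorphM; congr (_%:C); field; rewrite !gt_eqF.
Qed.

(** The triple product at [z = q]: the exponents [(j + 1)^2 + (j + 1)] and [(j
+ 1)^2 - (j + 1)] give the sum of [q^(j (j + 1))] twice, and the factor [1 +
q^-1 q] doubles the product. *)
Lemma th2_prod : th2 y%:C =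
  (2 * expR (- (pi * y / 4)) * (qinf (q ^+ 4) ^+ 2 / qinf (q ^+ 2)))%:C.
Proof.
have /andP[q0 q1] := q01; have qn0 : q != 0 by exact: lt0r_neq0.
have hw j : q ^+ (j.+1 ^ 2) * (q ^+ j.+1 + q ^- j.+1) =
    q ^+ (j.+1 * j.+2) + q ^+ (j * j.+1).
  rewrite mulrDr -exprD; congr (q ^+ _ + _); first by lia.
  by apply: (mulIf (expf_neq0 j.+1 qn0)); rewrite divfK ?expf_neq0// -exprD; congr (q ^+ _); lia.
have hb j : `|q ^+ (j.+1 ^ 2) * (q ^+ j.+1 + q ^- j.+1)| <= 2 * q ^+ j.
  rewrite hw ger0_norm ?addr_ge0 ?exprn_ge0 ?(ltW q0)// mulr_natl mulr2n.
  by apply: lerD; apply: nomeX_le; lia.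
have h1 := triple_product_limit q01 qn0 hb.
have ab0 : absb (fun j => (q ^+ (j * j.+1))%:C) (1 - q)^-1.
  by apply: nome_absb => n; lia.
have ab1 : absb (fun j => (q ^+ (j.+1 * j.+2))%:C) (1 - q)^-1.
  by apply: nome_absb => n; lia.
set S := csum (fun j => (q ^+ (j * j.+1))%:C) in ab0.
have S1 : csum (fun j => (q ^+ (j.+1 * j.+2))%:C) = S - 1.
  have := hasum_shift 1 (csumP ab0); rewrite big_ord1 /= mul0n expr0.
  exact: hasum_csum.
have e : csum (fun j => (q ^+ (j.+1 ^ 2) * (q ^+ j.+1 + q ^- j.+1))%:C) = S - 1 + S.
  rewrite -S1 -(csumD ab1 ab0); apply: eq_csum => j; by rewrite hw rmorphD.
rewrite e in h1.
have e2 : th2 y%:C = 2 * (expR (- (pi * y / 4)))%:C * S.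
  rewrite th2E//; have -> : y%:C / 4 = (y / 4)%:C by rewrite -(@natrC R 4) -fmorphV -rmorphM.
  rewrite /thodd -mulrA /S -(csumZ _ ab0); congr (_ * _); apply: eq_csum => k.
  rewrite -rmorphN -!rmorphM expC_real nomeX -expRD; congr (expR _)%:C.
  by field.
have h3 : ccvg (fun N => (\prod_(i < N) ((1 + q * q ^+ (2 * i + 1)) * (1 + q^-1 * q ^+ (2 * i + 1))))%:C)
   (2 * (qinf (q ^+ 4) / qinf (q ^+ 2)) ^+ 2)%:C.
  have pl := prod_plus (exp_in01 1 q01); rewrite -exprM in pl.
  apply: ccvg_real; rewrite -cvg_shiftS /=.
  apply: (eq_cvgn (u := fun N => 2 * ((\prod_(i < N.+1) (1 + (q ^+ 2) ^+ i.+1)) *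
     \prod_(i < N) (1 + (q ^+ 2) ^+ i.+1)))).
    move=> N; rewrite big_split /=.
    have -> : \prod_(i < N.+1) (1 + q * q ^+ (2 * i + 1)) = \prod_(i < N.+1) (1 + q ^+ 2 ^+ i.+1).
      by apply: eq_bigr => i _; rewrite -exprM -exprS; congr (1 + q ^+ _); lia.
    rewrite mulrCA; congr (_ * _); rewrite [RHS]big_ord_recl /=; congr (_ * _).
      by rewrite muln0 add0n expr1 mulVf.
    apply: eq_bigr => i _; rewrite /bump /= add1n; congr (1 + _).
    by rewrite -exprM addn1 exprS mulKf//.
  apply: cvgnM; first exact: cvg_cst.
  set l := qinf (q ^+ 4) / qinf (q ^+ 2) in pl *; rewrite (expr2 l); apply: cvgnM => //.
  by apply: (sub_cvgn (u := fun N => \prod_(i < N) (1 + (q ^+ 2) ^+ i.+1)) pl (f := succn)) => K; exists K => N; lia.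
have h4 := ccvg_unique h1 h3.
have E2C : (qinf (q ^+ 2))%:C != 0 :> C by rewrite (fmorph_eq0 (real_complex R)) gt_eqF.
rewrite e2; have -> : S = (qinf (q ^+ 2) * (qinf (q ^+ 4) / qinf (q ^+ 2)) ^+ 2)%:C.
  have two : (2 : C) != 0 by rewrite pnatr_eq0.
  apply: (mulfI two); apply: (mulfI (invr_neq0 E2C)).
  transitivity ((qinf (q ^+ 2))^-1%:C * (1 + (S - 1 + S))); first by rewrite fmorphV; ring.
  rewrite h4 -fmorphV -(@natrC R 2) -!rmorphM; congr (_%:C); field; by rewrite gt_eqF.
by rewrite -(@natrC R 2) -!rmorphM; congr (_%:C); field; rewrite gt_eqF.
Qed.

End OnAxis.
End Products.

(** * Complex derivatives *)

Section Calculus.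
Context {R : realType}.
Local Notation C := R[i].
Implicit Types (F G : C -> C) (w z d : C) (x y t : R).

(** Complex differentiability with a quadratic remainder. Holomorphic functions
satisfy it, and the rules of calculus reduce to norm estimates without any
limit. *)
Definition cder F w d := exists K e : R, [/\ 0 < e, 0 <= K & forall z, normc z <= e ->
  normc (F (w + z) - F w - z * d) <= K * normc z ^+ 2].

Lemma cder_cst c w : cder (fun=> c) w 0.
Proof.
exists 0, 1; split => // z _.
by rewrite subrr mulr0 subr0 normc0 mul0r.
Qed.

Lemma cder_id w : cder id w 1.
Proof.
exists 0, 1; split => // z _.
by rewrite (_ : _ - _ = 0) ?normc0 ?mul0r// /=; ring.
Qed.

Lemma cder_eq F w d d' : d = d' -> cder F w d -> cder F w d'.
Proof. by move=> ->. Qed.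

Lemma cderD F G w d1 d2 : cder F w d1 -> cder G w d2 ->
  cder (fun u => F u + G u) w (d1 + d2).
Proof.
move=> [K1 [e1 [e10 K10 h1]]] [K2 [e2 [e20 K20 h2]]].
exists (K1 + K2), (Num.min e1 e2); split; [by rewrite lt_min e10|exact: addr_ge0|].
move=> z; rewrite le_min => /andP[z1 z2].
have -> : F (w + z) + G (w + z) - (F w + G w) - z * (d1 + d2) =
   (F (w + z) - F w - z * d1) + (G (w + z) - G w - z * d2) by ring.
by apply: le_trans (ler_normcD _ _) _; rewrite mulrDl lerD// ?h1 ?h2.
Qed.

Lemma cderZ c F w d : cder F w d -> cder (fun u => c * F u) w (c * d).
Proof.
move=> [K [e [e0 K0 h]]]; exists (normc c * K), e; split => //.
  by rewrite mulr_ge0// normc_ge0.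
move=> z ze; have -> : c * F (w + z) - c * F w - z * (c * d) = c * (F (w + z) - F w - z * d) by ring.
by rewrite normcM -mulrA ler_wpM2l ?normc_ge0// h.
Qed.

Lemma cder_lip F w d : cder F w d -> exists K e : R, [/\ 0 < e, 0 <= K & forall z, normc z <= e ->
  normc (F (w + z) - F w) <= K * normc z].
Proof.
move=> [K [e [e0 K0 h]]]; exists (K + normc d), (Num.min e 1); split.
- by rewrite lt_min e0 ltr01.
- by rewrite addr_ge0// normc_ge0.
move=> z; rewrite le_min => /andP[z1 z2].
have -> : F (w + z) - F w = (F (w + z) - F w - z * d) + z * d by rewrite subrK.
apply: le_trans (ler_normcD _ _) _; rewrite mulrDl lerD//.
  apply: le_trans (h z z1) _; rewrite ler_wpM2l// expr2.
  by rewrite -[leRHS]mulr1 ler_wpM2l// normc_ge0.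
by rewrite normcM mulrC.
Qed.

Lemma cderM F G w d1 d2 : cder F w d1 -> cder G w d2 ->
  cder (fun u => F u * G u) w (d1 * G w + F w * d2).
Proof.
move=> hF hG; have [L1 [a1 [a10 L10 l1]]] := cder_lip hF.
have [L2 [a2 [a20 L20 l2]]] := cder_lip hG.
move: hF hG => [K1 [e1 [e10 K10 h1]]] [K2 [e2 [e20 K20 h2]]].
exists (K1 * normc (G w) + normc (F w) * K2 + L1 * L2), (Num.min (Num.min e1 a1) (Num.min e2 a2)); split.
- by rewrite !lt_min e10 a10 e20.
- by rewrite !addr_ge0 ?mulr_ge0 ?normc_ge0.
move=> z; rewrite !le_min => /andP[/andP[z1 z2] /andP[z3 z4]].
have -> : F (w + z) * G (w + z) - F w * G w - z * (d1 * G w + F w * d2) =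
   (F (w + z) - F w - z * d1) * G w + F w * (G (w + z) - G w - z * d2) +
   (F (w + z) - F w) * (G (w + z) - G w) by ring.
apply: le_trans (ler_normcD _ _) _; rewrite [leRHS]mulrDl; apply: lerD.
  apply: le_trans (ler_normcD _ _) _; rewrite [leRHS]mulrDl; apply: lerD; rewrite normcM.
    by rewrite mulrAC ler_wpM2r ?normc_ge0// h1.
  by rewrite -mulrA ler_wpM2l ?normc_ge0// h2.
rewrite normcM expr2 mulrACA; apply: ler_pM; rewrite ?normc_ge0 ?l1 ?l2//.
Qed.

Lemma cder_comp F G w d1 d2 : cder G w d2 -> cder F (G w) d1 ->
  cder (fun u => F (G u)) w (d2 * d1).
Proof.
move=> hG; have [L [a [a0 L0 l]]] := cder_lip hG; move: hG.
move=> [K2 [e2 [e20 K20 h2]]] [K1 [e1 [e10 K10 h1]]].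
have L1 : 0 < L + 1 by rewrite ltr_wpDl.
exists (K1 * L ^+ 2 + K2 * normc d1), (Num.min (Num.min e2 a) (e1 / (L + 1))); split.
- by rewrite !lt_min e20 a0 divr_gt0.
- by rewrite addr_ge0// mulr_ge0 ?normc_ge0 ?exprn_ge0.
move=> z; rewrite !le_min => /andP[/andP[z1 z2] z3].
set k := G (w + z) - G w.
have kL : normc k <= L * normc z by exact: l.
have ke : normc k <= e1.
  apply: le_trans kL _; apply: (@le_trans _ _ ((L + 1) * normc z)).
    by rewrite ler_wpM2r ?normc_ge0// lerDl.
  by rewrite mulrC -ler_pdivlMr.
have -> : F (G (w + z)) - F (G w) - z * (d2 * d1) =
   (F (G w + k) - F (G w) - k * d1) + (k - z * d2) * d1.
  by rewrite /k addrCA subrr addr0; ring.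
apply: le_trans (ler_normcD _ _) _; rewrite [leRHS]mulrDl; apply: lerD.
  apply: le_trans (h1 _ ke) _; rewrite -mulrA ler_wpM2l// -exprMn.
  by rewrite lerXn2r ?nnegrE ?normc_ge0 ?mulr_ge0 ?normc_ge0.
by rewrite normcM mulrAC ler_wpM2r ?normc_ge0// h2.
Qed.

Lemma cder_inv w : w != 0 -> cder (fun u => u^-1) w (- w ^- 2).
Proof.
move=> w0; have n0 : 0 < normc w by rewrite normc_gt0.
exists (2 / normc w ^+ 3), (normc w / 2); split.
- by rewrite divr_gt0.
- by rewrite divr_ge0// exprn_ge0// ltW.
move=> z hz.
have nz : normc w / 2 <= normc (w + z).
  have : normc w <= normc (w + z) + normc z.
    by have := ler_normcB (w + z) z; rewrite addrK.
  lra.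
have wz : w + z != 0 by rewrite -normc_gt0; apply: lt_le_trans nz; rewrite divr_gt0.
have -> : (w + z)^-1 - w^-1 - z * - w ^- 2 = z ^+ 2 / (w ^+ 2 * (w + z)).
  by field; apply/andP.
rewrite normcM normcV (normcM (w ^+ 2)) !normcX [leLHS]mulrC ler_wpM2r ?exprn_ge0 ?normc_ge0//.
have -> : 2 / normc w ^+ 3 = (normc w ^+ 2)^-1 * (normc w / 2)^-1 by field; rewrite gt_eqF.
rewrite invfM ler_wpM2l ?invr_ge0 ?exprn_ge0 ?normc_ge0//.
by rewrite lef_pV2 ?posrE// ?divr_gt0// normc_gt0.
Qed.

Lemma cder_X w n : cder (fun u => u ^+ n.+1) w (n.+1%:R * w ^+ n).
Proof.
elim: n => [|n IH].
  apply: cder_eq (cder_id w); by rewrite expr0 mulr1.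
have := cderM (cder_id w) IH.
rewrite (_ : (fun u => id u * u ^+ n.+1) = (fun u => u ^+ n.+2)); last first.
  by apply: funext => u; exact: esym (exprS u n.+1).
apply: cder_eq; rewrite (exprS w n) -[in RHS]natr1; ring.
Qed.

(** Along a real line the real part has an ordinary derivative, which gives
access to the real mean value theorem and to the fundamental theorem of
calculus. *)
Lemma cder_line F (a b d : C) t : cder F (a + t%:C * b) d ->
  is_derive t 1 (fun s : R => complex.Re (F (a + s%:C * b))) (complex.Re (b * d)).
Proof.
move=> [K [e [e0 K0 h]]].
have b1 : 0 < normc b + 1 by rewrite ltr_wpDl ?normc_ge0.
have cv : (fun s : R => s^-1 *: ((fun s : R => complex.Re (F (a + s%:C * b))) (s *: 1 + t) -
    complex.Re (F (a + t%:C * b)))) @ 0^' --> complex.Re (b * d).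
  apply/cvgrPdistC_le => eps eps0.
  near=> s.
  have s0 : s != 0 by near: s; exact: nbhs_dnbhs_neq.
  have se : `|s| <= Num.min (e / (normc b + 1)) (eps / (K * normc b ^+ 2 + 1)).
    near: s; apply: dnbhs0_le; rewrite lt_min !divr_gt0//.
    by rewrite ltr_wpDl// mulr_ge0// exprn_ge0// normc_ge0.
  move: se; rewrite le_min => /andP[s1 s2].
  have zb : normc (s%:C * b) = `|s| * normc b by rewrite normcM normc_real.
  have hz : normc (s%:C * b) <= e.
    rewrite zb; apply: (@le_trans _ _ (`|s| * (normc b + 1))).
      by rewrite ler_wpM2l// lerDl.
    by rewrite -ler_pdivlMr.
  have := h _ hz; rewrite zb => hh.
  have -> : (s *: 1 + t)%:C = t%:C + s%:C :> C by rewrite /GRing.scale /= mulr1 rmorphD addrC.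
  rewrite mulrDl addrA /GRing.scale /=.
  have -> : s^-1 * (complex.Re (F (a + t%:C * b + s%:C * b)) - complex.Re (F (a + t%:C * b))) -
      complex.Re (b * d) = s^-1 * complex.Re (F (a + t%:C * b + s%:C * b) - F (a + t%:C * b) - s%:C * b * d).
    by rewrite !Re_sub -[s%:C * b * d]mulrA Re_scale; field.
  rewrite normrM normfV ler_pdivrMl ?normr_gt0//.
  apply: le_trans (normc_ReP _) _; apply: le_trans hh _.
  rewrite exprMn mulrCA expr2 -mulrA ler_wpM2l//.
  apply: (@le_trans _ _ (`|s| * (K * normc b ^+ 2 + 1))).
    by rewrite ler_wpM2l// lerDl.
  by rewrite -ler_pdivlMr// ltr_wpDl// mulr_ge0// exprn_ge0// normc_ge0.
apply: DeriveDef.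
  by apply/cvg_ex; eexists; exact: cv.
exact: cvg_lim cv.
Unshelve. all: by end_near. Qed.

Definition rhp w := 0 < complex.Re w.

(** The factor 2 comes from applying the real mean value theorem to real and
imaginary parts separately. *)
Lemma cder_mvt F (f : C -> C) (a b : C) M : 0 <= M ->
  (forall t, 0 <= t -> t <= 1 -> cder F (a + t%:C * b) (f (a + t%:C * b))) ->
  (forall t, 0 <= t -> t <= 1 -> normc (f (a + t%:C * b)) <= M) ->
  normc (F (a + b) - F a) <= 2 * (normc b * M).
Proof.
move=> M0 hd hM.
have key G (g : C -> C) : (forall t, 0 <= t -> t <= 1 -> cder G (a + t%:C * b) (g (a + t%:C * b))) ->
  (forall t, 0 <= t -> t <= 1 -> normc (g (a + t%:C * b)) <= M) ->
  `|complex.Re (G (a + b) - G a)| <= normc b * M.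
  move=> hG hg.
  have dv t : 0 <= t -> t <= 1 -> is_derive t 1 (fun s : R => complex.Re (G (a + s%:C * b)))
     (complex.Re (b * g (a + t%:C * b))).
    by move=> t0 t1; apply: cder_line; exact: hG.
  have [||c] := @MVT R (fun s : R => complex.Re (G (a + s%:C * b)))
     (fun t => complex.Re (b * g (a + t%:C * b))) 0 1 ltr01.
  - by move=> t; rewrite in_itv /= => /andP[t0 t1]; apply: dv; exact: ltW.
  - apply: derivable_within_continuous => t; rewrite in_itv /= => /andP[t0 t1].
    by have [] := dv t t0 t1.
  rewrite in_itv /= => /andP[c0 c1]; rewrite mul0r mul1r addr0 subr0 mulr1 -Re_sub => ->.
  apply: le_trans (normc_ReP _) _; rewrite normcM ler_wpM2l ?normc_ge0//.
  by apply: hg; exact: ltW.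
apply: le_trans (normc_le_ReIm _) _; rewrite mulr_natl mulr2n; apply: lerD.
  exact: (key F f).
have -> : complex.Im (F (a + b) - F a) = complex.Re ((- 'i) * F (a + b) - (- 'i) * F a).
  by rewrite -mulrBr Re_mul /=; ring.
apply: (key (fun u => - 'i * F u) (fun u => - 'i * f u)).
  by move=> t t0 t1; apply: cderZ; exact: hd.
move=> t t0 t1; rewrite normcM; apply: le_trans (hM t t0 t1).
have -> : normc (- 'i : C) = 1 by rewrite /normc /= oppr0 expr0n /= add0r sqrrN expr1n sqrtr1.
by rewrite mul1r.
Qed.

Lemma cder_eq_real F G (f : C -> C) :
  (forall t, 0 < t -> cder F t%:C (f t%:C)) -> (forall t, 0 < t -> cder G t%:C (f t%:C)) ->
  exists c, forall t, 0 < t -> F t%:C = G t%:C + c.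
Proof.
move=> hF hG; exists (F 1%:C - G 1%:C) => t t0.
pose H u := F u + -1 * G u.
have hH s : 0 < s -> cder H s%:C 0.
  move=> s0; have := cderD (hF s s0) (cderZ (-1) (hG s s0)).
  by apply: cder_eq; ring.
have seg (s : R) : 0 <= s -> s <= 1 -> 0 < 1 + s * (t - 1).
  move=> s0 s1; have [e|e] := leP 1 t; first by rewrite ltr_pwDl// mulr_ge0// subr_ge0.
  have : s * (1 - t) < 1; last by rewrite mulrBr; lra.
  apply: (@le_lt_trans _ _ (1 * (1 - t))); first by rewrite ler_wpM2r// subr_ge0 ltW.
  by rewrite mul1r; lra.
have lineE s : 1%:C + s%:C * (t%:C - 1%:C) = (1 + s * (t - 1))%:C :> C.
  by rewrite rmorphD rmorphM rmorphB.
have : normc (H (1%:C + (t%:C - 1%:C)) - H 1%:C) <= 2 * (normc (t%:C - 1%:C : C) * 0).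
  apply: (cder_mvt (f := fun=> 0)) => //.
  - by move=> s s0 s1; rewrite lineE; exact: hH (seg s s0 s1).
  - by move=> s _ _; rewrite normc0.
rewrite !mulr0 addrCA subrr addr0 => h.
have /eqP : normc (H t%:C - H 1%:C) == 0 by rewrite eq_le h normc_ge0.
move/eqP; rewrite normc_eq0 /H subr_eq0 => /eqP.
by move=> e; rewrite -[LHS](subrK (G t%:C)) -(mulN1r (G t%:C)) e; ring.
Qed.

End Calculus.

(** * Cuspidal q-expansions and their primitives *)

Section QSeries.
Context {R : realType}.
Local Notation C := R[i].
Implicit Types (f g : C -> C) (c d : nat -> C) (w z : C) (r x : R).

(** The local parameter [exp (i pi tau / 4)]: the smallest power of [q] in
which all three theta constants are power series. *)
Definition nome4 w : C := expC (- (pi / 4)%:C * w).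

Lemma normc_nome4 w : normc (nome4 w) = expR (- (pi / 4 * complex.Re w)).
Proof. by rewrite normc_expC -rmorphN Re_scale mulNr. Qed.

Lemma pi4_gt0 : 0 < pi / 4 :> R. Proof. by rewrite divr_gt0// pi_gt0. Qed.

Lemma normc_nome4_lt1 w : rhp w -> normc (nome4 w) < 1.
Proof. by move=> w0; rewrite normc_nome4 expR_lt1 oppr_lt0 mulr_gt0// pi4_gt0. Qed.

Definition disc_summable c := forall r, 0 <= r -> r < 1 -> exists M, wnorm c r M.

Definition qexpansion c f := disc_summable c /\ forall w, rhp w -> f w = ps c (nome4 w).

Definition qser f := exists c, qexpansion c f.
(** Series without constant term: these are the ones that decay exponentially
and have a q-series as primitive. *)
Definition qcusp f := exists c, c 0%N = 0 /\ qexpansion c f.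

Lemma qcuspW f : qcusp f -> qser f.
Proof. by move=> [c [_ h]]; exists c. Qed.

Lemma qexp_wnorm c f w : qexpansion c f -> rhp w -> exists M, wnorm c (normc (nome4 w)) M.
Proof. by move=> [h _] w0; apply: h; rewrite ?normc_ge0// normc_nome4_lt1. Qed.

Lemma qexpansionD c d f g : qexpansion c f -> qexpansion d g ->
  qexpansion (fun n => c n + d n) (fun w => f w + g w).
Proof.
move=> [h1 h2] [h3 h4]; split.
  move=> r r0 r1; have [M hM] := h1 r r0 r1; have [M' hM'] := h3 r r0 r1.
  by exists (M + M'); exact: wnormD.
move=> w w0; rewrite h2// h4//.
have [M hM] := qexp_wnorm (conj h1 h2) w0; have [M' hM'] := qexp_wnorm (conj h3 h4) w0.
by rewrite (psD hM hM').
Qed.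

Lemma qexpansionZ c a f : qexpansion c f -> qexpansion (fun n => a * c n) (fun w => a * f w).
Proof.
move=> [h1 h2]; split.
  move=> r r0 r1; have [M hM] := h1 r r0 r1; eexists; exact: wnormZ r0 hM.
move=> w w0; rewrite h2//; have [M hM] := qexp_wnorm (conj h1 h2) w0.
by rewrite (psZ _ hM).
Qed.

Lemma qexpansionM c d f g : qexpansion c f -> qexpansion d g ->
  qexpansion (cauchyp c d) (fun w => f w * g w).
Proof.
move=> [h1 h2] [h3 h4]; split.
  move=> r r0 r1; have [M hM] := h1 r r0 r1; have [M' hM'] := h3 r r0 r1.
  by exists (M * M'); exact: (cauchyp_wnorm r0 hM hM').1.
move=> w w0; rewrite h2// h4//.
have [M hM] := qexp_wnorm (conj h1 h2) w0; have [M' hM'] := qexp_wnorm (conj h3 h4) w0.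
by rewrite (cauchyp_wnorm (normc_ge0 _) hM hM').2.
Qed.

Lemma qserM f g : qser f -> qser g -> qser (fun w => f w * g w).
Proof. by move=> [c hc] [d hd]; exists (cauchyp c d); exact: qexpansionM. Qed.

Lemma qser1 : qser (fun=> 1).
Proof.
exists (fun n => (n == 0%N)%:R); split.
  by move=> r r0 _; exists 1; exact: (ps_one 0 r0).1.
by move=> w w0; rewrite (ps_one _ (normc_ge0 (nome4 w))).2.
Qed.

Lemma qserX f n : qser f -> qser (fun w => f w ^+ n).
Proof.
move=> h; elim: n => [|n IH]; first exact: qser1.
have := qserM h IH; congr qser; apply: funext => w; exact: esym (exprS (f w) n).
Qed.

Lemma qcuspM f g : qcusp f -> qser g -> qcusp (fun w => f w * g w).
Proof.
move=> [c [c0 hc]] [d hd]; exists (cauchyp c d); split; last exact: qexpansionM.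
by rewrite /cauchyp big_ord1 c0 mul0r.
Qed.

Lemma qcuspZ a f : qcusp f -> qcusp (fun w => a * f w).
Proof.
move=> [c [c0 hc]]; exists (fun n => a * c n); split; last exact: qexpansionZ.
by rewrite c0 mulr0.
Qed.

(** Without constant term, [sum |c n| |p|^n] is at most [|p| / r] times [sum |c
n| r^n] for [|p| <= r]. *)
Lemma qcusp_decay f : qcusp f -> exists K, 0 <= K /\ forall w, 1 <= complex.Re w ->
  normc (f w) <= K * expR (- (pi / 4 * complex.Re w)).
Proof.
move=> [c [c0 [h1 h2]]].
set r := expR (- (pi / 4)) : R.
have r0 : 0 < r by exact: expR_gt0.
have r1 : r < 1 by rewrite /r expR_lt1 oppr_lt0 pi4_gt0.
have [M hM] := h1 r (ltW r0) r1.
exists (M / r); split; first by rewrite divr_ge0// ?(wnorm_ge0 hM)// ltW.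
  move=> w w1; have w0 : rhp w by exact: lt_le_trans w1.
  rewrite h2// -normc_nome4.
  set p := nome4 w; have pr : normc p <= r.
    rewrite normc_nome4 ler_expR lerN2 -[leLHS]mulr1 ler_wpM2l// ltW// pi4_gt0//.
  have -> : M / r * normc p = normc p / r * M by ring.
  apply: csum_norm_le => n.
  apply: (@le_trans _ _ (\sum_(k < n) normc p / r * (normc (c k) * r ^+ k))); last first.
    by rewrite -mulr_sumr ler_wpM2l// divr_ge0 ?normc_ge0// ltW.
  apply: ler_sum => -[k kn] _ /=; case: k kn => [|k] kn; first by rewrite c0 mul0r normc0 mul0r mulr0.
  rewrite normcM normcX mulrCA ler_wpM2l ?normc_ge0//.
  rewrite 2!exprS mulrA divfK ?gt_eqF// ler_wpM2l ?normc_ge0//.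
  by rewrite lerXn2r ?nnegrE ?normc_ge0// ltW.
Qed.

Lemma ps_monomial m r z : 0 <= r -> wnorm (fun n => (n == m)%:R : C) r (r ^+ m) /\
  ps (fun n => (n == m)%:R) z = z ^+ m.
Proof.
move=> r0; split.
  move=> n; have [nm|mn] := leqP n m.
    rewrite big1 ?exprn_ge0// => i _.
    by rewrite (ltn_eqF (leq_trans (ltn_ord i) nm)) normc0 mul0r.
  rewrite (bigD1 (Ordinal mn)) //= eqxx normc1 mul1r big1 ?addr0// => i im.
  by rewrite (_ : (_ == _) = false) ?normc0 ?mul0r//; exact: negbTE im.
rewrite /ps (@csum_fin _ _ m.+1); last first.
  by move=> k km; rewrite gtn_eqF// mul0r.
rewrite big_ord_recr /= eqxx mul1r big1 ?add0r// => i _.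
by rewrite ltn_eqF ?mul0r.
Qed.

(** The exponents are [k n^2] in the parameter [nome4]; the cases of interest
are [k = 1, 4, 16]. *)
Lemma theta_qexpansion (k : nat) : (0 < k)%N -> exists c, c 0%N = 1 /\
  qexpansion c (fun w => theta ((k%:R / 4)%:C * w)).
Proof.
move=> k0.
pose dl (j m : nat) : C := (m == k * j.+1 ^ 2)%N%:R.
have dlN r j : 0 <= r -> wnorm (dl j) r (r ^+ (k * j.+1 ^ 2)).
  by move=> r0; exact: (ps_monomial _ 0 r0).1.
have sB r n : 0 <= r -> r < 1 -> \sum_(j < n) r ^+ (k * j.+1 ^ 2) <= (1 - r)^-1.
  move=> r0 r1; apply: le_trans (geo_le n r0 r1); apply: ler_sum => j _.
  by rewrite ler_wiXn2l// ?(ltW r1)//; nia.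
exists (fun n => (n == 0%N)%:R + 2 * csum (fun j => dl j n)); split.
  rewrite eqxx (@csum_fin _ _ 0%N) ?big_ord0 ?mulr0 ?addr0// => j _.
  by rewrite /dl (_ : (0 == _)%N = false)//; lia.
have S r (r0 : 0 <= r) (r1 : r < 1) := wnorm_sum r0 (fun j => dlN r j r0) (fun n => sB r n r0 r1).
split.
  move=> r r0 r1; eexists; apply: (wnormD r0 (ps_one 0 r0).1).
  exact: wnormZ r0 (S r r0 r1).1.
move=> w w0; have p0 := normc_ge0 (nome4 w); have p1 := normc_nome4_lt1 w0.
rewrite (psD (ps_one 0 p0).1 (wnormZ 2 p0 (S _ p0 p1).1))// (ps_one _ p0).2.
rewrite (psZ _ (S _ p0 p1).1)// (S _ p0 p1).2// /theta; congr (1 + 2 * _).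
apply: eq_csum => j; rewrite (ps_monomial _ _ p0).2 /nome4 -expCMn; congr expC.
rewrite -[RHS]mulr_natr natrM natrX; by field.
Qed.

Lemma rhp_scale x w : 0 < x -> rhp w -> rhp (x%:C * w).
Proof. by move=> x0 w0; rewrite /rhp Re_scale mulr_gt0. Qed.

(** Integrating [nome4 w ^ n = exp (- pi n w / 4)] term by term; division by
zero makes the constant term vanish. *)
Definition prim_coeff c n : C := (- (4 / (pi * n%:R)))%:C * c n.

Lemma prim_coeff_summable c : disc_summable c -> disc_summable (prim_coeff c).
Proof.
move=> hc r r0 r1; have [M hM] := hc r r0 r1; exists (2 * M).
have := wnormZ 2 r0 hM; rewrite normc_nat; apply: wnorm_le => // n.
rewrite /prim_coeff !normcM normc_nat normc_real ler_wpM2r ?normc_ge0//.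
rewrite normrN ger0_norm; last by rewrite divr_ge0// mulr_ge0// pi_ge0.
case: n => [|n]; first by rewrite mulr0 invr0 mulr0.
rewrite ler_pdivrMr; last by rewrite mulr_gt0 ?pi_gt0.
have := pi_ge2 R; have : 1 <= n.+1%:R :> R by rewrite ler1n.
by move=> h1 h2; nra.
Qed.

Lemma arith_geo_le r n : 0 <= r -> r < 1 -> n%:R * r ^+ n <= (1 - r)^-1.
Proof.
move=> r0 r1; apply: le_trans (geo_le n r0 r1).
have -> : n%:R * r ^+ n = \sum_(k < n) r ^+ n.
  by rewrite sumr_const card_ord mulr_natl.
apply: ler_sum => k _; rewrite ler_wiXn2l ?(ltW r1)//; exact: ltnW.
Qed.

(** The remainder of the [n]-th term is bounded by [expC_order2]. It carries a
factor of order [n] and a growth [exp (pi n |z| / 4)]; for [|z| <= Re w / 2]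
half of the decay of [nome4 w ^ n] absorbs the growth, and half of what is left
absorbs the factor [n]. *)
Lemma prim_coeff_cder c w : c 0%N = 0 -> disc_summable c -> rhp w ->
  cder (fun u => ps (prim_coeff c) (nome4 u)) w (ps c (nome4 w)).
Proof.
move=> c0 hc w0.
set x := complex.Re w; have x0 : 0 < x by [].
(* a quarter of the decay exponent of [nome4 w] at [x = Re w] *)
pose r2 : R := expR (- (pi / 4 * x / 4)).
have r20 : 0 < r2 by exact: expR_gt0.
have r21 : r2 < 1 by rewrite /r2 expR_lt1 oppr_lt0 divr_gt0// mulr_gt0// pi4_gt0.
have [M hM] := hc r2 (ltW r20) r21.
have M0 := wnorm_ge0 hM.
pose K := pi / 4 * (1 - r2)^-1.
have K0 : 0 <= K by rewrite mulr_ge0 ?invr_ge0 ?subr_ge0 ?(ltW r21)// ltW// pi4_gt0.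
exists (K * M), (x / 2); split; [by rewrite divr_gt0|exact: mulr_ge0|].
move=> z hz.
have wz0 : rhp (w + z).
  rewrite /rhp Re_add; have := normc_ReP z; rewrite ler_norml => /andP[h1 _].
  by move: (h1) (hz); rewrite -/x => ? ?; lra.
pose a n : C := - (pi / 4 * n%:R)%:C * z.
have pE n : nome4 (w + z) ^+ n = nome4 w ^+ n * expC (a n).
  have -> : nome4 (w + z) = nome4 w * expC (- (pi / 4)%:C * z).
    by rewrite /nome4 mulrDr expCD.
  have -> : a n = - (pi / 4)%:C * z *+ n.
    by rewrite -mulr_natr -natrC /a; ring.
  by rewrite expCMn exprMn.
have pz := normc_nome4_lt1 wz0; have pw := normc_nome4_lt1 w0.
have [M1 hM1] := prim_coeff_summable hc (normc_ge0 _) pz.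
have [M2 hM2] := prim_coeff_summable hc (normc_ge0 _) pw.
have [M3 hM3] := hc _ (normc_ge0 _) pw.
have A1 := wnorm_absb hM1 (lexx _).
have A2 := wnorm_absb hM2 (lexx _).
have A3 := wnorm_absb hM3 (lexx _).
have -> : ps (prim_coeff c) (nome4 (w + z)) - ps (prim_coeff c) (nome4 w) - z * ps c (nome4 w) =
  csum (fun n => prim_coeff c n * nome4 (w + z) ^+ n + (-1 * (prim_coeff c n * nome4 w ^+ n) +
     - z * (c n * nome4 w ^+ n))).
  rewrite (csumD A1 (absbD (absbZ (-1) A2) (absbZ (- z) A3))).
  rewrite (csumD (absbZ (-1) A2) (absbZ (- z) A3)) (csumZ _ A2) (csumZ _ A3).
  by rewrite mulN1r mulNr addrA.
have -> : K * M * normc z ^+ 2 = (K * normc z ^+ 2) * M by ring.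
apply: csum_norm_le => n.
apply: (@le_trans _ _ (\sum_(k < n) K * normc z ^+ 2 * (normc (c k) * r2 ^+ k))); last first.
  by rewrite -mulr_sumr ler_wpM2l// mulr_ge0// exprn_ge0// normc_ge0.
apply: ler_sum => -[k kn] _ /=.
case: k kn => [|k] kn.
  by rewrite /prim_coeff c0 !(mulr0, mul0r, addr0, normc0).
have p0 := pi_gt0 R.
have pn : pi != 0 :> R by rewrite gt_eqF.
have k1n : k.+1%:R != 0 :> R by rewrite pnatr_eq0.
have -> : prim_coeff c k.+1 * nome4 (w + z) ^+ k.+1 + (-1 * (prim_coeff c k.+1 * nome4 w ^+ k.+1) +
     - z * (c k.+1 * nome4 w ^+ k.+1)) =
   prim_coeff c k.+1 * nome4 w ^+ k.+1 * (expC (a k.+1) - 1 - a k.+1).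
  rewrite pE mulN1r (mulNr z).
  have -> : z * (c k.+1 * nome4 w ^+ k.+1) = prim_coeff c k.+1 * a k.+1 * nome4 w ^+ k.+1.
    rewrite /prim_coeff /a.
    have -> : (- (4 / (pi * k.+1%:R)))%:C * c k.+1 * (- (pi / 4 * k.+1%:R)%:C * z) =
      ((4 / (pi * k.+1%:R)) * (pi / 4 * k.+1%:R))%:C * (c k.+1 * z) :> C.
      by ring.
    have -> : (4 / (pi * k.+1%:R)) * (pi / 4 * k.+1%:R) = 1 :> R.
      by move: pn k1n; move: (pi) (k.+1%:R) => P N P0 N0; field; rewrite ?N0 ?P0.
    by rewrite rmorph1 mul1r mulrCA mulrA.
  by rewrite !mulrBr mulr1 mulrA addrA (mulrAC _ (a _)).
have an : normc (a k.+1) = pi / 4 * k.+1%:R * normc z.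
  by rewrite /a normcM normcNE normc_real ger0_norm// mulr_ge0// ltW// pi4_gt0.
rewrite 2!normcM normcX.
have dn : normc (prim_coeff c k.+1) = 4 / (pi * k.+1%:R) * normc (c k.+1).
  rewrite /prim_coeff normcM normc_real normrN ger0_norm// divr_ge0// mulr_ge0//; exact: ltW.
have e2 := expC_order2 (a k.+1).
apply: (@le_trans _ _ (normc (prim_coeff c k.+1) * normc (nome4 w) ^+ k.+1 *
   (normc (a k.+1) ^+ 2 * expR (normc (a k.+1))))).
  by rewrite ler_wpM2l// mulr_ge0 ?exprn_ge0 ?normc_ge0.
have ee : normc (nome4 w) ^+ k.+1 * expR (normc (a k.+1)) <= (r2 ^+ k.+1) ^+ 2.
  rewrite normc_nome4 an /r2 -!expRM_natl -expRD ler_expR -/x.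
  have : pi / 4 * k.+1%:R * normc z <= pi / 4 * k.+1%:R * (x / 2).
    by rewrite ler_wpM2l// mulr_ge0// ltW// pi4_gt0.
  move: (k.+1%:R) (normc z) => N nz h.
  apply: (@le_trans _ _ (N * - (pi / 4 * x) + pi / 4 * N * (x / 2))); first by rewrite lerD2l.
  rewrite le_eqVlt; apply/orP; left; apply/eqP; by field.
apply: (@le_trans _ _ (normc (prim_coeff c k.+1) * normc (a k.+1) ^+ 2 * (r2 ^+ k.+1) ^+ 2)).
  have -> (A B D E : R) : A * B * (D * E) = A * D * (B * E) by ring.
  by rewrite ler_wpM2l// mulr_ge0 ?exprn_ge0 ?normc_ge0.
rewrite dn an.
have -> : 4 / (pi * k.+1%:R) * normc (c k.+1) * (pi / 4 * k.+1%:R * normc z) ^+ 2 * (r2 ^+ k.+1) ^+ 2 =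
   (pi / 4 * (k.+1%:R * r2 ^+ k.+1)) * (normc z ^+ 2 * (normc (c k.+1) * r2 ^+ k.+1)).
  move: (r2 ^+ _) (normc z) (normc _) => ? ? ?.
  by move: pn k1n; move: (pi) (k.+1%:R) => P N P0 N0; field; rewrite ?N0 ?P0.
rewrite -[leRHS]mulrA ler_wpM2r//.
  by rewrite mulr_ge0 ?exprn_ge0 ?normc_ge0// mulr_ge0 ?exprn_ge0 ?normc_ge0// ltW.
by rewrite /K ler_wpM2l ?(ltW pi4_gt0)// arith_geo_le// ltW.
Qed.

Lemma qcusp_prim f : qcusp f ->
  exists F, qcusp F /\ forall w, rhp w -> cder F w (f w).
Proof.
move=> [c [c0 [h1 h2]]]; exists (fun u => ps (prim_coeff c) (nome4 u)); split.
  exists (prim_coeff c); split; first by rewrite /prim_coeff c0 mulr0.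
  by split=> //; exact: prim_coeff_summable.
by move=> w w0; rewrite h2//; exact: prim_coeff_cder.
Qed.

End QSeries.

(** * Integrals over the positive axis through holomorphic primitives *)

Section HolomorphicIntegral.
Context {R : realType}.
Local Notation C := R[i].
Implicit Types (f g F G : C -> C) (w a b I J : C) (t x : R).

(** Limit at [0] from the right. Limits at infinity are limits at [0] of the
function composed with the inverse. *)
Definition lim0 (u : R -> C) a := forall e : R, 0 < e ->
  exists2 d : R, 0 < d & forall t, 0 < t -> t < d -> normc (u t - a) <= e.

Lemma lim0_near (u v : R -> C) a b (K d : R) : 0 < d -> 0 <= K -> lim0 u a ->
  (forall t, 0 < t -> t < d -> normc (v t - b) <= normc (u t - a) + K * t) -> lim0 v b.
Proof.
move=> d0 K0 hu hv e e0; have e2 : 0 < e / 2 by rewrite divr_gt0.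
have K1 : 0 < K + 1 by rewrite ltr_wpDl.
have [d1 d10 h1] := hu _ e2.
exists (Num.min (Num.min d d1) (e / 2 / (K + 1))).
  by rewrite !lt_min d0 d10 divr_gt0.
move=> t t0; rewrite !lt_min => /andP[/andP[td td1] te].
apply: le_trans (hv t t0 td) _; rewrite [leRHS]splitr; apply: lerD; first exact: h1.
move: te; rewrite ltr_pdivlMr// => te; apply: le_trans (ltW te).
by rewrite mulrDr mulr1 mulrC lerDl ltW.
Qed.

Lemma lim0_eq (u v : R -> C) a : (forall t, 0 < t -> u t = v t) -> lim0 u a -> lim0 v a.
Proof.
by move=> uv hu; apply: (lim0_near ltr01 (lexx 0) hu) => t t0 _; rewrite uv// mul0r addr0.
Qed.

Lemma lim0_cst a : lim0 (fun=> a) a.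
Proof. by move=> e e0; exists 1 => // t _ _; rewrite subrr normc0 ltW. Qed.

Lemma lim0D (u v : R -> C) a b : lim0 u a -> lim0 v b -> lim0 (fun t => u t + v t) (a + b).
Proof.
move=> hu hv e e0; have e2 : 0 < e / 2 by rewrite divr_gt0.
have [d1 d10 h1] := hu _ e2; have [d2 d20 h2] := hv _ e2.
exists (Num.min d1 d2); first by rewrite lt_min d10.
move=> t t0; rewrite lt_min => /andP[td1 td2].
have -> : u t + v t - (a + b) = (u t - a) + (v t - b) by ring.
apply: le_trans (ler_normcD _ _) _; rewrite [leRHS]splitr; apply: lerD; [exact: h1|exact: h2].
Qed.

Lemma lim0Z (u : R -> C) c a : lim0 u a -> lim0 (fun t => c * u t) (c * a).
Proof.
move=> hu e e0; have c1 : 0 < normc c + 1 by rewrite ltr_wpDl// normc_ge0.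
have [d d0 h] := hu (e / (normc c + 1)) (divr_gt0 e0 c1).
exists d => // t t0 td; rewrite -mulrBr normcM.
apply: (@le_trans _ _ ((normc c + 1) * normc (u t - a))).
  by rewrite ler_wpM2r ?normc_ge0// lerDl.
by rewrite mulrC -ler_pdivlMr// h.
Qed.

Lemma lim0_unique (u : R -> C) a b : lim0 u a -> lim0 u b -> a = b.
Proof.
move=> hu hv; apply/eqP; rewrite -subr_eq0 -normc_eq0 eq_le normc_ge0 andbT.
apply/ler_addgt0Pr => e e0; rewrite add0r; have e2 : 0 < e / 2 by rewrite divr_gt0.
have [d1 d10 h1] := hu _ e2; have [d2 d20 h2] := hv _ e2.
pose t := Num.min d1 d2 / 2.
have m0 : 0 < Num.min d1 d2 by rewrite lt_min d10.
have t0 : 0 < t by rewrite divr_gt0.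
have tm : t < Num.min d1 d2 by rewrite /t ltr_pdivrMr// mulr_natr mulr2n ltrDl.
move: (tm); rewrite lt_min => /andP[td1 td2].
have -> : a - b = (u t - b) - (u t - a) by ring.
apply: le_trans (ler_normcB _ _) _; rewrite [leRHS]splitr; apply: lerD; [exact: h2|exact: h1].
Qed.

Lemma lim0_scale (u : R -> C) a x : 0 < x -> lim0 u a -> lim0 (fun t => u (x * t)) a.
Proof.
move=> x0 hu e e0; have [d d0 h] := hu e e0; exists (d / x); first by rewrite divr_gt0.
by move=> t t0 td; apply: h; rewrite ?mulr_gt0// mulrC -ltr_pdivlMr.
Qed.

Definition primitive F f := forall w, rhp w -> cder F w (f w).

(** The integral of [f] over the positive axis, for holomorphic [f]: the
increment of a primitive from [0] to infinity. The primitive is required on the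
whole half plane so that it can be composed with maps that leave the axis. *)
Definition hasint f I := exists F a b, [/\ primitive F f,
  lim0 (fun t => F t%:C) a, lim0 (fun t => F t^-1%:C) b & I = b - a].

Lemma rhp_real t : 0 < t -> rhp t%:C. Proof. by []. Qed.

Lemma rhp_neq0 w : rhp w -> w != 0.
Proof. by apply: contraTneq => ->; rewrite /rhp ltxx. Qed.

Lemma rhp_inv w : rhp w -> rhp w^-1.
Proof.
move=> w0; rewrite /rhp Re_inv divr_gt0// exprn_gt0// normc_gt0; exact: rhp_neq0.
Qed.

Lemma primitive_eq_real F G f g : primitive F f -> primitive G g ->
  (forall t, 0 < t -> f t%:C = g t%:C) -> exists c, forall t, 0 < t -> F t%:C = G t%:C + c.
Proof.
move=> hF hG fg; apply: (cder_eq_real (f := f)) => t t0; first exact: hF.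
by rewrite fg//; exact: hG.
Qed.

(** Only the values on the axis matter, by the mean value theorem. *)
Lemma hasint_unique f g I J : (forall t, 0 < t -> f t%:C = g t%:C) ->
  hasint f I -> hasint g J -> I = J.
Proof.
move=> fg [F [a [b [hF Fa Fb ->]]]] [G [a' [b' [hG Ga Gb ->]]]].
have [c hc] := primitive_eq_real hF hG fg.
have -> : a = a' + c.
  apply: lim0_unique Fa _; apply: lim0_eq (lim0D Ga (lim0_cst c)) => t t0.
  by rewrite hc.
have -> : b = b' + c.
  apply: lim0_unique Fb _; apply: lim0_eq (lim0D Gb (lim0_cst c)) => t t0.
  by rewrite hc ?invr_gt0.
ring.
Qed.

Lemma hasint_ext f g I : (forall w, rhp w -> f w = g w) -> hasint f I -> hasint g I.
Proof.
move=> fg [F [a [b [hF Fa Fb ->]]]]; exists F, a, b; split => // w w0.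
by rewrite -fg//; exact: hF.
Qed.

Lemma hasintD f g I J : hasint f I -> hasint g J -> hasint (fun w => f w + g w) (I + J).
Proof.
move=> [F [a [b [hF Fa Fb ->]]]] [G [a' [b' [hG Ga Gb ->]]]].
exists (fun w => F w + G w), (a + a'), (b + b'); split; try exact: lim0D.
  by move=> w w0; apply: cderD; [exact: hF|exact: hG].
ring.
Qed.

Lemma hasintZ f c I : hasint f I -> hasint (fun w => c * f w) (c * I).
Proof.
move=> [F [a [b [hF Fa Fb ->]]]].
exists (fun w => c * F w), (c * a), (c * b); split; try exact: lim0Z.
  by move=> w w0; apply: cderZ; exact: hF.
by rewrite mulrBr.
Qed.

Lemma real_complexV t : (t^-1)%:C = t%:C^-1 :> C. Proof. exact: fmorphV. Qed.

(** Substitution of [1 / w]. *)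
Lemma hasint_inv f I : hasint f I -> hasint (fun w => w ^- 2 * f w^-1) I.
Proof.
move=> [F [a [b [hF Fa Fb ->]]]].
exists (fun w => -1 * F w^-1), (-1 * b), (-1 * a); split.
- move=> w w0; have := cderZ (-1) (cder_comp (cder_inv (rhp_neq0 w0)) (hF _ (rhp_inv w0))).
  by apply: cder_eq; ring.
- by apply: lim0Z; apply: lim0_eq Fb => t t0; rewrite real_complexV.
- by apply: lim0Z; apply: lim0_eq Fa => t t0; rewrite real_complexV invrK.
- ring.
Qed.

Lemma hasint_scale f I x : 0 < x -> hasint f I ->
  hasint (fun w => f (x%:C * w)) (x%:C^-1 * I).
Proof.
move=> x0 [F [a [b [hF Fa Fb ->]]]].
have xC : x%:C != 0 :> C by exact: rhp_neq0 (rhp_real x0).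
exists (fun w => x%:C^-1 * F (x%:C * w)), (x%:C^-1 * a), (x%:C^-1 * b); split.
- move=> w w0; have := cderZ (x%:C^-1) (cder_comp (cderZ x%:C (cder_id w)) (hF _ (rhp_scale x0 w0))).
  by apply: cder_eq; rewrite mulr1 mulKf.
- by apply: lim0Z; apply: lim0_eq (lim0_scale x0 Fa) => t t0; rewrite rmorphM.
- apply: lim0Z; have x1 : 0 < x^-1 by rewrite invr_gt0.
  apply: lim0_eq (lim0_scale x1 Fb) => t t0; congr F.
  by rewrite invfM invrK rmorphM.
- by rewrite mulrBr.
Qed.

(** A primitive that vanishes at infinity has limit [- I] at [0]: this is how
the end values in [contour] become integrals. *)
Lemma hasint_lim f I F : hasint f I -> primitive F f -> lim0 (fun t => F t^-1%:C) 0 ->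
  lim0 (fun t => F t%:C) (- I).
Proof.
move=> [G [a [b [hG Ga Gb ->]]]] hF F0.
have [c hc] := primitive_eq_real hF hG (fun t _ => erefl).
have bc : b + c = 0.
  apply: lim0_unique F0; apply: lim0_eq (lim0D Gb (lim0_cst c)) => t t0.
  by rewrite hc ?invr_gt0.
have -> : - (b - a) = a + c by rewrite -[LHS](addr0) -bc; ring.
by apply: lim0_eq (lim0D Ga (lim0_cst c)) => t t0; rewrite hc.
Qed.

Lemma poly_exp_decay (c : R) k : 0 < c -> exists2 K, 0 <= K &
  forall x, 0 < x -> x ^+ k * expR (- (c * x)) <= K * x^-1.
Proof.
move=> c0; exists (k.+1`!%:R / c ^+ k.+1).
  by rewrite divr_ge0// exprn_ge0// ltW.
move=> x x0; have cx0 : 0 <= c * x by rewrite mulr_ge0 ?ltW.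
have h : (c * x) ^+ k.+1 / k.+1`!%:R <= expR (c * x).
  apply: le_trans (sum_exp_coeff_le k.+2 cx0).
  rewrite big_ord_recr /= lerDr sumr_ge0// => i _.
  by rewrite divr_ge0// exprn_ge0.
have f0 : 0 < k.+1`!%:R :> R by rewrite ltr0n fact_gt0.
rewrite expRN ler_pdivrMr ?expR_gt0//.
apply: (@le_trans _ _ (k.+1`!%:R / c ^+ k.+1 / x * ((c * x) ^+ k.+1 / k.+1`!%:R))).
  rewrite exprMn exprS le_eqVlt; apply/orP; left; apply/eqP.
  have cn : c ^+ k != 0 by rewrite expf_neq0// gt_eqF.
  move: (c ^+ k) cn (k.+1`!%:R : R) f0 => ck ck0 f f0.
  rewrite (exprS x); by field; rewrite ck0 !gt_eqF.
by rewrite ler_wpM2l// divr_ge0 ?(ltW x0)// divr_ge0 ?(ltW f0)// exprn_ge0// ltW.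
Qed.

Lemma qcusp_lim k f b : complex.Re b = 0 -> qcusp f ->
  lim0 (fun t => t^-1%:C ^+ k * f (t^-1%:C + b)) 0.
Proof.
move=> b0 hf; have [K [K0 hK]] := qcusp_decay hf.
have [K1 K10 hK1] := poly_exp_decay k (@pi4_gt0 R).
have KK : 0 <= K * K1 by exact: mulr_ge0.
apply: (lim0_near ltr01 KK (lim0_cst 0)) => t t0 t1.
rewrite subr0 subrr normc0 add0r normcM normcX normc_real ger0_norm ?invr_ge0 ?(ltW t0)//.
have ti : 1 <= t^-1 by rewrite invf_ge1// ltW.
have re : complex.Re (t^-1%:C + b) = t^-1 by rewrite Re_add b0 addr0.
apply: (@le_trans _ _ (t^-1 ^+ k * (K * expR (- (pi / 4 * t^-1))))).
  by rewrite ler_wpM2l ?exprn_ge0 ?invr_ge0 ?(ltW t0)// -{2}re; apply: hK; rewrite re.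
rewrite mulrCA -[leRHS]mulrA ler_wpM2l//.
by have := hK1 t^-1; rewrite invrK invr_gt0; apply.
Qed.

(** Integration by parts: a primitive of [w^(k+1) f] is [w^(k+1) F] minus [k +
1] times a primitive of [w^k F], with [F] again a cuspidal q-series. *)
Lemma moment_prim k f : qcusp f -> exists P, primitive P (fun w => w ^+ k * f w) /\
  lim0 (fun t => P t^-1%:C) 0.
Proof.
elim: k f => [|k IH] f hf.
  have [F [hF pF]] := qcusp_prim hf; exists F; split.
    by move=> w w0; rewrite expr0 mul1r; exact: pF.
  by apply: lim0_eq (qcusp_lim 0 (erefl : complex.Re (0 : C) = 0) hF) => t t0; rewrite addr0 mul1r.
have [F [hF pF]] := qcusp_prim hf; have [P [hP lP]] := IH F hF.
exists (fun w => w ^+ k.+1 * F w + (- k.+1%:R) * P w); split.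
  move=> w w0; have := cderD (cderM (cder_X w k) (pF w w0)) (cderZ (- k.+1%:R) (hP w w0)).
  by apply: cder_eq; ring.
have -> : 0 = 0 + (- k.+1%:R) * 0 :> C by rewrite mulr0 addr0.
apply: lim0D; last exact: lim0Z.
by apply: lim0_eq (qcusp_lim k.+1 (erefl : complex.Re (0 : C) = 0) hF) => t t0; rewrite addr0.
Qed.

(** Two forms of weight 5 exchanged by inversion. *)
Definition invpair f g := forall w, rhp w -> f w^-1 = w ^+ 5 * g w.

Lemma invpair_sym f g : invpair f g -> invpair g f.
Proof.
move=> h w w0; have := h _ (rhp_inv w0); rewrite invrK => ->.
have wn := rhp_neq0 w0.
by rewrite mulrA -exprMn divff// expr1n mul1r.
Qed.

Lemma invpair_moment k f g w : (k <= 3)%N -> invpair f g -> rhp w ->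
  w ^- 2 * (w^-1 ^+ k * f w^-1) = w ^+ (3 - k) * g w.
Proof.
move=> k3 h w0; rewrite h//; have wn := rhp_neq0 w0.
(* weight 5 splits as 2 from the differential, [k] and [3 - k] *)
have -> : w ^+ 5 = w ^+ 2 * w ^+ k * w ^+ (3 - k) by rewrite -!exprD; congr (_ ^+ _); lia.
rewrite exprVn; field; by rewrite wn expf_neq0.
Qed.

(** At infinity the primitive of [w^k f] built from q-series has limit 0. Near
[0] it is compared, through inversion, with the primitive of [w^(3 - k) g] at
infinity; the two differ by a constant. Substituting [1 / w] then identifies
the moments. *)
Lemma moment_exists k f g : (k <= 3)%N -> qcusp f -> qcusp g -> invpair f g ->
  exists I, hasint (fun w => w ^+ k * f w) I /\ hasint (fun w => w ^+ (3 - k) * g w) I.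
Proof.
move=> k3 hf hg fg.
have [P [hP lP]] := moment_prim k hf; have [Q [hQ lQ]] := moment_prim (3 - k) hg.
have hQ' : primitive (fun w => -1 * Q w^-1) (fun w => w ^+ k * f w).
  move=> w w0; have := cderZ (-1) (cder_comp (cder_inv (rhp_neq0 w0)) (hQ _ (rhp_inv w0))).
  apply: cder_eq; have := invpair_moment (_ : (3 - k <= 3)%N) (invpair_sym fg) w0.
  have -> : (3 - (3 - k) = k)%N by lia.
  move=> <-; last by lia.
  ring.
have [c hc] := primitive_eq_real hP hQ' (fun t _ => erefl).
have h1 : hasint (fun w => w ^+ k * f w) (0 - c).
  exists P, c, 0; split => //.
  have -> : c = -1 * 0 + c by rewrite mulr0 add0r.
  apply: lim0_eq (lim0D (lim0Z (-1) lQ) (lim0_cst c)) => t t0.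
  by rewrite hc// real_complexV.
exists (0 - c); split => //.
apply: hasint_ext (hasint_inv h1) => w w0; exact: invpair_moment.
Qed.

(** By inversion [F (1 / w)] has derivative [- w^3 g w], which is exponentially
small for large [Re w]; so [F] has the same limit along [1 / (y + b)] as along
[1 / y]. *)
Lemma vertical_shift f g F b : complex.Re b = 0 -> normc b <= 1 -> qcusp g -> invpair f g ->
  primitive F f -> lim0 (fun t => F (t^-1%:C + b)^-1 - F t%:C) 0.
Proof.
move=> b0 b1 hg fg hF.
have [K [K0 hK]] := qcusp_decay hg.
have [K1 K10 hK1] := poly_exp_decay 3 (@pi4_gt0 R).
have KK : 0 <= 16 * (K * K1) by rewrite mulr_ge0// mulr_ge0.
apply: (lim0_near ltr01 KK (lim0_cst 0)) => t t0 t1.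
rewrite subr0 subrr normc0 add0r.
set x := t^-1; have x0 : 0 < x by rewrite invr_gt0.
have x1 : 1 <= x by rewrite invf_ge1// ltW.
have re s : complex.Re (x%:C + s%:C * b) = x by rewrite Re_add Re_scale b0 mulr0 addr0.
have rw s : rhp (x%:C + s%:C * b) by rewrite /rhp re.
(* [|w| <= 2 x] on the segment, as [|b| <= 1 <= x] *)
pose M := 8 * x ^+ 3 * (K * expR (- (pi / 4 * x))).
have M0 : 0 <= M by rewrite !mulr_ge0 ?exprn_ge0 ?expR_ge0 ?(ltW x0).
have -> : t%:C = x%:C^-1 :> C by rewrite /x real_complexV invrK.
apply: (@le_trans _ _ (2 * (normc b * M))).
  apply: (@cder_mvt _ (fun w => F w^-1) (fun w => - w ^- 2 * f w^-1)) => //.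
    move=> s _ _; apply: cder_comp; first exact: cder_inv (rhp_neq0 (rw s)).
    exact: hF (rhp_inv (rw s)).
  move=> s s0 s1; set w := _ + _; have w0 : rhp w by exact: rw.
  have -> : - w ^- 2 * f w^-1 = - (w ^+ 3 * g w).
    by rewrite -(invpair_moment (leq0n 3) fg w0) expr0 mul1r mulNr.
  rewrite normcNE normcM normcX /M; apply: ler_pM; rewrite ?exprn_ge0 ?normc_ge0//.
    have wn : normc w <= 2 * x.
      apply: le_trans (ler_normcD _ _) _; rewrite normc_real ger0_norm ?(ltW x0)//.
      rewrite normcM normc_real ger0_norm// mulr_natl mulr2n lerD2l.
      apply: le_trans x1; rewrite -[leRHS]mulr1; exact: ler_pM (normc_ge0 _) _ _.
    apply: (@le_trans _ _ ((2 * x) ^+ 3)); last by rewrite exprMn; lra.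
    by rewrite lerXn2r ?nnegrE ?normc_ge0// mulr_ge0// ltW.
  by have := hK w; rewrite (re s); apply.
apply: (@le_trans _ _ (2 * M)).
  by rewrite ler_pM2l// -[leRHS]mul1r ler_wpM2r.
have := hK1 x x0; rewrite /x invrK -/x => h.
have := ler_wpM2l K0 h; rewrite /M.
move: (expR _) (x ^+ 3) => E X; lra.
Qed.

(** [- F (1 / (w + b))], with [F] the primitive of [f] that vanishes at
infinity, is a primitive of the integrand. For large [y] it has the same limit
as [- F (1 / y)], which is [I]. For small [y], put [y' = 1 / y]: as [b^2 = -
1], [1 / (y + b) = 1 / (y' - b) - b], so the limit is the opposite of that of
[F (w - b)] at [0]. As [F (w - b)] is a primitive of [al * f'] that vanishes at
infinity, this is [al * I']. *)
Lemma contour f g f' g' (al b I I' : C) : complex.Re b = 0 -> b ^+ 2 = -1 ->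
  qcusp f -> qcusp g -> invpair f g -> qcusp f' -> qcusp g' -> invpair f' g' ->
  (forall w, rhp w -> f (w - b) = al * f' w) ->
  hasint f I -> hasint f' I' ->
  hasint (fun w => (w + b) ^+ 3 * g (w + b)) (I - al * I').
Proof.
move=> b0 bb hf hg fg hf' hg' fg' sh hI hI'.
have b1 : normc b <= 1.
  have := congr1 (@normc R) bb; rewrite normcX normcNE normc1 => h.
  by rewrite -(@expr_le1 _ 2)// ?h// normc_ge0.
have Nb0 : complex.Re (- b) = 0 by case: (b) b0 => ? ? /= ->; rewrite oppr0.
have Nb1 : normc (- b) <= 1 by rewrite normcNE.
have rsh w : rhp w -> rhp (w + b) by rewrite /rhp Re_add b0 addr0.
have rsh' w : rhp w -> rhp (w - b) by rewrite /rhp Re_add Nb0 addr0.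
have [F [hF pF]] := qcusp_prim hf.
have Foo : lim0 (fun t => F t^-1%:C) 0.
  by apply: lim0_eq (qcusp_lim 0 (erefl : complex.Re (0 : C) = 0) hF) => t t0; rewrite addr0 mul1r.
have F0 := hasint_lim hI pF Foo.
have pH : primitive (fun w => F (w - b)) (fun w => al * f' w).
  move=> w w0; have := cder_comp (cderD (cder_id w) (cder_cst (- b) w)) (pF _ (rsh' w w0)).
  by apply: cder_eq; rewrite addr0 mul1r sh.
have Hoo : lim0 (fun t => F (t^-1%:C - b)) 0.
  by apply: lim0_eq (qcusp_lim 0 Nb0 hF) => t t0; rewrite mul1r.
have H0 := hasint_lim (hasintZ al hI') pH Hoo.
have ha : invpair (fun w => al * f' w) (fun w => al * g' w).
  by move=> w w0; rewrite fg'// mulrCA.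
have s1 := vertical_shift b0 b1 hg fg pF.
have s2 := vertical_shift Nb0 Nb1 (qcuspZ al hg') ha pH.
exists (fun w => -1 * F (w + b)^-1), (al * I'), I; split => //.
- move=> w w0; have wb0 := rsh w w0.
  have := cderZ (-1) (cder_comp (cderD (cder_id w) (cder_cst b w))
    (cder_comp (cder_inv (rhp_neq0 wb0)) (pF _ (rhp_inv wb0)))).
  apply: cder_eq; rewrite -(invpair_moment (leq0n 3) fg wb0); ring.
- have -> : al * I' = -1 * (0 + - (al * I')) by ring.
  apply: lim0Z.
  apply: lim0_eq (lim0D s2 H0) => t t0.
  rewrite subrK; congr F; have tn := rhp_neq0 (rhp_real t0).
  have h1 := rhp_neq0 (rsh _ (rhp_real t0)).
  have h2 := rhp_neq0 (rsh' _ (rhp_inv (rhp_real t0))).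
  apply: (mulIf h1); rewrite mulVf// real_complexV; apply: (mulIf h2).
  rewrite mul1r mulrDl mulrDl.
  have -> : (t%:C^-1 - b)^-1 * (t%:C + b) * (t%:C^-1 - b) = t%:C + b.
    by rewrite mulrAC mulVf// mul1r.
  have -> : - b * (t%:C + b) * (t%:C^-1 - b) = - b + b ^+ 2 * t%:C - b ^+ 2 / t%:C + b ^+ 3 by field.
  by rewrite (exprS b 2) bb; ring.
- have -> : I = -1 * (0 + - I) by ring.
  by apply: lim0Z; apply: lim0_eq (lim0D s1 F0) => t t0; rewrite subrK.
Qed.

End HolomorphicIntegral.

(** * Comparison with the Lebesgue integral *)

Section LebesgueLink.
Context {R : realType}.
Local Notation C := R[i].
Implicit Types (f g F G : C -> C) (w a b I J : C) (t x : R).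

Lemma cder_rhp_eq f g w d : rhp w -> (forall z, rhp z -> f z = g z) ->
  cder g w d -> cder f w d.
Proof.
move=> w0 fg [K [e [e0 K0 h]]].
exists K, (Num.min e (complex.Re w / 2)); split => //.
  by rewrite lt_min e0 divr_gt0.
move=> z; rewrite le_min => /andP[ze zw].
have wz : rhp (w + z).
  have := normc_ReP z; rewrite ler_norml => /andP[h1 _].
  by move: w0; rewrite /rhp Re_add => w0; lra.
by rewrite !fg//; exact: h.
Qed.

(** A cuspidal q-series is the termwise primitive of its termwise derivative;
the coefficients of the latter are summable on every smaller disc. *)
Lemma qcusp_cder f w : qcusp f -> rhp w -> exists d, cder f w d.
Proof.
move=> [c [c0 [hc fc]]] w0.
pose c' n : C := (- (pi / 4 * n%:R))%:C * c n.
have cc : prim_coeff c' = c.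
  apply: funext => -[|n]; first by rewrite /prim_coeff /c' c0 !mulr0.
  have n0 : n.+1%:R != 0 :> R by rewrite pnatr_eq0.
  have p0 : pi != 0 :> R by rewrite gt_eqF// pi_gt0.
  rewrite /prim_coeff /c' mulrA -rmorphM.
  have -> : - (4 / (pi * n.+1%:R)) * - (pi / 4 * n.+1%:R) = 1 :> R.
    by move: p0 n0; move: (pi) (n.+1%:R) => P N P0 N0; field; rewrite ?P0 ?N0.
  by rewrite rmorph1 mul1r.
have hc' : disc_summable c'.
  (* a radius between [r] and [1]: the ratio [r / s] absorbs the factor [n] *)
  move=> r r0 r1; pose s := (1 + r) / 2.
  have s0 : 0 < s by rewrite /s; lra.
  have s1 : s < 1 by rewrite /s; lra.
  have rs : r / s < 1 by rewrite ltr_pdivrMr// mul1r /s; lra.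
  have rs0 : 0 <= r / s by rewrite divr_ge0// ltW.
  have [M hM] := hc s (ltW s0) s1.
  exists (pi / 4 * (1 - r / s)^-1 * M) => n.
  apply: (@le_trans _ _ (pi / 4 * (1 - r / s)^-1 * \sum_(k < n) normc (c k) * s ^+ k)); last first.
    by rewrite ler_wpM2l// mulr_ge0 ?(ltW pi4_gt0)// invr_ge0 subr_ge0 ltW.
  rewrite mulr_sumr; apply: ler_sum => k _.
  rewrite normcM normc_real normrN ger0_norm; last by rewrite mulr_ge0// ltW// pi4_gt0.
  have -> : r ^+ k = (r / s) ^+ k * s ^+ k by rewrite -exprMn divfK// gt_eqF.
  rewrite [leRHS](_ : _ = pi / 4 * (normc (c k) * s ^+ k) * (1 - r / s)^-1); last by ring.
  rewrite [leLHS](_ : _ = pi / 4 * (normc (c k) * s ^+ k) * (k%:R * (r / s) ^+ k)); last by ring.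
  apply: ler_wpM2l; last exact: arith_geo_le.
  by rewrite mulr_ge0 ?(ltW pi4_gt0)// mulr_ge0 ?normc_ge0 ?exprn_ge0 ?(ltW s0).
exists (ps c' (nome4 w)); apply: (cder_rhp_eq w0 fc).
rewrite -[X in ps X]cc; apply: prim_coeff_cder => //.
by rewrite /c' c0 mulr0.
Qed.

Lemma cder_continuous_Re f t d : cder f t%:C d -> {for t, continuous (fun s : R => complex.Re (f s%:C))}.
Proof.
move=> /cder_lip [K [e [e0 K0 h]]]; apply/cvgrPdist_le => eps eps0.
have K1 : 0 < K + 1 by rewrite ltr_wpDl.
near=> s.
have st : `|t - s| <= Num.min e (eps / (K + 1)).
  near: s; apply: (@cvgr_dist_le _ _ _ _ _ id) => //.
  by rewrite lt_min e0 divr_gt0.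
move: st; rewrite le_min distrC => /andP[s1 s2].
have := h (s - t)%:C; rewrite normc_real => /(_ s1).
have -> : t%:C + (s - t)%:C = s%:C :> C by rewrite -rmorphD addrC subrK.
move=> hh.
rewrite distrC -Re_sub; apply: le_trans (normc_ReP _) _; apply: le_trans hh _.
apply: (@le_trans _ _ ((K + 1) * `|s - t|)); first by rewrite ler_wpM2r// lerDl.
by rewrite mulrC -ler_pdivlMr.
Unshelve. all: by end_near. Qed.

Lemma lim0_Re u a : lim0 u a -> complex.Re (u t) @[t --> 0^'+] --> complex.Re a.
Proof.
move=> h; apply/cvgrPdist_le => e e0; have [d d0 hd] := h e e0.
near=> t; rewrite distrC -Re_sub; apply: le_trans (normc_ReP _) (hd _ _ _); near: t.
  exact: nbhs_right_gt.
exact: nbhs_right_lt.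
Unshelve. all: by end_near. Qed.

Lemma lim0_Rey (u : R -> C) a : lim0 (fun t => u t^-1) a ->
  complex.Re (u t) @[t --> +oo] --> complex.Re a.
Proof.
move=> h; apply/cvgrPdist_le => e e0; have [d d0 hd] := h e e0.
near=> t; have t0 : 0 < t by near: t; apply: nbhs_pinfty_gt.
rewrite distrC -Re_sub; apply: le_trans (normc_ReP _) _.
have := hd t^-1; rewrite invrK; apply; first by rewrite invr_gt0.
have td : d^-1 < t by near: t; apply: nbhs_pinfty_gt; exact: num_real.
by rewrite -(invrK d) ltf_pV2 ?posrE ?invr_gt0.
Unshelve. all: by end_near. Qed.

Lemma cder_real_derive F t d : cder F t%:C d ->
  is_derive t 1 (fun s : R => complex.Re (F s%:C)) (complex.Re d).
Proof.
move=> h; have := @cder_line _ F 0 1 d t.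
rewrite mul1r add0r mulr1 => /(_ h).
by under eq_fun do rewrite mulr1 add0r.
Qed.

(** The real part of [- i F] has derivative [Im f = 0] on the axis, so it has
equal limits at both ends. *)
Lemma hasint_Im f I : (forall t, 0 < t -> complex.Im (f t%:C) = 0) -> hasint f I ->
  complex.Im I = 0.
Proof.
move=> fr [F [a [b [hF Fa Fb ->]]]].
have dv t : 0 < t -> is_derive t 1 (fun s : R => complex.Re (- 'i * F s%:C)) 0.
  move=> t0; have := cder_real_derive (cderZ (- 'i) (hF _ (rhp_real t0))).
  have -> : complex.Re (- 'i * f t%:C) = 0 by rewrite Re_mul fr//=; ring.
  by [].
have cst s t : 0 < s -> s < t -> complex.Re (- 'i * F t%:C) = complex.Re (- 'i * F s%:C).
  move=> s0 st; apply/eqP; rewrite -subr_eq0.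
  have [||c _ ->] := @MVT R (fun s : R => complex.Re (- 'i * F s%:C)) (fun=> 0) s t st.
  - by move=> x; rewrite in_itv /= => /andP[sx _]; apply: dv; exact: lt_trans sx.
  - apply: derivable_within_continuous => x; rewrite in_itv /= => /andP[sx _].
    by have [] := dv x (lt_le_trans s0 sx).
  by rewrite mul0r.
have ab : complex.Re (- 'i * b) = complex.Re (- 'i * a).
  have h1 := lim0_Re (lim0Z (- 'i) Fa).
  have h2 := lim0_Re (lim0Z (- 'i) Fb).
  pose c := complex.Re (- 'i * F 1%:C).
  have e t : 0 < t -> complex.Re (- 'i * F t%:C) = c.
    move=> t0; have [t1|t1|->//] := ltgtP t 1; first exact: esym (cst _ _ t0 t1).
    exact: cst ltr01 t1.
  have c1 : (fun _ : R => c) @ 0^'+ --> complex.Re (- 'i * a).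
    apply: cvg_trans h1; apply: near_eq_cvg; near=> t; by rewrite e.
  have c2 : (fun _ : R => c) @ 0^'+ --> complex.Re (- 'i * b).
    apply: cvg_trans h2; apply: near_eq_cvg; near=> t; by rewrite e// invr_gt0.
  exact: cvg_unique c2 c1.
move: ab; rewrite !Re_mul Im_sub /=; lra.
Unshelve. all: by end_near. Qed.

(** The fundamental theorem of calculus for nonnegative integrands, with
integrand and primitive extended to [0] by their limits. *)
Lemma Rintegral_hasint f (rho : R -> R) I :
  (forall t, 0 < t -> f t%:C = (rho t)%:C) -> (forall t, 0 < t -> 0 <= rho t) ->
  (forall t, 0 < t -> exists d, cder f t%:C d) -> lim0 (fun t => f t%:C) 0 ->
  hasint f I -> \int[lebesgue_measure]_(t in `]0, +oo[) rho t = complex.Re I.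
Proof.
move=> frho rho0 fd f0 [F [a [b [hF Fa Fb ->]]]].
pose r (t : R) := if 0 < t then complex.Re (f t%:C) else 0.
pose P (t : R) := if 0 < t then complex.Re (F t%:C) else complex.Re a.
have r0 : r 0 = 0 by rewrite /r ltxx.
have P0 : P 0 = complex.Re a by rewrite /P ltxx.
have np t : 0 < t -> \forall s \near t, 0 < s.
  by move=> t0; exact: lt_nbhsr.
have cr : {within `[0, +oo[, continuous r}.
  apply/continuous_within_itvcyP; split.
    move=> t; rewrite in_itv /= andbT => t0; have [d hd] := fd t t0.
    have : complex.Re (f s%:C) @[s --> t] --> r t.
      by have := cder_continuous_Re hd; rewrite /prop_for /continuous_at /r t0.
    apply: cvg_trans; apply: near_eq_cvg; near=> s; rewrite /r.
    by have -> : 0 < s by near: s; exact: np.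
  rewrite r0; have := lim0_Re f0; apply: cvg_trans; apply: near_eq_cvg; near=> s; rewrite /r.
  by have -> : 0 < s by near: s; exact: nbhs_right_gt.
have dP t : 0 < t -> is_derive t 1 P (r t).
  move=> t0; rewrite /r t0; apply: near_eq_is_derive (cder_real_derive (hF _ (rhp_real t0))).
  near=> s; rewrite /P; by have -> : 0 < s by near: s; exact: np.
have dP' t : 0 < t -> derivable P t 1 by move=> t0; have [] := dP t t0.
have rp t : 0 <= t -> 0 <= r t.
  by move=> _; rewrite /r; case: ifPn => // t0; rewrite frho// rho0.
have Py : P x @[x --> +oo] --> complex.Re b.
  have := lim0_Rey (u := fun t => F t%:C) Fb; apply: cvg_trans; apply: near_eq_cvg; near=> s; rewrite /P.
  by have -> : 0 < s by near: s; apply: nbhs_pinfty_gt.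
have Pz : P x @[x --> 0^'+] --> P 0.
  rewrite P0; have := lim0_Re Fa; apply: cvg_trans; apply: near_eq_cvg; near=> s; rewrite /P.
  by have -> : 0 < s by near: s; exact: nbhs_right_gt.
have key := Rintegral_ge0_continuous_FTC2y rp cr Py dP' Pz.
transitivity (\int[lebesgue_measure]_(t in `]0, +oo[) r t).
  apply: eq_Rintegral => t; rewrite inE /= in_itv /= andbT => t0.
  by rewrite /r t0 frho.
have mr : measurable_fun (`]0, +oo[ : set R) r.
  apply: open_continuous_measurable_fun => //.
  by move: cr => /continuous_within_itvcyP[/in_continuous_mksetP cf _].
rewrite /Rintegral integral_itv_obnd_cbnd; last exact/measurable_EFinP.
rewrite -/(Rintegral _ _ _) key; first by rewrite P0 Re_sub.
move=> t; rewrite in_itv /= andbT => t0; rewrite derive1E.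
by have [_ ->] := dP t t0.
Unshelve. all: by end_near. Qed.

(** By inversion the integrand at [t] is [x^(5 - k) g x] at [x = 1 / t]. *)
Lemma moment_lim0 k f g : (k <= 3)%N -> qcusp g -> invpair f g ->
  lim0 (fun t => t%:C ^+ k * f t%:C) 0.
Proof.
move=> k3 hg fg.
apply: lim0_eq (qcusp_lim (5 - k) (erefl : complex.Re (0 : C) = 0) hg) => t t0.
have h := fg _ (rhp_inv (rhp_real t0)); rewrite invrK in h.
rewrite h addr0 real_complexV mulrA; congr (_ * _).
have tn := rhp_neq0 (rhp_real t0).
have -> : t%:C^-1 ^+ 5 = t%:C^-1 ^+ k * t%:C^-1 ^+ (5 - k).
  by rewrite -exprD; congr (_ ^+ _); lia.
by rewrite mulrA -exprMn divff// expr1n mul1r.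
Qed.

Lemma moment_cder k f t : qcusp f -> 0 < t -> exists d, cder (fun w => w ^+ k * f w) t%:C d.
Proof.
move=> hf t0; have [d hd] := qcusp_cder hf (rhp_real t0).
case: k => [|k].
  exists d; apply: cder_rhp_eq hd => // z _; exact: mul1r.
by eexists; exact: cderM (cder_X _ k) hd.
Qed.

End LebesgueLink.

(** * The four forms of weight 5 *)

Section Forms.
Context {R : realType}.
Local Notation C := R[i].
Implicit Types (w : C) (t x y : R).

(** The four forms of the opening remarks, with a factor [th2] in front because
it is the one that vanishes at infinity. *)
Definition vhat w : C := th2 w ^+ 8 * (th3 w * th4 w).
Definition uhat w : C := th2 w * (th3 w * th4 w ^+ 8).
Definition hhat w : C := th2 w * (th3 w ^+ 8 * th4 w).
Definition ghat w : C := th2 w ^+ 4 * (th3 w ^+ 2 * th4 w ^+ 4).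

Lemma qexpansion_theta k (f : C -> C) : (0 < k)%N -> (forall w, f w = theta ((k%:R / 4)%:C * w)) ->
  exists c, c 0%N = 1 /\ qexpansion c f.
Proof. by move=> k0 /funext ->; exact: theta_qexpansion. Qed.

Lemma th3_qexpansion : exists c, c 0%N = 1 /\ qexpansion c (@th3 R).
Proof.
apply: (@qexpansion_theta 4) => // w; rewrite /th3; congr theta.
by rewrite divff ?pnatr_eq0// rmorph1 mul1r.
Qed.

Lemma th3_qser : qser (@th3 R).
Proof. by have [c [_ h]] := th3_qexpansion; exists c. Qed.

Lemma th4_qser : qser (@th4 R).
Proof.
have [c [_ hc]] := th3_qexpansion.
have [d [_ hd]] : exists d, d 0%N = 1 /\ qexpansion d (fun w : C => theta (4 * w)).
  apply: (@qexpansion_theta 16) => // w.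
  by have -> : (16%:R / 4)%:C = 4 :> C by field.
rewrite (_ : @th4 R = fun w => 2 * theta (4 * w) + -1 * th3 w).
  eexists; exact: qexpansionD (qexpansionZ 2 hd) (qexpansionZ (-1) hc).
by apply: funext => w; rewrite mulN1r.
Qed.

Lemma th2_qcusp : qcusp (@th2 R).
Proof.
have [c [c0 hc]] := th3_qexpansion.
have [d [d0 hd]] : exists d, d 0%N = 1 /\ qexpansion d (fun w : C => theta (w / 4)).
  apply: (@qexpansion_theta 1) => // w; congr theta.
  by field.
rewrite (_ : @th2 R = fun w => theta (w / 4) + -1 * th3 w); last first.
  by apply: funext => w; rewrite mulN1r.
exists (fun n => d n + -1 * c n); split; first by rewrite c0 d0 mulr1 subrr.
exact: qexpansionD hd (qexpansionZ (-1) hc).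
Qed.

Lemma vhat_qcusp : qcusp vhat.
Proof.
rewrite /vhat; under eq_fun do rewrite exprS -mulrA.
apply: qcuspM th2_qcusp _; apply: qserM; first exact: qserX (qcuspW th2_qcusp).
exact: qserM th3_qser th4_qser.
Qed.

Lemma ghat_qcusp : qcusp ghat.
Proof.
rewrite /ghat; under eq_fun do rewrite exprS -mulrA.
apply: qcuspM th2_qcusp _; apply: qserM; first exact: qserX (qcuspW th2_qcusp).
apply: qserM; [exact: qserX th3_qser|exact: qserX th4_qser].
Qed.

Lemma uhat_qcusp : qcusp uhat.
Proof. apply: qcuspM th2_qcusp _; apply: qserM; [exact: th3_qser|exact: qserX th4_qser]. Qed.

Lemma hhat_qcusp : qcusp hhat.
Proof. apply: qcuspM th2_qcusp _; apply: qserM; [exact: qserX th3_qser|exact: th4_qser]. Qed.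

Lemma vhat_uhat : invpair vhat uhat.
Proof.
move=> w w0; have [s [-> hs]] := rhp_sqrt w0.
rewrite /vhat /uhat th2_inv// th3_inv// th4_inv//; ring.
Qed.

Lemma hhat_hhat : invpair hhat hhat.
Proof.
move=> w w0; have [s [-> hs]] := rhp_sqrt w0.
rewrite /hhat th2_inv// th3_inv// th4_inv//; ring.
Qed.

Lemma ghat_ghat : invpair ghat ghat.
Proof.
move=> w w0; have [s [-> hs]] := rhp_sqrt w0.
rewrite /ghat th2_inv// th3_inv// th4_inv//; ring.
Qed.

Lemma vhat_shift w : rhp w -> vhat (w - 'i) = vhat w.
Proof.
move=> w0; rewrite /vhat th2_shift// th3_shift// th4_shift// exprMn zeta8 mul1r.
by rewrite (mulrC (th4 w)).
Qed.

Lemma uhat_shift w : rhp w -> uhat (w - 'i) = zeta * hhat w.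
Proof.
move=> w0; rewrite /uhat /hhat th2_shift// th3_shift// th4_shift//.
by rewrite -mulrA (mulrC (th4 w)).
Qed.

End Forms.

Section OnTheAxis.
Context {R : realType}.
Local Notation C := R[i].
Implicit Types (w : C) (t x y : R).

(** Euler's product at the nome [exp (- pi x)], so that [eul (2 y)] is the
infinite product in [eta (i y)]. *)
Definition eul x : R := qinf (expR (- (pi * x))).

Lemma eul_gt0 x : 0 < x -> 0 < eul x.
Proof. by move=> x0; apply: qinf_gt0; exact: nome_in01. Qed.

Lemma nome_pow x n : expR (- (pi * x)) ^+ n = expR (- (pi * (n%:R * x))).
Proof. by rewrite -expRM_natl; congr expR; ring. Qed.

Definition th2r y : R := 2 * expR (- (pi * y / 4)) * (eul (4 * y) ^+ 2 / eul (2 * y)).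
Definition th3r y : R := eul (2 * y) ^+ 5 / (eul y * eul (4 * y)) ^+ 2.
Definition th4r y : R := eul y ^+ 2 / eul (2 * y).

Lemma th2_th2r y : 0 < y -> th2 y%:C = (th2r y)%:C.
Proof. by move=> y0; rewrite (th2_prod y0) /th2r /eul !nome_pow. Qed.

Lemma th3_th3r y : 0 < y -> th3 y%:C = (th3r y)%:C.
Proof. by move=> y0; rewrite (th3_prod y0) /th3r /eul !nome_pow. Qed.

Lemma th4_th4r y : 0 < y -> th4 y%:C = (th4r y)%:C.
Proof. by move=> y0; rewrite (th4_prod y0) /th4r /eul !nome_pow. Qed.

Lemma th2r_ge0 y : 0 < y -> 0 <= th2r y.
Proof.
move=> y0; rewrite !mulr_ge0 ?expR_ge0 ?exprn_ge0 ?invr_ge0//; apply: ltW; apply: eul_gt0; lra.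
Qed.

Lemma th3r_ge0 y : 0 < y -> 0 <= th3r y.
Proof.
move=> y0; rewrite divr_ge0 ?exprn_ge0 ?mulr_ge0//; apply: ltW; apply: eul_gt0; lra.
Qed.

Lemma th4r_ge0 y : 0 < y -> 0 <= th4r y.
Proof.
move=> y0; rewrite divr_ge0 ?exprn_ge0//; apply: ltW; apply: eul_gt0; lra.
Qed.

Lemma th34r_double y : 0 < y -> th3r y * th4r y = th4r (2 * y) ^+ 2.
Proof.
move=> y0; rewrite /th3r /th4r.
have -> : 2 * (2 * y) = 4 * y by ring.
have h1 : eul y != 0 by rewrite gt_eqF// eul_gt0.
have h2 : eul (2 * y) != 0 by rewrite gt_eqF// eul_gt0//; lra.
have h4 : eul (4 * y) != 0 by rewrite gt_eqF// eul_gt0//; lra.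
by move: (eul y) (eul (2 * y)) (eul (4 * y)) h1 h2 h4 => a b c a0 b0 c0; field; rewrite ?a0 ?b0 ?c0.
Qed.

Lemma th2r_double y : 0 < y -> th2r y ^+ 2 = 2 * (th2r (2 * y) * th3r (2 * y)).
Proof.
move=> y0; rewrite /th2r /th3r.
have -> : 2 * (2 * y) = 4 * y by ring.
have -> : 4 * (2 * y) = 8 * y by ring.
have h2 : eul (2 * y) != 0 by rewrite gt_eqF// eul_gt0//; lra.
have h4 : eul (4 * y) != 0 by rewrite gt_eqF// eul_gt0//; lra.
have h8 : eul (8 * y) != 0 by rewrite gt_eqF// eul_gt0//; lra.
have -> : expR (- (pi * (2 * y) / 4)) = expR (- (pi * y / 4)) ^+ 2.
  by rewrite -expRM_natl; congr expR; field.
move: (expR _) (eul (2 * y)) (eul (4 * y)) (eul (8 * y)) h2 h4 h8 => e a b c a0 b0 c0.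
by field; rewrite ?a0 ?b0 ?c0.
Qed.

Lemma th3r_quadruple y : 0 < y -> th3r y = th3r (4 * y) + th2r (4 * y).
Proof.
move=> y0; have y4 : 0 < 4 * y by lra.
have : th3 y%:C = th3 (4 * y)%:C + th2 (4 * y)%:C; last first.
  rewrite (th3_th3r y0) (th3_th3r y4) (th2_th2r y4) => /(congr1 (@complex.Re R)).
  by rewrite Re_add.
rewrite /th2 /th3; have -> : (4 * y)%:C / 4 = y%:C :> C by field.
by rewrite addrC subrK.
Qed.

Lemma th4r_quadruple y : 0 < y -> th4r y = th3r (4 * y) - th2r (4 * y).
Proof.
move=> y0; have y4 : 0 < 4 * y by lra.
have : th4 y%:C = th3 (4 * y)%:C - th2 (4 * y)%:C; last first.
  rewrite (th4_th4r y0) (th3_th3r y4) (th2_th2r y4) => /(congr1 (@complex.Re R)).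
  by rewrite Re_sub.
rewrite /th2 /th3 /th4; have -> : (4 * y)%:C / 4 = y%:C :> C by field.
have -> : (4 * y)%:C = 4 * y%:C :> C by ring.
ring.
Qed.

(** The values of the four forms on the positive axis. *)
Definition vr y := th2r y ^+ 8 * (th3r y * th4r y).
Definition ur y := th2r y * (th3r y * th4r y ^+ 8).
Definition hr y := th2r y * (th3r y ^+ 8 * th4r y).
Definition gr y := th2r y ^+ 4 * (th3r y ^+ 2 * th4r y ^+ 4).

(** Raising [th2r_double] to the fourth power and [th34r_double] express the
left-hand side at the argument [2 y]. The difference with the first term on the
right contains [th3^2 - th4^2] at [2 y], which is [2 th2^2] at [4 y], and the
duplication formulas once more identify it with the second term. *)
Lemma vr_gr y : 0 < y -> vr y = 16 * (gr (2 * y) + 8 * gr (4 * y)).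
Proof.
move=> y0; have y2 : 0 < 2 * y by lra.
have y4 : 0 < 4 * y by lra.
have e4 : 2 * (2 * y) = 4 * y by ring.
have e8 : 4 * (2 * y) = 2 * (4 * y) by ring.
have := th2r_double y0; have := th34r_double y0; have := th2r_double y2; have := th34r_double y2.
have := th3r_quadruple y2; have := th4r_quadruple y2; have := th2r_double y4.
rewrite e4 e8 /vr /gr.
move: (th2r y) (th3r y) (th4r y) (th2r (2 * y)) (th3r (2 * y)) (th4r (2 * y)) (th2r (4 * y)) (th3r (4 * y)) (th4r (4 * y))
  (th2r (2 * (4 * y))) (th3r (2 * (4 * y))) => a2 a3 a4 b2 b3 b4 c2 c3 c4 d2 d3 h1 h2 h3 h4 h5 h6 h7.
have sq : b3 ^+ 2 - b4 ^+ 2 = 2 * c2 ^+ 2 by rewrite h1 h2 h3; ring.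
have d1 : c2 * c3 = b2 ^+ 2 / 2 by rewrite h5; field.
transitivity ((a2 ^+ 2) ^+ 4 * (a3 * a4)); first by ring.
rewrite h7 h6.
transitivity (16 * (b2 ^+ 4 * b3 ^+ 2 * b4 ^+ 2 * b4 ^+ 2 +
  b2 ^+ 4 * b3 ^+ 2 * b4 ^+ 2 * (b3 ^+ 2 - b4 ^+ 2))); first by ring.
rewrite sq.
have -> : c2 ^+ 4 * (c3 ^+ 2 * c4 ^+ 4) = c2 ^+ 2 * (c2 * c3) ^+ 2 * (c4 ^+ 2) ^+ 2 by ring.
by rewrite d1 -h4; field.
Qed.

Lemma vhat_vr y : 0 < y -> vhat y%:C = (vr y)%:C.
Proof. by move=> y0; rewrite /vhat th2_th2r// th3_th3r// th4_th4r// -!rmorphXn -!rmorphM. Qed.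
Lemma uhat_ur y : 0 < y -> uhat y%:C = (ur y)%:C.
Proof. by move=> y0; rewrite /uhat th2_th2r// th3_th3r// th4_th4r// -!rmorphXn -!rmorphM. Qed.
Lemma hhat_hr y : 0 < y -> hhat y%:C = (hr y)%:C.
Proof. by move=> y0; rewrite /hhat th2_th2r// th3_th3r// th4_th4r// -!rmorphXn -!rmorphM. Qed.
Lemma ghat_gr y : 0 < y -> ghat y%:C = (gr y)%:C.
Proof. by move=> y0; rewrite /ghat th2_th2r// th3_th3r// th4_th4r// -!rmorphXn -!rmorphM. Qed.

Lemma vr_ge0 y : 0 < y -> 0 <= vr y.
Proof.
move=> y0; rewrite /vr; move: (th2r_ge0 y0) (th3r_ge0 y0) (th4r_ge0 y0).
by move: (th2r y) (th3r y) (th4r y) => a b c a0 b0 c0; rewrite !(mulr_ge0, exprn_ge0).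
Qed.
Lemma ur_ge0 y : 0 < y -> 0 <= ur y.
Proof.
move=> y0; rewrite /ur; move: (th2r_ge0 y0) (th3r_ge0 y0) (th4r_ge0 y0).
by move: (th2r y) (th3r y) (th4r y) => a b c a0 b0 c0; rewrite !(mulr_ge0, exprn_ge0).
Qed.
Lemma hr_ge0 y : 0 < y -> 0 <= hr y.
Proof.
move=> y0; rewrite /hr; move: (th2r_ge0 y0) (th3r_ge0 y0) (th4r_ge0 y0).
by move: (th2r y) (th3r y) (th4r y) => a b c a0 b0 c0; rewrite !(mulr_ge0, exprn_ge0).
Qed.
Lemma gr_ge0 y : 0 < y -> 0 <= gr y.
Proof.
move=> y0; rewrite /gr; move: (th2r_ge0 y0) (th3r_ge0 y0) (th4r_ge0 y0).
by move: (th2r y) (th3r y) (th4r y) => a b c a0 b0 c0; rewrite !(mulr_ge0, exprn_ge0).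
Qed.

End OnTheAxis.

(** * Their moments *)

Section Moments.
Context {R : realType}.
Local Notation C := R[i].
Implicit Types (w : C) (t x y : R).

Definition moment (f : C -> C) k I := hasint (fun w => w ^+ k * f w) I.

Lemma expand_cube (b c0 : C) (f : C -> C) (m0 m1 m2 m3 : C) :
  moment f 0 m0 -> moment f 1 m1 -> moment f 2 m2 -> moment f 3 m3 ->
  hasint (fun w => (w + b) ^+ 3 * (c0 * f w))
    (c0 * (m3 + 3 * b * m2 + 3 * b ^+ 2 * m1 + b ^+ 3 * m0)).
Proof.
move=> h0 h1 h2 h3.
have := hasintZ c0 (hasintD (hasintD (hasintD h3 (hasintZ (3 * b) h2)) (hasintZ (3 * b ^+ 2) h1)) (hasintZ (b ^+ 3) h0)).
apply: hasint_ext => w _; ring.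
Qed.

Lemma moment_dilate f k I x : 0 < x -> moment f k I ->
  hasint (fun w => w ^+ k * f (x%:C * w)) ((x%:C ^+ k.+1)^-1 * I).
Proof.
move=> x0 h; have xC := rhp_neq0 (rhp_real x0).
have := hasintZ (x%:C ^- k) (hasint_scale x0 h).
rewrite mulrA -invfM -exprSr; apply: hasint_ext => w _.
by rewrite exprMn -[_ ^+ k * _ * _]mulrA mulKf// expf_neq0.
Qed.

Lemma moment0_hasint f I : moment f 0 I -> hasint f I.
Proof. by apply: hasint_ext => w _; rewrite expr0 mul1r. Qed.

Lemma moment_Im f k I : (forall t, 0 < t -> complex.Im (f t%:C) = 0) -> moment f k I ->
  complex.Im I = 0.
Proof.
move=> fr; apply: hasint_Im => t t0.
by rewrite -rmorphXn Im_scale fr// mulr0.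
Qed.

Lemma real_imag_eq (x y x' y' : R) :
  x%:C + 'i * y%:C = x'%:C + 'i * y'%:C :> C -> x = x' /\ y = y'.
Proof.
move=> e; split.
  by move/(congr1 (@complex.Re R)): e; rewrite !Re_add !Re_mul /=; lra.
by move/(congr1 (@complex.Im R)): e; rewrite !Im_add !Im_mul /=; lra.
Qed.

(** The contour relation for [vhat] gives [h0 = 3 h1]. The one for [uhat] reads
[3 i v2 - 3 v1 - i v0 = - zeta h0], where all moments are real and [v0 = 40
g0], [v1 = 12 g1], [v2 = 4 g1]; its two real equations are [36 g1 = h0 / sqrt
2] and [40 g0 - 12 g1 = h0 / sqrt 2]. The common factor [m] is [g1]. *)
Lemma moment_values : exists m : R, let s := Num.sqrt 2 in
  [/\ [/\ moment ghat 0 (6 / 5 * m)%:C, moment ghat 1 m%:C, moment ghat 2 m%:C &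
          moment ghat 3 (6 / 5 * m)%:C],
      [/\ moment vhat 0 (48 * m)%:C, moment vhat 1 (12 * m)%:C, moment vhat 2 (4 * m)%:C &
          moment vhat 3 (9 / 5 * m)%:C],
      [/\ moment uhat 0 (9 / 5 * m)%:C, moment uhat 1 (4 * m)%:C, moment uhat 2 (12 * m)%:C &
          moment uhat 3 (48 * m)%:C] &
      [/\ moment hhat 0 (36 * s * m)%:C, moment hhat 1 (12 * s * m)%:C,
          moment hhat 2 (12 * s * m)%:C & moment hhat 3 (36 * s * m)%:C]].
Proof.
have [g0 [hg0 hg3]] := moment_exists (leq0n 3) ghat_qcusp ghat_qcusp (@ghat_ghat R).
have [g1 [hg1 hg2]] := moment_exists (isT : (1 <= 3)%N) ghat_qcusp ghat_qcusp (@ghat_ghat R).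
have [h0 [hh0 hh3]] := moment_exists (leq0n 3) hhat_qcusp hhat_qcusp (@hhat_hhat R).
have [h1 [hh1 hh2]] := moment_exists (isT : (1 <= 3)%N) hhat_qcusp hhat_qcusp (@hhat_hhat R).
have [v0 [hv0 hu3]] := moment_exists (leq0n 3) vhat_qcusp uhat_qcusp (@vhat_uhat R).
have [v1 [hv1 hu2]] := moment_exists (isT : (1 <= 3)%N) vhat_qcusp uhat_qcusp (@vhat_uhat R).
have [v2 [hv2 hu1]] := moment_exists (isT : (2 <= 3)%N) vhat_qcusp uhat_qcusp (@vhat_uhat R).
have [v3 [hv3 hu0]] := moment_exists (isT : (3 <= 3)%N) vhat_qcusp uhat_qcusp (@vhat_uhat R).
have i2 : ('i%R : C) ^+ 2 = -1 by exact: sqr_i.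
have vk k I J : moment vhat k I -> moment ghat k J ->
    I = 16 * ((2 ^+ k.+1)^-1 * J + 8 * ((4 ^+ k.+1)^-1 * J)).
  move=> hI hJ.
  have d2 := moment_dilate (ltr0Sn R 1) hJ; have d4 := moment_dilate (ltr0Sn R 3) hJ.
  rewrite !natrC in d2 d4.
  have := hasintZ 16 (hasintD d2 (hasintZ 8 d4)).
  apply: hasint_unique hI => t t0.
  have t20 : 0 < 2 * t by lra.
  have t40 : 0 < 4 * t by lra.
  have e2 : 2 * t%:C = (2 * t)%:C :> C by ring.
  have e4 : 4 * t%:C = (4 * t)%:C :> C by ring.
  rewrite e2 e4 vhat_vr// !ghat_gr// vr_gr//.
  move: (gr (2 * t)) (gr (4 * t)) (t%:C ^+ k) => a b c; ring.
have ev0 := vk _ _ _ hv0 hg0; have ev1 := vk _ _ _ hv1 hg1.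
have ev2 := vk _ _ _ hv2 hg2; have ev3 := vk _ _ _ hv3 hg3.
have Ni0 : complex.Re (- 'i : C) = 0 by rewrite /= oppr0.
have i0 : complex.Re ('i%R : C) = 0 by [].
have Ni2 : (- 'i : C) ^+ 2 = -1 by rewrite sqrrN.
have vsh w : rhp w -> vhat (w - - 'i) = 1 * vhat w.
  move=> w0; rewrite opprK mul1r -(vhat_shift (_ : rhp (w + 'i))).
    by rewrite addrK.
  by rewrite /rhp Re_add i0 addr0.
have cA := contour Ni0 Ni2 vhat_qcusp uhat_qcusp (@vhat_uhat R) vhat_qcusp uhat_qcusp (@vhat_uhat R) vsh
   (moment0_hasint hv0) (moment0_hasint hv0).
have cB := contour i0 i2 uhat_qcusp vhat_qcusp (invpair_sym (@vhat_uhat R)) hhat_qcusp hhat_qcusp (@hhat_hhat R)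
   (@uhat_shift R) (moment0_hasint hu0) (moment0_hasint hh0).
have eA := hasint_unique (fun t _ => erefl) (expand_cube (- 'i) zeta hh0 hh1 hh2 hh3)
   (hasint_ext (fun w hw => congr1 _ (uhat_shift hw)) cA).
have vsh' w : rhp w -> (w + 'i) ^+ 3 * vhat (w + 'i) = (w + 'i) ^+ 3 * (1 * vhat w).
  by move=> hw; congr (_ * _); have := vsh w hw; rewrite opprK.
have eB := hasint_unique (fun t _ => erefl) (expand_cube 'i%R 1 hv0 hv1 hv2 hv3)
   (hasint_ext vsh' cB).
have z0 : zeta != 0 :> C by exact: expC_neq0.
have i10 : 1 + 'i != 0 :> C.
  apply/eqP => /(congr1 (@complex.Im R)); rewrite Im_add /= add0r => /eqP.
  by rewrite oner_eq0.
have h0E : h0 = 3 * h1.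
  apply: (mulfI z0); apply: (mulfI i10); apply/eqP; rewrite -subr_eq0; apply/eqP.
  transitivity (zeta * (h0 + 3 * (- 'i) * h1 + 3 * (- 'i) ^+ 2 * h1 + (- 'i) ^+ 3 * h0)).
    by rewrite (exprS (- 'i) 2) Ni2; move: (zeta) ('i%R) => a d; ring.
  by rewrite eA mul1r subrr.
have real_form (f : C -> C) (r : R -> R) : (forall t, 0 < t -> f t%:C = (r t)%:C) ->
   forall t, 0 < t -> complex.Im (f t%:C) = 0.
  by move=> fr t t0; rewrite fr.
have ig1 := moment_Im (real_form _ _ (@ghat_gr R)) hg1.
have ig0 := moment_Im (real_form _ _ (@ghat_gr R)) hg0.
have ih1 := moment_Im (real_form _ _ (@hhat_hr R)) hh1.
have real_C (z : C) : complex.Im z = 0 -> z = (complex.Re z)%:C by case: z => a b /= ->.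
have g1E := real_C _ ig1; have g0E := real_C _ ig0; have h1E := real_C _ ih1.
move: (complex.Re g1) (complex.Re g0) (complex.Re h1) g1E g0E h1E => a b c g1E g0E h1E.
have v0E : v0 = (40 * b)%:C by rewrite ev0 g0E; field.
have v1E : v1 = (12 * a)%:C by rewrite ev1 g1E; field.
have v2E : v2 = (4 * a)%:C by rewrite ev2 g1E; field.
have v3E : v3 = (3 / 2 * b)%:C by rewrite ev3 g0E; field.
have s0 : 0 < Num.sqrt 2 :> R by rewrite sqrtr_gt0.
have sn : Num.sqrt 2 != 0 :> R by rewrite gt_eqF.
have three : v3 + 3 * 'i * v2 + 3 * 'i ^+ 2 * v1 + 'i%R ^+ 3 * v0 = v3 - zeta * h0.
  by rewrite -eB mul1r.
have eC : 3 * 'i * v2 - 3 * v1 - 'i * v0 = - (zeta * h0).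
  have : 3 * 'i * v2 + 3 * 'i ^+ 2 * v1 + 'i ^+ 3 * v0 = - (zeta * h0).
    by apply: (addrI v3); rewrite !addrA.
  by rewrite (exprS 'i%R 2) i2 => <-; move: ('i%R) => d; ring.
(* both components of [zeta * h0] *)
pose k := (Num.sqrt 2)^-1 * (3 * c).
have [e1 e2] : - (36 * a) = - k /\ 12 * a - 40 * b = - k.
  apply: real_imag_eq; move: eC; rewrite h0E zetaE v0E v1E v2E h1E /k.
  move: ('i%R) (Num.sqrt 2) sn => ii s sn eC.
  transitivity (3 * ii * (4 * a)%:C - 3 * (12 * a)%:C - ii * (40 * b)%:C); first by ring.
  by rewrite eC; ring.
have bE : b = 6 / 5 * a by lra.
have cE : c = 12 * Num.sqrt 2 * a.
  have -> : 12 * Num.sqrt 2 * a = Num.sqrt 2 * (36 * a) / 3 by field.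
  by rewrite (oppr_inj e1) /k; field.
rewrite bE in g0E v0E v3E; rewrite cE in h1E.
exists a => /=.
have <- : v0 = (48 * a)%:C by rewrite v0E; congr (_%:C); field.
have <- : v3 = (9 / 5 * a)%:C by rewrite v3E; congr (_%:C); field.
have <- : h0 = (36 * Num.sqrt 2 * a)%:C by rewrite h0E h1E; ring.
by rewrite -g1E -g0E -v1E -v2E -h1E.
Qed.

End Moments.

(** * Eta quotients on the imaginary axis *)

Section EtaAxis.
Context {R : realType}.
Local Notation C := R[i].
Implicit Types (t x y : R).

Lemma normC_normc (z : C) : `|z| = (normc z)%:C.
Proof. by rewrite normc_def; case: z. Qed.

(** Limits of real sequences in the topology of [R[i]^o], the one that [eta]
uses. *)
Lemma lim_real (u : nat -> R) (l : R) : u @ \oo --> l ->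
  lim ((fun N => (u N)%:C : R[i]^o) @ \oo) = l%:C.
Proof.
move=> ul; apply: cvg_lim; first exact: norm_hausdorff.
apply/cvgrPdist_lt => e e0.
have er : e = (complex.Re e)%:C.
  by move: e0; rewrite ltcE /= => /andP[/eqP ei _]; case: (e) ei => a b /= ->.
have re0 : 0 < complex.Re e by move: e0; rewrite er ltcR.
move/cvgrPdist_lt: ul => /(_ _ re0); apply: filterS => n h.
by rewrite er -rmorphB normC_normc normc_real ltcR.
Qed.

Lemma qexp_axis y : qexp (0 +i* y) = (expR (- (pi * (2 * y))))%:C.
Proof.
rewrite /qexp -expC_real; congr expC.
by apply/eqP; rewrite eq_complex /=; apply/andP; split; apply/eqP; ring.
Qed.

Lemma eta_axis y : 0 < y -> eta (0 +i* y) = (expR (- (pi * y / 12)) * eul (2 * y))%:C.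
Proof.
move=> y0; have y2 : 0 < 2 * y by lra.
rewrite /eta rmorphM; congr (_ * _).
  have -> : (0 +i* y) / 24 = 0 +i* (y / 24) :> C.
    by rewrite -(@natrC R 24) -fmorphV; apply/eqP; rewrite eq_complex /=; apply/andP; split; apply/eqP; ring.
  by rewrite qexp_axis; congr (expR _)%:C; field.
have -> : (fun N => \prod_(1 <= n < N.+1) (1 - qexp (0 +i* y) ^+ n)) =
    (fun N => (qpoch (expR (- (pi * (2 * y)))) N)%:C) :> (nat -> C).
  apply: funext => N; rewrite qexp_axis /qpoch rmorph_prod big_add1 big_mkord.
  by apply: eq_bigr => i _; rewrite rmorphB rmorph1 rmorphXn.
exact: lim_real (qpoch_cvg (nome_in01 y2)).
Qed.

Lemma eta_scale (k : nat) t : 0 < t -> (0 < k)%N ->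
  eta (k%:R * (0 +i* t)) = (expR (- (pi * t / 12)) ^+ k * eul (2 * (k%:R * t)))%:C.
Proof.
move=> t0 k0; have kt : 0 < k%:R * t by rewrite mulr_gt0// ltr0n.
have -> : k%:R * (0 +i* t) = 0 +i* (k%:R * t) :> C.
  by rewrite -natrC; apply/eqP; rewrite eq_complex /=; apply/andP; split; apply/eqP; ring.
by rewrite eta_axis// -expRM_natl; congr (expR _ * _)%:C; ring.
Qed.

Lemma h_axis t : 0 < t -> h (0 +i* t) = (2^-1 * hr (8 * t))%:C.
Proof.
move=> t0; rewrite /h !eta_scale// /hr /th2r /th3r /th4r.
have e8 : 2 * (4 * t) = 8 * t by ring.
have e16 : 2 * (8 * t) = 16 * t by ring.
have e32 : 2 * (16 * t) = 32 * t by ring.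
have e32' : 4 * (8 * t) = 32 * t by ring.
rewrite e8 e16 e32 e32'.
have -> : expR (- (pi * (8 * t) / 4)) = expR (- (pi * t / 12)) ^+ 24.
  by rewrite -expRM_natl; congr expR; field.
have h0 : 0 < expR (- (pi * t / 12)) by exact: expR_gt0.
have h1 : 0 < eul (8 * t) by apply: eul_gt0; lra.
have h2 : 0 < eul (16 * t) by apply: eul_gt0; lra.
have h3 : 0 < eul (32 * t) by apply: eul_gt0; lra.
move: (expR _) (eul _) (eul _) (eul _) h0 h1 h2 h3 => a b c d a0 b0 c0 d0.
rewrite -!rmorphXn -rmorphM -fmorphV -rmorphM; congr (_%:C).
by field; rewrite !gt_eqF.
Qed.

Lemma u_axis t : 0 < t -> u (0 +i* t) = (2^-1 * ur (8 * t))%:C.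
Proof.
move=> t0; rewrite /u !eta_scale// /ur /th2r /th3r /th4r.
have e8 : 2 * (4 * t) = 8 * t by ring.
have e16 : 2 * (8 * t) = 16 * t by ring.
have e32' : 4 * (8 * t) = 32 * t by ring.
rewrite e8 e16 e32'.
have -> : expR (- (pi * (8 * t) / 4)) = expR (- (pi * t / 12)) ^+ 24.
  by rewrite -expRM_natl; congr expR; field.
have h0 : 0 < expR (- (pi * t / 12)) by exact: expR_gt0.
have h1 : 0 < eul (8 * t) by apply: eul_gt0; lra.
have h2 : 0 < eul (16 * t) by apply: eul_gt0; lra.
have h3 : 0 < eul (32 * t) by apply: eul_gt0; lra.
move: (expR _) (eul _) (eul _) (eul _) h0 h1 h2 h3 => a b c d a0 b0 c0 d0.
rewrite -!rmorphXn -fmorphV -rmorphM; congr (_%:C).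
by field; rewrite !gt_eqF.
Qed.

Lemma v_axis t : 0 < t -> v (0 +i* t) = (256^-1 * vr (1 * t))%:C.
Proof.
move=> t0; rewrite /v eta_scale// eta_axis// mul1r /vr /th2r /th3r /th4r.
have e4 : 2 * (2 * t) = 4 * t by ring.
rewrite e4.
have -> : expR (- (pi * t / 4)) = expR (- (pi * t / 12)) ^+ 3.
  by rewrite -expRM_natl; congr expR; field.
have h0 : 0 < expR (- (pi * t / 12)) by exact: expR_gt0.
have h1 : 0 < eul (1 * t) by apply: eul_gt0; lra.
have h2 : 0 < eul (2 * t) by apply: eul_gt0; lra.
have h3 : 0 < eul (4 * t) by apply: eul_gt0; lra.
rewrite mul1r in h1.
move: (expR _) (eul _) (eul _) (eul _) h0 h1 h2 h3 => a b c d a0 b0 c0 d0.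
rewrite -!rmorphXn -fmorphV -rmorphM; congr (_%:C).
by field; rewrite !gt_eqF.
Qed.

Lemma g_axis t : 0 < t -> g (0 +i* t) = (16^-1 * gr (2 * t))%:C.
Proof.
move=> t0; rewrite /g !eta_scale// eta_axis// /gr /th2r /th3r /th4r.
have e4 : 2 * (2 * t) = 4 * t by ring.
have e8 : 2 * (4 * t) = 8 * t by ring.
have e8' : 4 * (2 * t) = 8 * t by ring.
rewrite e4 e8 e8'.
have -> : expR (- (pi * (2 * t) / 4)) = expR (- (pi * t / 12)) ^+ 6.
  by rewrite -expRM_natl; congr expR; field.
have h0 : 0 < expR (- (pi * t / 12)) by exact: expR_gt0.
have h1 : 0 < eul (2 * t) by apply: eul_gt0; lra.
have h2 : 0 < eul (4 * t) by apply: eul_gt0; lra.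
have h3 : 0 < eul (8 * t) by apply: eul_gt0; lra.
move: (expR _) (eul _) (eul _) (eul _) h0 h1 h2 h3 => a b c d a0 b0 c0 d0.
rewrite -!rmorphXn -!rmorphM; congr (_%:C).
by field; rewrite !gt_eqF.
Qed.

(** The Mellin integral of [f] is a moment of [X] after the substitution of [m
t] for [t]. *)
Lemma L_value (f X Y : C -> C) (rho : R -> R) (c m : R) k I :
  (k <= 3)%N -> 0 < m -> 0 <= c ->
  qcusp X -> qcusp Y -> invpair X Y ->
  (forall t, 0 < t -> X t%:C = (rho t)%:C) -> (forall t, 0 < t -> 0 <= rho t) ->
  (forall t, 0 < t -> f (0 +i* t) = (c * rho (m * t))%:C) -> moment X k I ->
  L f k.+1 = ((2 * pi) ^+ k.+1 / k`!%:R * (c / m ^+ k.+1 * complex.Re I))%:C.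
Proof.
move=> k3 m0 c0 hX hY hXY Xr r0 fX hI.
have mC : m%:C != 0 :> C by exact: rhp_neq0 (rhp_real m0).
pose al : R := c / m ^+ k.
have al0 : 0 <= al by rewrite divr_ge0// exprn_ge0// ltW.
pose F (w : C) : C := (m%:C * w) ^+ k * X (m%:C * w).
have hF := hasintZ al%:C (hasint_scale m0 hI).
rewrite rmorphM /L; congr (_ * _).
have frho t : 0 < t -> al%:C * F t%:C = (c * rho (m * t) * t ^+ k)%:C.
  move=> t0; rewrite /F -rmorphM Xr ?mulr_gt0// -rmorphXn -!rmorphM; congr (_%:C).
  by rewrite /al exprMn; move: (rho _) => r; field; rewrite expf_neq0// gt_eqF.
have key : \int[lebesgue_measure]_(t in `]0, +oo[) (c * rho (m * t) * t ^+ k) = complex.Re (al%:C * (m%:C^-1 * I)).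
  apply: (Rintegral_hasint (f := fun w => al%:C * F w)) => //.
  - by move=> t t0; rewrite !mulr_ge0 ?exprn_ge0 ?r0 ?mulr_gt0// ltW.
  - move=> t t0; have [d hd] := moment_cder k hX (mulr_gt0 m0 t0).
    rewrite rmorphM in hd.
    by eexists; apply: cderZ; apply: cder_comp (cderZ m%:C (cder_id _)) hd.
  - have -> : 0 = al%:C * 0 :> C by rewrite mulr0.
    apply: lim0Z; apply: lim0_eq (lim0_scale m0 (moment_lim0 k3 hY hXY)) => t t0.
    by rewrite /F rmorphM.
have reI : complex.Re (al%:C * (m%:C^-1 * I)) = c / m ^+ k.+1 * complex.Re I.
  rewrite -real_complexV !Re_scale mulrA; congr (_ * _).
  by rewrite /al exprS; field; rewrite expf_neq0 gt_eqF.
rewrite /Cintegral; apply/eqP; rewrite eq_complex /=; apply/andP; split; apply/eqP.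
  rewrite -reI -key; apply: eq_Rintegral => t; rewrite inE /= in_itv /= andbT => t0.
  by rewrite fX// -rmorphM.
rewrite (@eq_Rintegral _ _ _ _ _ (fun=> 0)).
  by rewrite Rintegral_cst// mul0r.
move=> t; rewrite inE /= in_itv /= andbT => t0.
by rewrite fX// -rmorphM.
Qed.

End EtaAxis.

(** * The critical values *)

Section LValues.
Context {R : realType}.
Local Notation C := R[i].

Lemma L_h k (r : R) : (k <= 3)%N -> moment hhat k r%:C ->
  L h k.+1 = ((2 * pi) ^+ k.+1 / k`!%:R * (2^-1 / 8 ^+ k.+1 * r))%:C.
Proof.
move=> k3 hk; have c0 : 0 <= 2^-1 :> R by rewrite invr_ge0 ler0n.
exact: (L_value k3 (ltr0Sn R 7) c0 (@hhat_qcusp R) (@hhat_qcusp R) (@hhat_hhat R) (@hhat_hr R)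
  (@hr_ge0 R) (@h_axis R) hk).
Qed.

Lemma L_u k (r : R) : (k <= 3)%N -> moment uhat k r%:C ->
  L u k.+1 = ((2 * pi) ^+ k.+1 / k`!%:R * (2^-1 / 8 ^+ k.+1 * r))%:C.
Proof.
move=> k3 hk; have c0 : 0 <= 2^-1 :> R by rewrite invr_ge0 ler0n.
exact: (L_value k3 (ltr0Sn R 7) c0 (@uhat_qcusp R) (@vhat_qcusp R) (invpair_sym (@vhat_uhat R)) (@uhat_ur R)
  (@ur_ge0 R) (@u_axis R) hk).
Qed.

Lemma L_v k (r : R) : (k <= 3)%N -> moment vhat k r%:C ->
  L v k.+1 = ((2 * pi) ^+ k.+1 / k`!%:R * (256^-1 / 1 ^+ k.+1 * r))%:C.
Proof.
move=> k3 hk; have c0 : 0 <= 256^-1 :> R by rewrite invr_ge0 ler0n.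
exact: (L_value k3 (ltr0Sn R 0) c0 (@vhat_qcusp R) (@uhat_qcusp R) (@vhat_uhat R) (@vhat_vr R)
  (@vr_ge0 R) (@v_axis R) hk).
Qed.

Lemma L_g k (r : R) : (k <= 3)%N -> moment ghat k r%:C ->
  L g k.+1 = ((2 * pi) ^+ k.+1 / k`!%:R * (16^-1 / 2 ^+ k.+1 * r))%:C.
Proof.
move=> k3 hk; have c0 : 0 <= 16^-1 :> R by rewrite invr_ge0 ler0n.
exact: (L_value k3 (ltr0Sn R 1) c0 (@ghat_qcusp R) (@ghat_qcusp R) (@ghat_ghat R) (@ghat_gr R)
  (@gr_ge0 R) (@g_axis R) hk).
Qed.

End LValues.

Theorem corollary3p3 (R : realType) :
  [/\ L (@h R) 4 = (pi / 4)%:C * L h 3,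
      (pi / 4)%:C * L h 3 = (pi ^+ 2 / 32)%:C * L (@h R) 2 &
      (pi ^+ 2 / 32)%:C * L h 2 = (pi ^+ 3 / 384)%:C * L (@h R) 1] /\
  [/\ L (@u R) 4 = (pi / 3)%:C * L u 3,
      (pi / 3)%:C * L u 3 = (pi ^+ 2 / 8)%:C * L (@u R) 2 &
      (pi ^+ 2 / 8)%:C * L u 2 = (5 * pi ^+ 3 / 72)%:C * L (@u R) 1] /\
  [/\ L (@v R) 4 = (3 * pi / 10)%:C * L v 3,
      (3 * pi / 10)%:C * L v 3 = (pi ^+ 2 / 10)%:C * L (@v R) 2 &
      (pi ^+ 2 / 10)%:C * L v 2 = (pi ^+ 3 / 20)%:C * L (@v R) 1] /\
  L (@u R) 4 = (2 * Num.sqrt 2 / 3)%:C * L h 4 /\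
  L (@v R) 4 = (6 / 5)%:C * L u 4 /\
  [/\ L (@g R) 4 = (2 * pi / 5)%:C * L g 3,
      (2 * pi / 5)%:C * L g 3 = (pi ^+ 2 / 5)%:C * L (@g R) 2 &
      (pi ^+ 2 / 5)%:C * L g 2 = (pi ^+ 3 / 6)%:C * L (@g R) 1] /\
  L (@h R) 4 = (15 / (8 * Num.sqrt 2))%:C * L g 4.
Proof.
have [m [[g0 g1 g2 g3] [v0 v1 v2 v3] [u0 u1 u2 u3] [h0 h1 h2 h3]]] := @moment_values R.
have s0 : Num.sqrt 2 != 0 :> R by rewrite gt_eqF// sqrtr_gt0.
have ss : Num.sqrt 2 * Num.sqrt 2 = 2 :> R by rewrite -expr2 sqr_sqrtr.
have f0 : 0`!%:R = 1 :> R by [].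
have f1 : 1`!%:R = 1 :> R by [].
have f2 : 2`!%:R = 2 :> R by [].
have f3 : 3`!%:R = 6 :> R by [].
split.
  rewrite (L_h _ h0)// (L_h _ h1)// (L_h _ h2)// (L_h _ h3)// ?f0 ?f1 f2 f3 -!rmorphM.
  by move: (Num.sqrt 2) (pi) => s p; split; congr (_%:C); field.
split.
  rewrite (L_u _ u0)// (L_u _ u1)// (L_u _ u2)// (L_u _ u3)// ?f0 ?f1 f2 f3 -!rmorphM.
  by move: (pi) => p; split; congr (_%:C); field.
split.
  rewrite (L_v _ v0)// (L_v _ v1)// (L_v _ v2)// (L_v _ v3)// ?f0 ?f1 f2 f3 -!rmorphM.
  by move: (pi) => p; split; congr (_%:C); field.
split.
  rewrite [LHS](L_u _ u3)// [X in _ = _ * X](L_h _ h3)// f3 -rmorphM; congr (_%:C).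
  move: (Num.sqrt 2) (pi) s0 ss => s p s0 ss.
  transitivity ((2 * p) ^+ 4 / 6 / 2 / 8 ^+ 4 * 24 * (s * s) * m); last by field.
  by rewrite ss; field.
split.
  rewrite [LHS](L_v _ v3)// [X in _ = _ * X](L_u _ u3)// f3 -rmorphM; congr (_%:C).
  by move: (pi) => p; field.
split.
  rewrite (L_g _ g0)// (L_g _ g1)// (L_g _ g2)// (L_g _ g3)// ?f0 ?f1 f2 f3 -!rmorphM.
  by move: (pi) => p; split; congr (_%:C); field.
rewrite [LHS](L_h _ h3)// [X in _ = _ * X](L_g _ g3)// f3 -rmorphM; congr (_%:C).
move: (Num.sqrt 2) (pi) s0 ss => s p s0 ss.
transitivity ((2 * p) ^+ 4 / 6 / 2 / 8 ^+ 4 * 36 * (s * s) * m / s); first by field.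
by rewrite ss; field.
Qed.
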